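(* If $f:(V,\pi)\to(V',\pi')$ is a $\mathrm{Lod}_\infty$ quasi-isomorphism, it admits a quasi-inverse, i.e. there exists a $\mathrm{Lod}_\infty$ quasi-isomorphism $g:(V',\pi')\to(V,\pi)$ which induces the inverse isomorphism in cohomology, i.e. $g_{1\,\sharp}=(f_{1\,\sharp})^{-1}$.
   Context: Vector spaces are over a field $\mathbb{K}$ of characteristic $0$ and are $\mathbb{Z}^n$-graded; $\langle\alpha,\beta\rangle=\sum_i\alpha_i\beta_i$; a homogeneous vector or map and its degree/weight are denoted by the same symbol; $e_1=(1,0,\ldots,0)\in\mathbb{Z}^n$. Tensor coalgebra. For a graded space $W$, $T(W)=\bigoplus_{p\ge1}W^{\otimes p}$, $\mathbb{Z}^n$-graded by total degree, with coproduct $\Delta(w_1\otimes\ldots\otimes w_p)=\sum_{I\cup J=N^{(p-1)},\,I\ne\emptyset}\varepsilon_W(I;J)W_I\bigotimes W_J\otimes w_p$. Here $N^{(p)}=(1,\ldots,p)$, $I,J$ are disjoint naturally ordered subsets with the given union, $W_I=w_{i_1}\otimes\ldots\otimes w_{i_{|I|}}$, and $\varepsilon_W(I;J)$ is the Koszul sign of the rearrangement of $(W_I,W_J)$ into increasing index order. Tensor products of maps: $(f\otimes g)(v_1\otimes v_2)=(-1)^{\langle g,v_1\rangle}f(v_1)\otimes g(v_2)$. A weight $Q$ coderivation is a weight $Q$ linear map with $\Delta Q=(Q\otimes\mathrm{id}+\mathrm{id}\otimes Q)\Delta$; a codifferential is a coderivation with $Q^2=0$. A cohomomorphism $\mathcal{F}:(T(W),\Delta)\to(T(W'),\Delta)$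 is a weight $0$ linear map with $\Delta\mathcal{F}=(\mathcal{F}\otimes\mathcal{F})\Delta$. Coderivations and cohomomorphisms are uniquely determined by their corestrictions (restriction to $W^{\otimes p}$ followed by projection onto $W$, resp. $W'$). Desuspension. $\downarrow V$ is $V$ with grading $(\downarrow V)^\alpha=V^{\alpha+e_1}$; $\downarrow:V\to\downarrow V$ has weight $-e_1$ and inverse $\uparrow$; $\downarrow^{\otimes p}=\downarrow\otimes\ldots\otimes\downarrow$. A $\mathrm{Lod}_\infty$ algebra is a graded space $V$ with a codifferential $Q$ of weight $e_1$ on $(T(\downarrow V),\Delta)$. It is represented by the sequence $\pi=(\pi_1,\pi_2,\ldots)$ of multilinear structure maps $\pi_p=\uparrow\circ Q_p\circ\downarrow^{\otimes p}:V^{\times p}\to V$ of weight $(2-p)e_1$; in particular $\pi_1^2=0$. A $\mathrm{Lod}_\infty$ morphism from $(V,Q)$ to $(V',Q')$ is a cohomomorphism $\mathcal{F}:T(\downarrow V)\to T(\downarrow V')$ with $Q'\mathcal{F}=\mathcal{F}Q$. It is represented by the sequence $f=(f_1,f_2,\ldots)$, $f_p=\uparrow\circ\mathcal{F}_p\circ\downarrow^{\otimes p}:V^{\times p}\to V'$ of weight $(1-p)e_1$; then $f_1:(V,\pi_1)\to(V',\pi'_1)$ is a chain map, with induced map $f_{1\sharp}:H(V,\pi_1)\to H(V',\pi'_1)$, where $H(V,\pi_1)=\ker\pi_1/\mathrm{im}\,\pi_1$. The morphism $f$ is a $\mathrm{Lod}_\infty$ quasi-isomorphism if $f_{1\sharp}$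 is an isomorphism. *)

(* Defs.v *)
From HB Require Import structures.
From mathcomp Require Import all_boot all_order all_algebra.
From mathcomp Require Import boolp.
From mathcomp.multinomials Require Import freeg.

Set Implicit Arguments.
Unset Strict Implicit.
Unset Printing Implicit Defensive.

Import GRing.Theory.
Local Open Scope ring_scope.
Local Open Scope quotient_scope.

Section LinearQuotient.
Variables (K : fieldType) (M : lmodType K) (R : M -> Prop).

Definition lspan : {pred M} := fun x =>
  `[< forall P : {pred M}, submod_closed P ->
      (forall y, R y -> y \in P) -> x \in P >].

Lemma lspan_closed : submod_closed lspan.
Proof.
split=> [|a x y /asboolP hx /asboolP hy]; apply/asboolP=> P hP hR.
  by case: hP.
by case: (hP) => _; apply; [apply: hx|apply: hy].
Qed.

HB.instance Definition _ := GRing.isSubmodClosed.Build K M lspan lspan_closed.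

Lemma lspan_gen x : R x -> x \in lspan.
Proof. by move=> Rx; apply/asboolP=> P _; apply. Qed.

Lemma lspan_ind (P : {pred M}) : submod_closed P ->
  (forall y, R y -> y \in P) -> {subset lspan <= P}.
Proof. by move=> hP hR x /asboolP; apply. Qed.

(* M modulo the submodule generated by R *)
Definition lquot : Type := Quotient.quot lspan.
HB.instance Definition _ := Choice.on lquot.
HB.instance Definition _ := GRing.Zmodule.on lquot.

Definition lpi (x : M) : lquot := \pi_(Quotient.quot lspan) x.
Definition lrepr (x : lquot) : M := repr (x : Quotient.quot lspan).

Lemma lreprK : cancel lrepr lpi. Proof. exact: reprK. Qed.

Lemma lpi_eq x y : (lpi x == lpi y) = (x - y \in lspan).
Proof. by rewrite Quotient.idealrBE. Qed.

Lemma lpiP x y : lpi x = lpi y <-> x - y \in lspan.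
Proof. by rewrite -lpi_eq; split=> /eqP. Qed.

Lemma lpiD x y : lpi (x + y) = lpi x + lpi y.
Proof. exact: Quotient.pi_add. Qed.

Definition lquot_scale (a : K) (x : lquot) : lquot := lpi (a *: lrepr x).

Lemma lpiZ a x : lpi (a *: x) = lquot_scale a (lpi x).
Proof.
by apply/lpiP; rewrite -scalerBr rpredZ //; apply/lpiP; rewrite lreprK.
Qed.

Fact lquot_scaleA a b x :
  lquot_scale a (lquot_scale b x) = lquot_scale (a * b) x.
Proof. by rewrite -[x]lreprK -!lpiZ scalerA. Qed.
Fact lquot_scale1 : left_id 1 lquot_scale.
Proof. by move=> x; rewrite -[x]lreprK -!lpiZ scale1r. Qed.
Fact lquot_scaleDr : right_distributive lquot_scale +%R.
Proof.
by move=> a x y; rewrite -[x]lreprK -[y]lreprK -lpiD -!lpiZ -lpiD scalerDr.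
Qed.
Fact lquot_scaleDl x : {morph lquot_scale^~ x : a b / a + b}.
Proof. by move=> a b /=; rewrite -[x]lreprK -!lpiZ -lpiD scalerDl. Qed.

HB.instance Definition _ := GRing.Zmodule_isLmodule.Build K lquot
  lquot_scaleA lquot_scale1 lquot_scaleDr lquot_scaleDl.

Fact lpi_linear : linear lpi.
Proof. by move=> a x y; rewrite lpiD lpiZ. Qed.
HB.instance Definition _ := GRing.isLinear.Build K M lquot _ lpi lpi_linear.

Section Lift.
Variables (N : lmodType K) (f : {linear M -> N}).
Hypothesis fR : forall x, R x -> f x = 0.

Definition llift of (forall x, R x -> f x = 0) :=
  fun x : lquot => f (lrepr x).

Lemma lspan_ker x : x \in lspan -> f x = 0.
Proof.
pose P : {pred M} := [pred x | f x == 0].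
move=> xR; apply/eqP; apply: (lspan_ind (P := P)) xR => [|y Ry].
  split; rewrite ?inE ?linear0 // => a u v.
  by rewrite !inE linearP => /eqP-> /eqP->; rewrite scaler0 addr0.
by rewrite inE fR.
Qed.

Lemma lliftE x : llift fR (lpi x) = f x.
Proof.
apply/eqP; rewrite -subr_eq0 -linearB lspan_ker //.
by apply/lpiP; rewrite lreprK.
Qed.

Fact llift_linear : linear (llift fR).
Proof.
move=> a x y; rewrite -[x]lreprK -[y]lreprK -linearP !lliftE.
by rewrite linearP.
Qed.
HB.instance Definition _ := GRing.isLinear.Build K lquot N _
  (llift fR) llift_linear.
End Lift.
End LinearQuotient.
Arguments llift : simpl never.

Section Presentation.
Variables (K : fieldType) (X : choiceType).

Fact fglift_linear (M : lmodType K) (phi : X -> M) :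
  linear (fglift phi : {freeg X / K} -> M).
Proof.
have liftB : {morph fglift phi : x y / x - y}.
  by apply: (@lift_is_additive K X M phi).
have liftD : {morph fglift phi : x y / x + y}.
  have lift0 : fglift phi 0 = 0 by rewrite -(subrr 0) liftB subrr.
  by move=> x y; rewrite -[y in LHS]opprK -[- y]sub0r !liftB lift0 sub0r opprK.
have lift_sum s (F : X -> K) :
  fglift phi (\sum_(x <- s) << F x *g x >>) = \sum_(x <- s) F x *: phi x.
  elim: s => [|x s IH]; first by rewrite !big_nil -(subrr 0) liftB subrr.
  by rewrite !big_cons liftD IH liftU.
move=> a x y; rewrite liftD; congr (_ + _).
rewrite -[in RHS](freeg_sumE x) !lift_sum scaler_sumr.
by apply: eq_bigr => z _; rewrite scalerA.
Qed.
HB.instance Definition _ (M : lmodType K) (phi : X -> M) :=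
  GRing.isLinear.Build K {freeg X / K} M _ (fglift phi) (fglift_linear phi).

Variable R : {freeg X / K} -> Prop.

(* the K-module with generators X and relations R *)
Definition pres : lmodType K := lquot R.
Definition pgen (x : X) : pres := lpi R << x >>.

Definition plift (M : lmodType K) (phi : X -> M)
    (phiR : forall y, R y -> fglift phi y = 0) : {linear pres -> M} :=
  llift phiR.

Lemma pliftE (M : lmodType K) (phi : X -> M) phiR x :
  plift (phi := phi) phiR (pgen x) = phi x.
Proof. by rewrite [LHS]lliftE /= liftU scale1r. Qed.

Lemma pres_sum (x : pres) :
  exists s : seq X, exists c : X -> K, x = \sum_(z <- s) c z *: pgen z.
Proof.
rewrite -[x]lreprK; move: (lrepr x) => y.
exists (dom y), (fun z => @coeff K X z y); rewrite -[in LHS](freeg_sumE y) raddf_sum.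
apply: eq_bigr => z _; rewrite /pgen -linearZ /=; congr (lpi _ _).
by apply/eqP/freeg_eqP => t; rewrite coeffZ !coeffU mul1r.
Qed.

Lemma pres_eq (M : lmodType K) (f g : {linear pres -> M}) :
  (forall x, f (pgen x) = g (pgen x)) -> f =1 g.
Proof.
move=> fg x; have [s [c ->]] := pres_sum x.
by rewrite !linear_sum; apply: eq_bigr => z _; rewrite !linearZ fg.
Qed.
End Presentation.
Arguments plift : simpl never.

Section TensorProduct.
Variable K : fieldType.

Section Def.
Variables A B : lmodType K.

Inductive tensor_rel : {freeg (A * B)%type / K} -> Prop :=
| TensorRelL a u v w :
    tensor_rel (<< (a *: u + v, w) >> - a *: << (u, w) >> - << (v, w) >>)
| TensorRelR a u v w :
    tensor_rel (<< (w, a *: u + v) >> - a *: << (w, u) >> - << (w, v) >>).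

Definition tensor : lmodType K := pres tensor_rel.
Definition tens (u : A) (v : B) : tensor := pgen tensor_rel (u, v).

Lemma tensDl a u v w : tens (a *: u + v) w = a *: tens u w + tens v w.
Proof.
apply/eqP; rewrite -subr_eq0 opprD addrA /tens /pgen -linearZ -!linearB /=.
rewrite -(linear0 (lpi tensor_rel)) lpi_eq subr0; apply: lspan_gen.
exact: TensorRelL.
Qed.

Lemma tensDr a u v w : tens w (a *: u + v) = a *: tens w u + tens w v.
Proof.
apply/eqP; rewrite -subr_eq0 opprD addrA /tens /pgen -linearZ -!linearB /=.
rewrite -(linear0 (lpi tensor_rel)) lpi_eq subr0; apply: lspan_gen.
exact: TensorRelR.
Qed.

Lemma tensZl a u w : tens (a *: u) w = a *: tens u w.
Proof.
have t0 : tens 0 w = 0.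
  by have := tensDl (-1) 0 0 w; rewrite scaler0 addr0 scaleN1r addNr.
by have := tensDl a u 0 w; rewrite t0 !addr0.
Qed.

Lemma tensZr a u w : tens w (a *: u) = a *: tens w u.
Proof.
have t0 : tens w 0 = 0.
  by have := tensDr (-1) 0 0 w; rewrite scaler0 addr0 scaleN1r addNr.
by have := tensDr a u 0 w; rewrite t0 !addr0.
Qed.

Definition bilin (M : lmodType K) (phi : A -> B -> M) :=
  (forall w, linear (phi^~ w)) /\ (forall w, linear (phi w)).

Lemma bilin_rel (M : lmodType K) (phi : A -> B -> M) : bilin phi ->
  forall y, tensor_rel y -> fglift (fun p => phi p.1 p.2) y = 0.
Proof.
case=> phil phir _ [] a u v w; rewrite !linearB linearZ /= !liftU !scale1r /=.
  by rewrite phil -addrA -opprD subrr.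
by rewrite phir -addrA -opprD subrr.
Qed.

Definition tensor_lift (M : lmodType K) (phi : A -> B -> M)
  (phiP : bilin phi) : {linear tensor -> M} := plift (bilin_rel phiP).

Lemma tensor_liftE (M : lmodType K) (phi : A -> B -> M) (phiP : bilin phi) u v :
  tensor_lift phiP (tens u v) = phi u v.
Proof. exact: pliftE. Qed.
End Def.
End TensorProduct.
Arguments tensor_lift : simpl never.

Notation "u *t v" := (tens u v) (at level 40, left associativity).

Definition pairing n (a b : 'rV[int]_n) : int := \sum_(i < n) a 0 i * b 0 i.

Lemma pairing0l n (b : 'rV[int]_n) : pairing 0 b = 0.
Proof. by rewrite /pairing big1 // => i _; rewrite mxE mul0r. Qed.

(* A grading V = \bigoplus_a V^a is given by its projections: V^a is the image
   of [gr_pr V a]. *)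
Record gradedSpace (K : fieldType) (n : nat) := GradedSpace {
  gr_sort :> lmodType K;
  gr_pr : 'rV[int]_n -> {linear gr_sort -> gr_sort};
  gr_prK : forall a b v, gr_pr a (gr_pr b v) = if a == b then gr_pr b v else 0;
  gr_fin : forall v, exists s : seq 'rV[int]_n,
    uniq s && (v == \sum_(a <- s) gr_pr a v)
}.

Section GradedSpace.
Variables (K : fieldType) (n : nat).
Implicit Types V W : gradedSpace K n.

Definition homog V (a : 'rV[int]_n) (v : V) : bool := gr_pr V a v == v.

Definition has_weight V W (d : 'rV[int]_n) (f : V -> W) : Prop :=
  forall a v, homog a v -> homog (a + d) (f v).

Definition gr_supp V (v : V) : seq 'rV[int]_n := xchoose (gr_fin v).

Lemma gr_suppP V (v : V) :
  uniq (gr_supp v) /\ v = \sum_(a <- gr_supp v) gr_pr V a v.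
Proof. by case/andP: (xchooseP (gr_fin v)) => us /eqP. Qed.

Lemma gr_pr_out V (v : V) s a : v = \sum_(b <- s) gr_pr V b v ->
  a \notin s -> gr_pr V a v = 0.
Proof.
move=> sv as_; rewrite sv linear_sum big_seq big1 // => b bs; rewrite gr_prK.
by case: eqP => // ab; rewrite ab bs in as_.
Qed.

(* the sum over a of phi a, applied to the component of v in degree a *)
Definition gr_sum V (M : lmodType K) (phi : 'rV[int]_n -> V -> M) (v : V) : M :=
  \sum_(a <- gr_supp v) phi a (gr_pr V a v).

Section GrSum.
Variables (V : gradedSpace K n) (M : lmodType K).
Variables (phi : 'rV[int]_n -> V -> M).
Hypothesis phi_lin : forall a, linear (phi a).

Let phi0 a : phi a 0 = 0.
Proof. by have:= phi_lin a (-1) 0 0; rewrite scaler0 addr0 scaleN1r addNr. Qed.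

Lemma gr_sumE (v : V) s : uniq s -> (forall a, a \notin s -> gr_pr V a v = 0) ->
  gr_sum phi v = \sum_(a <- s) phi a (gr_pr V a v).
Proof.
move=> us sv; have [uv vv] := gr_suppP v; rewrite /gr_sum.
pose F a := phi a (gr_pr V a v).
have supF (r : seq _) : uniq r -> (forall a, a \notin r -> gr_pr V a v = 0) ->
    \sum_(a <- r) F a = \sum_(a <- undup (r ++ s ++ gr_supp v)) F a.
  move=> ur rv; set t := undup _.
  rewrite [RHS](bigID (mem r)) /= [X in _ + X]big1 ?addr0; last first.
    by move=> a ar; rewrite /F rv.
  rewrite -[RHS]big_filter; apply: perm_big; apply: uniq_perm => //.
    by rewrite filter_uniq // undup_uniq.
  by move=> a; rewrite mem_filter mem_undup mem_cat; case: (a \in r).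
rewrite (supF s) // (supF (gr_supp v)) => // [|a]; last exact: gr_pr_out.
apply: perm_big; apply: uniq_perm; rewrite ?undup_uniq // => a.
by rewrite !mem_undup !mem_cat; do 2!case: (a \in _).
Qed.

Fact gr_sum_linear : linear (gr_sum phi).
Proof.
move=> c u v.
pose s := undup (gr_supp u ++ gr_supp v).
have out w : {subset gr_supp w <= s} -> forall a, a \notin s -> gr_pr V a w = 0.
  move=> ws a as_; have [_ /gr_pr_out] := gr_suppP w; apply.
  by apply: contra as_; apply: ws.
have us : uniq s by exact: undup_uniq.
have hu : {subset gr_supp u <= s}.
  by move=> a au; rewrite mem_undup mem_cat au.
have hv : {subset gr_supp v <= s}.
  by move=> a av; rewrite mem_undup mem_cat av orbT.
rewrite !(@gr_sumE _ s) //; try exact: out.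
  rewrite scaler_sumr -big_split; apply: eq_bigr => a _ /=.
  by rewrite linearP phi_lin.
by move=> a as_; rewrite linearP !(out _ _ a) // scaler0 addr0.
Qed.

Lemma gr_sum_homog a v : homog a v -> gr_sum phi v = phi a v.
Proof.
move=> /eqP av; rewrite (@gr_sumE _ [:: a]) // ?big_seq1 ?av // => b.
by rewrite inE -av gr_prK => /negPf->.
Qed.
End GrSum.

(* v |-> (-1)^<d, v> v for homogeneous v *)
Definition gr_sign V (d : 'rV[int]_n) : V -> V :=
  gr_sum (fun a v => (-1 : K) ^ pairing d a *: v).

Fact gr_sign_linear V d : linear (@gr_sign V d).
Proof.
apply: gr_sum_linear => a c u v.
by rewrite scalerDr !scalerA mulrC.
Qed.
HB.instance Definition _ V d :=
  GRing.isLinear.Build K V V _ (gr_sign d) (gr_sign_linear d).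

Lemma gr_signE V d a (v : V) :
  homog a v -> gr_sign d v = (-1) ^ pairing d a *: v.
Proof.
move=> av; apply: (gr_sum_homog _ av) => b c u w.
by rewrite scalerDr !scalerA mulrC.
Qed.

Section TensorMap.
Variables (A A' : gradedSpace K n) (B B' : lmodType K).
Variables (f : {linear A -> A'}) (d : 'rV[int]_n) (g : {linear B -> B'}).

Fact tensor_map_bilin : bilin (fun u v => f (gr_sign d u) *t g v).
Proof.
by split=> w a u v /=; rewrite !linearP ?tensDl ?tensDr.
Qed.

(* f \otimes g, where d is the weight of g *)
Definition tensor_map : {linear tensor A B -> tensor A' B'} :=
  tensor_lift tensor_map_bilin.

Lemma tensor_mapE a u v : homog a u ->
  tensor_map (u *t v) = (-1) ^ pairing d a *: (f u *t g v).
Proof.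
move=> au; rewrite /tensor_map tensor_liftE (gr_signE _ au) linearZ.
by rewrite tensZl.
Qed.
End TensorMap.
End GradedSpace.
Arguments gr_sign : simpl never.
Arguments tensor_map : simpl never.

Section TensorCoalgebra.
Variables (K : fieldType) (n : nat) (W : gradedSpace K n).

(* homogeneous vectors, together with a degree (0 has every degree) *)
Definition hvec := {x : 'rV[int]_n * W | homog x.1 x.2}.
Definition hdeg (x : hvec) : 'rV[int]_n := (val x).1.
Definition hval (x : hvec) : W := (val x).2.

Lemma homog_pr a (v : W) : homog a (gr_pr W a v).
Proof. by rewrite /homog gr_prK eqxx. Qed.
Definition hcomp a (v : W) : hvec := exist _ (a, gr_pr W a v) (homog_pr a v).

(* z = a x + y, all in the same degree *)
Definition hcomb a (x y z : hvec) :=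
  [/\ hdeg x = hdeg z, hdeg y = hdeg z & hval z = a *: hval x + hval y].

(* Since W is the direct sum of its components, T(W) is generated by the
   w_1 \otimes ... \otimes w_p, p >= 1, with all w_i homogeneous, subject to
   linearity in each w_i within a fixed degree. There is no W^{\otimes 0}: the
   empty word is 0. *)
Inductive word_rel : {freeg (seq hvec) / K} -> Prop :=
| WordNil : word_rel << [::] >>
| WordLin s t a x y z : hcomb a x y z ->
    word_rel (<< s ++ z :: t >> - a *: << s ++ x :: t >> - << s ++ y :: t >>).

Definition tcoalg_module : lmodType K := pres word_rel.
Definition word (s : seq hvec) : tcoalg_module := pgen word_rel s.

Lemma word0 : word [::] = 0.
Proof.
rewrite /word /pgen -(linear0 (lpi word_rel)); apply/eqP.
by rewrite lpi_eq subr0; apply: lspan_gen; exact: WordNil.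
Qed.

Lemma word_lin s t a x y z : hcomb a x y z ->
  word (s ++ z :: t) = a *: word (s ++ x :: t) + word (s ++ y :: t).
Proof.
move=> xyz; apply/eqP; rewrite -subr_eq0 opprD addrA /word /pgen.
rewrite -linearZ -!linearB /= -(linear0 (lpi word_rel)) lpi_eq subr0.
by apply: lspan_gen; exact: WordLin.
Qed.

Definition wordlin (M : lmodType K) (phi : seq hvec -> M) :=
  phi [::] = 0 /\ forall s t a x y z, hcomb a x y z ->
    phi (s ++ z :: t) = a *: phi (s ++ x :: t) + phi (s ++ y :: t).

Lemma wordlin_rel (M : lmodType K) (phi : seq hvec -> M) : wordlin phi ->
  forall y, word_rel y -> fglift phi y = 0.
Proof.
case=> phi0 phiL _ [|s t a x y z xyz]; first by rewrite liftU phi0 scaler0.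
rewrite !linearB linearZ /= !liftU !scale1r (phiL _ _ _ _ _ _ xyz).
by rewrite -addrA -opprD subrr.
Qed.

Definition tlift (M : lmodType K) (phi : seq hvec -> M) (phiP : wordlin phi) :
  {linear tcoalg_module -> M} := plift (wordlin_rel phiP).

Local Arguments tlift : simpl never.

Lemma tliftE (M : lmodType K) (phi : seq hvec -> M) (phiP : wordlin phi) s :
  tlift phiP (word s) = phi s.
Proof. exact: pliftE. Qed.

Lemma tcoalg_eq (M : lmodType K) (f g : {linear tcoalg_module -> M}) :
  (forall s, f (word s) = g (word s)) -> f =1 g.
Proof. exact: pres_eq. Qed.

Lemma word_wordlin : wordlin word.
Proof. by split=> [|s t a x y z]; [exact: word0|exact: word_lin]. Qed.

Definition wdeg (s : seq hvec) : 'rV[int]_n := \sum_(x <- s) hdeg x.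

Lemma hcomb_degs s t a x y z : hcomb a x y z ->
  (map hdeg (s ++ x :: t) = map hdeg (s ++ z :: t)) *
  (map hdeg (s ++ y :: t) = map hdeg (s ++ z :: t)).
Proof. by case=> xz yz _; rewrite !map_cat /= xz yz. Qed.

Lemma wdegE s : wdeg s = \sum_(a <- map hdeg s) a.
Proof. by rewrite big_map. Qed.

Fact tcoalg_pr_wordlin a :
  wordlin (fun s => if wdeg s == a then word s else 0).
Proof.
split=> [|s t c x y z xyz]; first by rewrite word0 if_same.
rewrite !wdegE !(hcomb_degs s t xyz); case: ifP => _; last first.
  by rewrite scaler0 addr0.
exact: word_lin.
Qed.

Definition tcoalg_pr a : {linear tcoalg_module -> tcoalg_module} :=
  tlift (tcoalg_pr_wordlin a).

Fact tcoalg_prK a b v :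
  tcoalg_pr a (tcoalg_pr b v) = if a == b then tcoalg_pr b v else 0.
Proof.
transitivity ((if a == b then tcoalg_pr b
  else \0 : {linear tcoalg_module -> tcoalg_module}) v); last by case: ifP.
rewrite -[LHS]/((tcoalg_pr a \o tcoalg_pr b) v); apply: tcoalg_eq => s /=.
rewrite tliftE; case: (altP (wdeg s =P b)) => [<-|sb]; last first.
  rewrite linear0; case: ifP => //= _.
  by rewrite tliftE (negPf sb).
rewrite tliftE eq_sym; case: ifP => //= _.
by rewrite tliftE eqxx.
Qed.

Fact tcoalg_fin v : exists s : seq 'rV[int]_n,
  uniq s && (v == \sum_(a <- s) tcoalg_pr a v).
Proof.
have [r [c ->]] := pres_sum v.
exists (undup (map wdeg r)); rewrite undup_uniq /=; apply/eqP.
under [RHS]eq_bigr do rewrite linear_sum.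
rewrite exchange_big /= big_seq [RHS]big_seq; apply: eq_bigr => z zr.
rewrite (bigD1_seq (wdeg z)) ?undup_uniq //=; last first.
  by rewrite mem_undup map_f.
rewrite big1 ?addr0 => [|a az]; rewrite linearZ /= tliftE ?eqxx //.
by rewrite eq_sym (negPf az) scaler0.
Qed.

(* T(W), graded by total degree *)
Definition tcoalg : gradedSpace K n := GradedSpace tcoalg_prK tcoalg_fin.

Lemma homog_word s : @homog _ _ tcoalg (wdeg s) (word s).
Proof. by apply/eqP; rewrite [LHS]tliftE eqxx. Qed.

(* W_I for W = s, i.e. the subword of s on the positions in I *)
Definition subword (p : nat) (I : {set 'I_p}) (s : seq hvec) : seq hvec :=
  mask [seq i \in I | i <- enum 'I_p] s.

(* The Koszul sign of (W_I, W_J) -> W for J = ~: I, where d lists the degrees of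
   the letters. *)
Definition koszul (p : nat) (I : {set 'I_p}) (d : seq 'rV[int]_n) : K :=
  \prod_(i in I) \prod_(j in ~: I | (j < i)%N) (-1) ^ pairing d`_i d`_j.

(* The sum is over the nonempty I not containing the last position p; with
   J = {1..p-1} \ I, the word J followed by w_p is the subword on ~: I, and w_p
   does not contribute to the sign. *)
Definition split_word (s : seq hvec) : tensor tcoalg tcoalg :=
  \sum_(I : {set 'I_(size s)} | (I != set0) && [forall i in I, i.+1 < size s]%N)
    koszul I (map hdeg s) *:
      ((word (subword I s) : tcoalg) *t (word (subword (~: I) s) : tcoalg)).

Lemma mask_mid (b : bitseq) (s t : seq hvec) (x : hvec) :
  size b = size (s ++ x :: t) -> mask b (s ++ x :: t) =
  mask (take (size s) b) s ++ nseq (nth false b (size s)) x ++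
  mask (drop (size s).+1 b) t.
Proof.
rewrite size_cat /= => sb.
have sb' : (size s < size b)%N by rewrite sb addnS ltnS leq_addr.
rewrite -[in LHS](cat_take_drop (size s) b) mask_cat ?size_takel 1?ltnW //.
by rewrite (drop_nth false) //; case: (nth _ _ _).
Qed.

Fact split_word_wordlin : wordlin split_word.
Proof.
split=> [|s t a x y z xyz].
  rewrite /split_word big1 // => I /andP[/set0Pn[[]]] //.
rewrite /split_word !(hcomb_degs s t xyz).
have -> : size (s ++ x :: t) = size (s ++ z :: t) by rewrite !size_cat.
have -> : size (s ++ y :: t) = size (s ++ z :: t) by rewrite !size_cat.
move ep : (size (s ++ z :: t)) => p.
rewrite scaler_sumr -big_split /=; apply: eq_bigr => I _.
rewrite scalerA mulrC -scalerA -scalerDr; congr (_ *: _).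
have subE J u : subword J (s ++ u :: t) =
    mask (take (size s) [seq i \in J | i <- enum 'I_p]) s ++
    nseq (nth false [seq i \in J | i <- enum 'I_p] (size s)) u ++
    mask (drop (size s).+1 [seq i \in J | i <- enum 'I_p]) t.
  rewrite /subword mask_mid // size_map size_enum_ord -ep !size_cat //.
have sp : (size s < p)%N by rewrite -ep size_cat /= addnS ltnS leq_addr.
have nthE (J : {set 'I_p}) :
    nth false [seq i \in J | i <- enum 'I_p] (size s) = (Ordinal sp \in J).
  rewrite (nth_map (Ordinal sp)) ?size_enum_ord //; congr (_ \in J).
  by apply: val_inj; rewrite /= nth_enum_ord.
rewrite !subE !nthE inE; case: (_ \in I) => /=.
  by rewrite (word_lin _ _ xyz) tensDl.
by rewrite (word_lin _ _ xyz) tensDr.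
Qed.

Definition coprod : {linear tcoalg -> tensor tcoalg tcoalg} :=
  tlift split_word_wordlin.

Lemma coprodE s : coprod (word s) = split_word s.
Proof. exact: tliftE. Qed.

Fact tcoalg_proj_wordlin :
  wordlin (fun s => if s is [:: x] then hval x else 0).
Proof.
split=> // s t a x y z [xz yz zE].
by case: s t => [|u [|u' s]] [|v t] //=; rewrite scaler0 addr0.
Qed.

(* the projection of T(W) onto W *)
Definition tcoalg_proj : {linear tcoalg -> W} := tlift tcoalg_proj_wordlin.

Fact tcoalg_inj_linear :
  linear (gr_sum (fun a (v : W) => word [:: hcomp a v])).
Proof.
apply: gr_sum_linear => a c u v; apply: (@word_lin [::] [::]).
by split=> //; rewrite /hval /= linearP.
Qed.

(* the inclusion of W = W^{\otimes 1} in T(W) *)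
Definition tcoalg_inj : W -> tcoalg :=
  gr_sum (fun a (v : W) => word [:: hcomp a v]).
HB.instance Definition _ :=
  GRing.isLinear.Build K W tcoalg _ tcoalg_inj tcoalg_inj_linear.

Lemma tcoalg_injE (x : hvec) : tcoalg_inj (hval x) = word [:: x].
Proof.
have xE : hcomp (hdeg x) (hval x) = x.
  by apply: val_inj; rewrite /= (eqP (valP x)) -surjective_pairing.
rewrite /tcoalg_inj (gr_sum_homog _ (valP x)) => [|a c u v].
  by rewrite -[in RHS]xE.
by apply: (@word_lin [::] [::]); split=> //; rewrite /hval /= linearP.
Qed.

Lemma tcoalg_injK : cancel tcoalg_inj tcoalg_proj.
Proof.
move=> v; have [_ vE] := gr_suppP v.
rewrite /tcoalg_inj /gr_sum linear_sum [RHS]vE; apply: eq_bigr => a _.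
by rewrite /= tliftE /hval /= gr_prK eqxx.
Qed.

Definition is_coderivation (d : 'rV[int]_n) (Q : {linear tcoalg -> tcoalg}) :=
  has_weight d Q /\ forall x, coprod (Q x) =
    tensor_map Q 0 (idfun : {linear tcoalg -> tcoalg}) (coprod x) +
    tensor_map (idfun : {linear tcoalg -> tcoalg}) d Q (coprod x).

Definition is_codifferential (d : 'rV[int]_n) (Q : {linear tcoalg -> tcoalg}) :=
  is_coderivation d Q /\ forall x, Q (Q x) = 0.
End TensorCoalgebra.
Arguments tlift : simpl never.
Arguments tcoalg_inj : simpl never.
Arguments coprod : simpl never.
Arguments tcoalg_proj : simpl never.

Section Primitive.
Variables (K : fieldType) (n : nat) (W : gradedSpace K n).
Local Notation TW := (tcoalg W).

Fact snoc_wordlin (x : hvec W) :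
  wordlin (fun s => if s is [::] then 0 else word (rcons s x)).
Proof.
split=> // s t a u v z uvz.
have E y : (if s ++ y :: t is [::] then 0 else word (rcons (s ++ y :: t) x))
    = word (s ++ y :: rcons t x).
  by rewrite -cats1 -catA /= cats1; case: s.
by rewrite !E; exact: word_lin.
Qed.
Let snoc x : {linear TW -> TW} := tlift (snoc_wordlin x).

Fact snoc_lin a x y z (u : TW) : hcomb a x y z ->
  snoc z u = a *: snoc x u + snoc y u.
Proof.
move=> xyz; rewrite -[RHS]/((a \*: snoc x \+ snoc y) u).
apply: tcoalg_eq => s /=; rewrite !tliftE; case: s => [|u' s].
  by rewrite scaler0 addr0.
by rewrite -!cats1; apply: word_lin.
Qed.

Fact glue_wordlin (u : TW) :
  wordlin (fun s => if s is [:: x] then snoc x u else 0).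
Proof.
split=> // s t a x y z xyz.
case: s t => [|v [|v' s]] [|w t] //=; rewrite ?scaler0 ?addr0 //.
exact: snoc_lin.
Qed.

Fact glue_bilin : bilin (fun u v : TW => tlift (glue_wordlin u) v).
Proof.
split=> w; last exact: linearP.
move=> a u v; rewrite -[RHS]/((a \*: tlift (glue_wordlin u) \+
  tlift (glue_wordlin v)) w).
apply: tcoalg_eq => -[|x [|y s]] /=; rewrite !tliftE ?scaler0 ?addr0 //.
by rewrite linearP.
Qed.

Lemma koszul1 p (I : {set 'I_p}) (d : seq 'rV[int]_n) :
  (forall i j, i \in I -> j \notin I -> (i < j)%N) -> koszul K I d = 1.
Proof.
move=> lt; rewrite /koszul big1 // => i Ii; rewrite big1 // => j.
by rewrite inE => /andP[/(lt i j Ii) ij /(ltn_trans ij)]; rewrite ltnn.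
Qed.

Lemma size_subword (s : seq (hvec W)) (I : {set 'I_(size s)}) :
  size (subword I s) = #|I|.
Proof.
rewrite /subword size_mask; last by rewrite size_map size_enum_ord.
rewrite count_map -sum1_count -sum1_card big_enum_cond.
by apply: eq_bigl => i.
Qed.

Lemma glue_coprod (u : TW) :
  tensor_lift glue_bilin (coprod W u) = u - tcoalg_inj (tcoalg_proj W u).
Proof.
rewrite -[RHS]/((idfun \- (@tcoalg_inj _ _ W \o tcoalg_proj W)) u).
rewrite -[LHS]/((tensor_lift glue_bilin \o coprod W) u).
apply: tcoalg_eq => s /=; rewrite coprodE tliftE linear_sum /=.
under eq_bigr => I _ do rewrite linearZ /= tensor_liftE tliftE.
case/lastP: s => [|s x].
  rewrite word0 linear0 subr0 big1 // => I /andP[/set0Pn[[]]] //.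
case: (posnP (size s)) => [/size0nil->|s0].
  rewrite /= tcoalg_injE subrr big1 // => I /andP[/set0Pn[i Ii]].
  by move/'forall_implyP/(_ i Ii); rewrite ltnS ltn0.
have -> : (if rcons s x is [:: y] then hval y else 0 : W) = 0.
  by case: s s0 => [|? []].
rewrite linear0 subr0.
have sz : size (rcons s x) = (size s).+1 by rewrite size_rcons.
have lastP' : (size s < size (rcons s x))%N by rewrite sz.
pose l : 'I_(size (rcons s x)) := Ordinal lastP'.
have [I0E I1E] : subword (~: [set l]) (rcons s x) = s /\
    subword (~: ~: [set l]) (rcons s x) = [:: x].
  rewrite /subword.
  have E (J : {set 'I_(size (rcons s x))}) b :
      (forall i : 'I_(size (rcons s x)), (i < size s)%N -> (i \in J) = b) ->
      [seq i \in J | i <- enum 'I_(size (rcons s x))] =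
        rcons (nseq (size s) b) (l \in J).
    move=> Jb; apply: (@eq_from_nth _ false).
      by rewrite size_map size_enum_ord [RHS]size_rcons size_nseq.
    rewrite size_map size_enum_ord => i ilt.
    rewrite (nth_map l) ?size_enum_ord // nth_rcons size_nseq nth_nseq.
    have iE : nat_of_ord (nth l (enum 'I_(size (rcons s x))) i) = i.
      exact: nth_enum_ord.
    case: ltnP => is_; first by rewrite Jb ?iE.
    have ei : i = size s.
      by apply/eqP; rewrite eqn_leq is_ andbT -ltnS -sz.
    rewrite ei eqxx; congr (_ \in J); apply: val_inj => /=.
    exact: nth_enum_ord.
  rewrite (E _ true) ?(E _ false); last first.
  - by move=> i il; rewrite !inE -val_eqE /= ltn_eqF.
  - by move=> i il; rewrite !inE -val_eqE /= ltn_eqF.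
  rewrite !inE eqxx /= -!cats1 !mask_cat ?size_nseq // mask_true // mask_false.
  by rewrite cats0.
rewrite (bigD1 (~: [set l])) /=; last first.
  apply/andP; split.
    apply/set0Pn; exists (Ordinal (ltn_trans s0 lastP')).
    by rewrite !inE -val_eqE /= ltn_eqF.
  apply/'forall_implyP => i; rewrite !inE -val_eqE /= => il.
  apply: (leq_ltn_trans _ lastP'); rewrite ltn_neqAle il -ltnS.
  by apply: leq_trans (ltn_ord i) _; rewrite sz.
rewrite I0E I1E koszul1 ?scale1r; last first.
  move=> i j; rewrite !inE negbK => il /eqP->.
  rewrite ltn_neqAle val_eqE il /= -ltnS.
  by apply: leq_trans (ltn_ord i) _; rewrite sz.
rewrite tliftE big1 ?addr0; first by case: s s0 {sz lastP' l I0E I1E}.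
move=> I /andP[/andP[_ /'forall_implyP Il] nI].
case E: (subword (~: I) (rcons s x)) => [|y [|? ?]]; rewrite ?scaler0 //.
have /eqP/cards1P[j jE] : #|~: I| = 1%N by rewrite -size_subword E.
case/negP: nI; apply/eqP; rewrite -[LHS]setCK jE; congr (~: [set _]).
have : l \in ~: I by rewrite inE; apply/negP => /Il /=; rewrite size_rcons ltnn.
by rewrite jE inE => /eqP.
Qed.

(* ker Delta = W *)
Lemma coprod_eq0 (u : TW) : coprod W u = 0 -> u = tcoalg_inj (tcoalg_proj W u).
Proof.
by move=> u0; apply/eqP; rewrite -subr_eq0 -glue_coprod u0 linear0.
Qed.

Lemma coprod_inj (v : W) : coprod W (tcoalg_inj v) = 0.
Proof.
rewrite /tcoalg_inj /gr_sum linear_sum big1 // => a _.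
rewrite coprodE /split_word big1 // => I /andP[/set0Pn[i Ii]].
by move/'forall_implyP/(_ i Ii); rewrite ltnS ltn0.
Qed.
End Primitive.

Section Cohomology.
Variables (K : fieldType).

Section Def.
Variables (V : lmodType K) (d : {linear V -> V}).

Definition cycle_pred : {pred V} := [pred x | d x == 0].

Fact cycle_pred_closed : submod_closed cycle_pred.
Proof.
split=> [|a u v]; rewrite !inE ?linear0 // linearP => /eqP-> /eqP->.
by rewrite scaler0 addr0.
Qed.
HB.instance Definition _ :=
  GRing.isSubmodClosed.Build K V cycle_pred cycle_pred_closed.

Definition cycles : Type := {x : V | x \in cycle_pred}.
HB.instance Definition _ := SubChoice.on cycles.
HB.instance Definition _ := [SubChoice_isSubLmodule of cycles by <:].

(* ker d / im d, for d^2 = 0 *)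
Definition cohomology : lmodType K :=
  lquot (fun z : cycles => exists y, val z = d y).
Definition cohom_class (z : cycles) : cohomology := lpi _ z.
HB.instance Definition _ :=
  GRing.isLinear.Build K cycles cohomology _ cohom_class (lpi_linear _).
End Def.

Section Map.
Variables (V V' : lmodType K) (d : {linear V -> V}) (d' : {linear V' -> V'}).
Variables (f : {linear V -> V'}) (fd : forall v, d' (f v) = f (d v)).

Fact cycles_map_subproof (z : cycles d) : f (val z) \in cycle_pred d'.
Proof.
have /eqP dz : d (val z) == 0 := valP z.
by rewrite inE fd dz linear0.
Qed.
Definition cycles_map (z : cycles d) : cycles d' :=
  exist _ (f (val z)) (cycles_map_subproof z).

Fact cycles_map_linear : linear cycles_map.
Proof. by move=> a u v; apply: val_inj; rewrite /= linearP. Qed.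
HB.instance Definition _ := GRing.isLinear.Build K (cycles d) (cycles d') _
  cycles_map cycles_map_linear.

Fact cohomology_map_subproof (z : cycles d) : (exists y, val z = d y) ->
  (@cohom_class V' d' \o cycles_map) z = 0.
Proof.
case=> y zy; rewrite /= -(linear0 (lpi _)); apply/lpiP; rewrite subr0.
by apply: lspan_gen; exists (f y); rewrite /= fd zy.
Qed.

Definition cohomology_map : {linear cohomology d -> cohomology d'} :=
  llift cohomology_map_subproof.

Lemma cohomology_mapE z :
  cohomology_map (cohom_class z) = cohom_class (cycles_map z).
Proof. exact: lliftE. Qed.
End Map.
End Cohomology.
Arguments cohomology_map : simpl never.

Definition is_cohomomorphism (K : fieldType) (n : nat) (W W' : gradedSpace K n)
    (F : {linear tcoalg W -> tcoalg W'}) :=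
  has_weight 0 F /\
  forall x, coprod W' (F x) = tensor_map F 0 F (coprod W x).

Definition e1 n : 'rV[int]_n.+1 := delta_mx 0 0.

Section Desuspension.
Variables (K : fieldType) (n : nat) (V : gradedSpace K n.+1).

Fact desusp_prK a b v : gr_pr V (a + e1 n) (gr_pr V (b + e1 n) v) =
  if a == b then gr_pr V (b + e1 n) v else 0.
Proof. by rewrite gr_prK (inj_eq (addIr _)). Qed.

Fact desusp_fin v : exists s : seq 'rV[int]_n.+1,
  uniq s && (v == \sum_(a <- s) gr_pr V (a + e1 n) v).
Proof.
have [us vE] := gr_suppP v; exists [seq a - e1 n | a <- gr_supp v].
rewrite map_inj_uniq ?us /=; last exact: addIr.
by rewrite big_map; under eq_bigr do rewrite subrK; rewrite -vE.
Qed.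

(* (\downarrow V)^a = V^(a + e1), on the same underlying space *)
Definition desusp : gradedSpace K n.+1 := GradedSpace desusp_prK desusp_fin.

Definition up : {linear desusp -> V} := (idfun : {linear V -> V}).
Definition down : {linear V -> desusp} := (idfun : {linear V -> V}).

Fact down_homog (x : hvec V) : homog (hdeg x - e1 n) (down (hval x)).
Proof. by rewrite /homog /= subrK; exact: valP x. Qed.
Definition down_hvec (x : hvec V) : hvec desusp :=
  exist _ (hdeg x - e1 n, down (hval x)) (down_homog x).

(* the sign of \downarrow \otimes ... \otimes \downarrow on homogeneous vectors
   of degrees d: the j-th factor, of weight - e1, passes the i-th vector for
   each i < j *)
Definition down_sign (d : seq 'rV[int]_n.+1) : K :=
  \prod_(j < size d) \prod_(i < j) (-1) ^ pairing (- e1 n) d`_i.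

Fact down_word_wordlin :
  wordlin (fun s => down_sign (map (@hdeg _ _ _) s) *: word (map down_hvec s)).
Proof.
split=> [|s t a x y z xyz]; first by rewrite word0 scaler0.
rewrite !(hcomb_degs s t xyz) !map_cat /=.
rewrite scalerA mulrC -scalerA -scalerDr; congr (_ *: _).
have dxyz : hcomb a (down_hvec x) (down_hvec y) (down_hvec z).
  by case: xyz => xz yz zE; split=> //; congr (_ - _).
exact: (word_lin (map down_hvec s) (map down_hvec t) dxyz).
Qed.

(* the direct sum over p >= 1 of the \downarrow^{\otimes p} *)
Definition down_tens : {linear tcoalg V -> tcoalg desusp} :=
  tlift down_word_wordlin.

Lemma down_tens_inj v : down_tens (tcoalg_inj v) = tcoalg_inj (down v).
Proof.
have [_ vE] := gr_suppP v.
rewrite -[LHS]/((down_tens \o @tcoalg_inj K _ V) v).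
rewrite -[RHS]/((@tcoalg_inj K _ desusp \o down) v).
rewrite vE !linear_sum; apply: eq_bigr => a _.
rewrite -[gr_pr V a v]/(hval (hcomp a v)) /= tcoalg_injE [LHS]tliftE.
rewrite -[hval (hcomp a v)]/(hval (down_hvec (hcomp a v))) tcoalg_injE.
by rewrite /down_sign /= big_ord1 big_ord0 scale1r.
Qed.
End Desuspension.
Arguments down_tens : simpl never.

(* Graded by Z^(n+1), so that the first basis vector e1 exists. *)
Record lodAlgebra (K : fieldType) (n : nat) := LodAlgebra {
  lod_space :> gradedSpace K n.+1;
  lod_Q : {linear tcoalg (desusp lod_space) -> tcoalg (desusp lod_space)};
  lod_codiff : is_codifferential (e1 n) lod_Q
}.

Record lodMorphism (K : fieldType) (n : nat) (V V' : lodAlgebra K n) :=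
  LodMorphism {
    lod_F : {linear tcoalg (desusp V) -> tcoalg (desusp V')};
    lod_cohom : is_cohomomorphism lod_F;
    lod_comm : forall x, lod_Q V' (lod_F x) = lod_F (lod_Q V x)
  }.

Section LodInfinity.
Variables (K : fieldType) (n : nat).
Implicit Types V : lodAlgebra K n.

(* the structure map pi_p is the restriction to V^{\otimes p} *)
Definition lod_pi V : {linear tcoalg V -> V} :=
  @up K n V \o tcoalg_proj (desusp V) \o lod_Q V \o down_tens V.

Definition lod_pi1 V : {linear V -> V} := lod_pi V \o @tcoalg_inj K n.+1 V.

Lemma lod_Q_inj V (v : desusp V) : lod_Q V (tcoalg_inj v) =
  tcoalg_inj (tcoalg_proj (desusp V) (lod_Q V (tcoalg_inj v))).
Proof.
apply: coprod_eq0; case: (lod_codiff V) => -[_ ->] _.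
by rewrite coprod_inj !linear0 addr0.
Qed.

Lemma lod_pi1_sqr V v : lod_pi1 V (lod_pi1 V v) = 0.
Proof.
rewrite /lod_pi1 /lod_pi /= !down_tens_inj /= -lod_Q_inj.
by case: (lod_codiff V) => _ ->; rewrite linear0.
Qed.

Section Morphism.
Variables (V V' : lodAlgebra K n) (f : lodMorphism V V').

(* f_p is the restriction to V^{\otimes p} *)
Definition lod_f : {linear tcoalg V -> V'} :=
  @up K n V' \o tcoalg_proj (desusp V') \o lod_F f \o down_tens V.

Definition lod_f1 : {linear V -> V'} := lod_f \o @tcoalg_inj K n.+1 V.

Lemma lod_chain v : lod_pi1 V' (lod_f1 v) = lod_f1 (lod_pi1 V v).
Proof.
rewrite /lod_pi1 /lod_f1 /lod_pi /lod_f /= !down_tens_inj /=.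
set w : desusp V := v.
have FE : lod_F f (tcoalg_inj w) =
    tcoalg_inj (tcoalg_proj (desusp V') (lod_F f (tcoalg_inj w))).
  apply: coprod_eq0; case: (lod_cohom f) => _ ->.
  by rewrite coprod_inj linear0.
by rewrite -[in LHS]FE lod_comm [in LHS]lod_Q_inj.
Qed.

Definition lod_f1_sharp :
    {linear cohomology (lod_pi1 V) -> cohomology (lod_pi1 V')} :=
  cohomology_map lod_chain.

Definition lod_quasi_iso : Prop := bijective lod_f1_sharp.
End Morphism.
End LodInfinity.

(* Main.v *)
From HB Require Import structures.
Require Import Defs.
From mathcomp Require Import all_boot all_order all_algebra ssrAC.
From mathcomp Require Import boolp.
From mathcomp Require classical_sets.

Set Implicit Arguments.
Unset Strict Implicit.
Unset Printing Implicit Defensive.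

Import GRing.Theory.
Local Open Scope ring_scope.

(** A Lod-infinity quasi-isomorphism is a cohomomorphism F : T(W) -> T(W') of
tensor coalgebras with codifferentials Q and Q', W and W' being desuspensions,
whose linear part f : W -> W' is a quasi-isomorphism.  A quasi-inverse is found
as a strict left inverse, after F has been made injective.

Cofreeness.  Projecting the second tensor factor of the coproduct onto letters
gives deconcatenation of the last letter, so that x = inj (pr x) + the sum of
the words x' followed by pr x''.  Hence a cohomomorphism with corestriction f
solves F = inj f + append_along F 0 f, whose right-hand side involves F on
shorter words only: it is unique (cohom_eq, cohom_ext), and the solution of this
equation is a cohomomorphism (cohom_is_cohom).  The same works for coderivations
(coder_is_coder) and for coderivations along a cohomomorphism (coder_flat).  The
combinatorial input is that unshuffling is coassociative and graded
cocommutative (ssum_coassoc, ssumC).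

Retraction (cohomomorphism_retraction).  Assume given linear maps rho and h at
the level of W' with dh + hd = 1 - f rho and h f = 0, and a linear l such that l
applied to the corestriction of F is the projection onto W.  Then F has a left
inverse R with QR = RQ'.  The corestriction of R is improved degree by degree,
starting from l.  If E = QR - RQ' vanishes on words of length at most k, then on
words of length k+1 it takes values in W, its corestriction e satisfies
d e = - e Q', and e kills the image of F.  The homotopy s, the sum of the
pi (x) .. (x) pi (x) h (x) 1 (x) .. (x) 1 with pi = f rho, satisfies
Q's + sQ' = 1 - T(pi) modulo shorter words (word_homotopyP); hence adding e s'
to the corestriction, s' being s made to vanish on the image of F, removes the
curvature on words of length k+1 and keeps RF = id.

Cylinder.  For arbitrary F, replace W' by W' + W + desusp W, the product of W'
with the acyclic complex on W + desusp W, and F by the cohomomorphism with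
corestriction (corestriction of F, pr, pr Q).  The second coordinate is an l as
above.  The cokernel of the new linear part is the mapping cone of f, which is
acyclic because f is a quasi-isomorphism; over a field it is therefore
contractible (graded_contraction), and the contraction yields rho and h
(cylinder_contraction).

Conclusion.  G is the retraction composed with the inclusion of T(W') in the
tensor coalgebra of the cylinder.  For a cycle z, the elements (f z, 0, 0) and
(f z, z, d z) of the cylinder differ by a boundary and the second one is
retracted to z, so the linear part of G inverts f on cohomology. *)

(** * Koszul signs and sums over unshuffles *)
Section KoszulSign.
Variables (K : fieldType) (n : nat).
Implicit Types a b c : 'rV[int]_n.

Definition ksgn a b : K := (-1) ^ pairing a b.

Lemma pairingC a b : pairing a b = pairing b a.
Proof. by apply: eq_bigr => i _; rewrite mulrC. Qed.

Lemma pairingDr a b c : pairing a (b + c) = pairing a b + pairing a c.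
Proof. by rewrite -big_split; apply: eq_bigr => i _; rewrite mxE mulrDr. Qed.

Lemma ksgnC a b : ksgn a b = ksgn b a.
Proof. by rewrite /ksgn pairingC. Qed.

Lemma ksgnDr a b c : ksgn a (b + c) = ksgn a b * ksgn a c.
Proof. by rewrite /ksgn pairingDr exprzDr ?unitrN1. Qed.

Lemma ksgnDl a b c : ksgn (a + b) c = ksgn a c * ksgn b c.
Proof. by rewrite !(ksgnC _ c) ksgnDr. Qed.

Lemma ksgn0l a : ksgn 0 a = 1.
Proof. by rewrite /ksgn pairing0l expr0z. Qed.

Lemma ksgn0r a : ksgn a 0 = 1.
Proof. by rewrite ksgnC ksgn0l. Qed.

Lemma ksgn_sqr a b : ksgn a b * ksgn a b = 1.
Proof. by rewrite /ksgn -exprMz_comm ?mulrNN ?mulr1 ?exp1rz ?unitrN1 //; exact: commrN1. Qed.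

Lemma ksgnNl a b : ksgn (- a) b = ksgn a b.
Proof.
rewrite -[RHS]mul1r -(ksgn0l b) -(addNr a) ksgnDl -mulrA ksgn_sqr.
by rewrite mulr1.
Qed.
End KoszulSign.

(** [ssum Phi s] is the sum of Phi I J over the splittings of s into complementary
subwords I and J, with the sign of (I, J) -> s.  Recursing on the first letter and
passing it to Phi makes the algebra of unshuffles a matter of plain inductions,
without linearity of Phi: that letter is free to enter I, and has to pass all of I
to enter J. *)
Section Splittings.
Variables (K : fieldType) (n : nat) (X : Type) (deg : X -> 'rV[int]_n).
Local Notation sgn := (@ksgn K n).
Local Notation sdeg := (fun s : seq X => \sum_(x <- s) deg x).

Fixpoint ssum (M : lmodType K) (Phi : seq X -> seq X -> M) (s : seq X) : M :=
  if s is x :: t then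
    ssum (fun I J => Phi (x :: I) J) t +
    ssum (fun I J => sgn (deg x) (sdeg I) *: Phi I (x :: J)) t
  else Phi [::] [::].

Lemma eq_ssum (M : lmodType K) (Phi Psi : seq X -> seq X -> M) s :
  (forall I J, sdeg I + sdeg J = sdeg s ->
     (size I + size J = size s)%N -> Phi I J = Psi I J) ->
  ssum Phi s = ssum Psi s.
Proof.
elim: s Phi Psi => [|x s IH] Phi Psi eqPP /=.
  by apply: eqPP; rewrite ?big_nil ?addr0.
congr (_ + _); apply: IH => I J dIJ sIJ.
  by apply: eqPP; rewrite /= ?addSn ?sIJ // !big_cons -addrA dIJ.
congr (_ *: _).
by apply: eqPP; rewrite /= ?addnS ?sIJ // !big_cons addrCA dIJ.
Qed.

Lemma ssumD (M : lmodType K) (Phi Psi : seq X -> seq X -> M) s :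
  ssum (fun I J => Phi I J + Psi I J) s = ssum Phi s + ssum Psi s.
Proof.
elim: s Phi Psi => [|x s IH] Phi Psi //=.
rewrite IH addrACA; congr (_ + _); rewrite -IH.
by apply: eq_ssum => I J _ _; rewrite scalerDr.
Qed.

Lemma linear_ssum (M N : lmodType K) (f : {linear M -> N})
    (Phi : seq X -> seq X -> M) s :
  f (ssum Phi s) = ssum (fun I J => f (Phi I J)) s.
Proof.
elim: s Phi => [|x s IH] Phi //=.
rewrite linearD !IH; congr (_ + _).
by apply: eq_ssum => I J _ _; rewrite linearZ.
Qed.

Lemma ssumZ (M : lmodType K) a (Phi : seq X -> seq X -> M) s :
  ssum (fun I J => a *: Phi I J) s = a *: ssum Phi s.
Proof. by rewrite -[RHS]/((a \*: idfun : {linear M -> M}) _) linear_ssum. Qed.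

Lemma ssum0 (M : lmodType K) s : ssum (fun _ _ => 0 : M) s = 0.
Proof.
elim: s => [|x s IH] //=; rewrite IH add0r -[RHS]IH.
by apply: eq_ssum => *; rewrite scaler0.
Qed.

(** Both sides sum over the splittings of s into three subwords. *)
Lemma ssum_coassoc (M : lmodType K) (Phi : seq X -> seq X -> seq X -> M) s :
  ssum (fun I J => ssum (fun A B => Phi A B J) I) s =
  ssum (fun A L => ssum (fun B J => Phi A B J) L) s.
Proof.
elim: s Phi => [|x s IH] Phi //=.
rewrite !ssumD -!addrA; congr (_ + _); first exact: IH.
transitivity (
  ssum (fun I J => ssum (fun A B => sgn (deg x) (sdeg A) *: Phi A (x :: B) J) I) s +
  ssum (fun I J => ssum (fun A B => sgn (deg x) (sdeg A + sdeg B) *: Phi A B (x :: J)) I) s).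
  congr (_ + _); apply: eq_ssum => I J _ _; rewrite -ssumZ.
  by apply: eq_ssum => A B <- _.
rewrite !IH -ssumD; apply: eq_ssum => A L _ _.
rewrite scalerDr -!ssumZ; congr (_ + _).
by apply: eq_ssum => B J _ _; rewrite scalerA ksgnDr.
Qed.

Lemma ssumC (M : lmodType K) (Phi : seq X -> seq X -> M) s :
  ssum Phi s = ssum (fun I J => sgn (sdeg I) (sdeg J) *: Phi J I) s.
Proof.
elim: s Phi => [|x s IH] Phi /=; first by rewrite big_nil ksgn0l scale1r.
rewrite addrC; congr (_ + _); rewrite IH; apply: eq_ssum => I J _ _.
  by rewrite big_cons ksgnDl scalerA mulrC.
by rewrite big_cons ksgnDr scalerA mulrA (ksgnC _ _ (deg x)) ksgn_sqr mul1r.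
Qed.

(** The mirror image of the recursion that defines ssum; the coproduct treats the
last letter in a special way. *)
Lemma ssum_rcons (M : lmodType K) (Phi : seq X -> seq X -> M) s x :
  ssum Phi (rcons s x) =
  ssum (fun I J => sgn (deg x) (sdeg J) *: Phi (rcons I x) J) s +
  ssum (fun I J => Phi I (rcons J x)) s.
Proof.
elim: s Phi => [|y s IH] Phi /=; first by rewrite big_nil !ksgn0r !scale1r.
rewrite !IH addrACA; congr (_ + _); congr (_ + _).
apply: eq_ssum => I J _ _; rewrite !scalerA; congr (_ *: _).
rewrite -cats1 big_cat big_seq1 big_cons !ksgnDr mulrCA; congr (_ * _).
by rewrite mulrC (ksgnC _ (deg y)).
Qed.

Lemma ssum_nilr (M : lmodType K) (Phi : seq X -> M) s :
  ssum (fun I J => if J is [::] then Phi I else 0) s = Phi s.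
Proof.
elim: s Phi => [|x s IH] Phi //=.
rewrite (IH (fun I => Phi (x :: I))) (eq_ssum (Psi := fun _ _ => 0)).
  by rewrite ssum0 addr0.
by move=> *; rewrite scaler0.
Qed.
End Splittings.

(** * The coproduct of a word as a sum over unshuffles *)
Section SubsetSplittings.
Variables (K : fieldType) (n : nat).
Implicit Types (d : seq 'rV[int]_n) (M : lmodType K).

Definition set_mask p (I : {set 'I_p}) : bitseq := [seq i \in I | i <- enum 'I_p].

(** Subsets of 'I_p.+1 are encoded by the membership of 0 and a subset of 'I_p. *)
Definition set_cons p (bJ : bool * {set 'I_p}) : {set 'I_p.+1} :=
  [set i | if unlift ord0 i is Some j then j \in bJ.2 else bJ.1].

Lemma set_cons_bij p : bijective (@set_cons p).
Proof.
exists (fun I : {set 'I_p.+1} => (ord0 \in I, [set j : 'I_p | lift ord0 j \in I])) => [[b J]|I].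
  congr (_, _); first by rewrite inE unlift_none.
  by apply/setP => j; rewrite !inE liftK.
apply/setP=> i; rewrite inE /=.
by case: unliftP => [j ->|->] //; rewrite inE.
Qed.

Lemma in_set_cons0 p b (J : {set 'I_p}) : (ord0 \in set_cons (b, J)) = b.
Proof. by rewrite inE unlift_none. Qed.

Lemma in_set_consS p b (J : {set 'I_p}) i :
  (lift ord0 i \in set_cons (b, J)) = (i \in J).
Proof. by rewrite inE liftK. Qed.

Lemma set_mask_cons p b (J : {set 'I_p}) :
  set_mask (set_cons (b, J)) = b :: set_mask J.
Proof.
rewrite /set_mask enum_ordSl /= in_set_cons0 -map_comp; congr (_ :: _).
by apply: eq_map => i /=; rewrite in_set_consS.
Qed.

Lemma set_maskC p (I : {set 'I_p}) : set_mask (~: I) = map negb (set_mask I).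
Proof. by rewrite /set_mask -map_comp; apply: eq_map => i; rewrite /= inE. Qed.

Lemma sum_mask d (I : {set 'I_(size d)}) :
  \sum_(a <- mask (set_mask I) d) a = \sum_(i in I) d`_i.
Proof.
have dE : d = [seq d`_(nat_of_ord i) | i <- enum 'I_(size d)].
  by rewrite -[LHS](mkseq_nth 0) /mkseq -val_enum_ord -map_comp.
rewrite [X in mask _ X]dE -map_mask big_map /set_mask -filter_mask big_filter.
by rewrite big_enum_cond; apply: eq_bigl => i.
Qed.

Lemma koszul_cons a d b (J : {set 'I_(size d)}) :
  @koszul K n (size d).+1 (set_cons (b, J)) (a :: d) =
  (if b then 1 else @ksgn K n a (\sum_(c <- mask (set_mask J) d) c)) *
  koszul K J d.
Proof.
rewrite {1}/koszul big_mkcond big_ord_recl /= big1 ?mul1r; last first.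
  by move=> j; rewrite ltn0 andbF.
rewrite if_same mul1r.
transitivity (\prod_(i in J) ((if b then 1 else @ksgn K n a d`_i) *
    \prod_(j in ~: J | (j < i)%N) @ksgn K n d`_i d`_j)).
  rewrite [RHS]big_mkcond; apply: eq_bigr => i _.
  rewrite in_set_consS; case: ifP => // iJ.
  rewrite big_mkcond big_ord_recl inE in_set_cons0 /= andbT.
  congr (_ * _); first by case: b; rewrite // ksgnC.
  rewrite [RHS]big_mkcond; apply: eq_bigr => j _.
  by rewrite !inE liftK.
rewrite big_split /=; congr (_ * _); rewrite sum_mask.
case: b; first by rewrite big1.
by rewrite (big_morph (ksgn K a) (ksgnDr K a) (ksgn0r K a)).
Qed.

(** The analogue of ssum for masks instead of the subwords that they select: a mask
remembers the position of the last letter, even when letters are repeated. *)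
Fixpoint mask_sum M (Phi : bitseq -> M) d : M :=
  if d is a :: d' then
    mask_sum (fun m => Phi (true :: m)) d' +
    mask_sum (fun m => @ksgn K n a (\sum_(c <- mask m d') c) *: Phi (false :: m)) d'
  else Phi [::].

Lemma sum_koszul M (Phi : bitseq -> M) d :
  \sum_(I : {set 'I_(size d)}) koszul K I d *: Phi (set_mask I) = mask_sum Phi d.
Proof.
elim: d Phi => [|a d IH] Phi /=.
  rewrite (big_pred1 set0) => [|I].
    rewrite /koszul big1 => [|[] //]; rewrite scale1r /set_mask.
    by congr Phi; apply: size0nil; rewrite size_map size_enum_ord.
  by rewrite /=; apply/esym/eqP/setP; case.
rewrite (reindex _ (onW_bij _ (set_cons_bij (size d)))) /=.
transitivity (\sum_b \sum_(J : {set 'I_(size d)})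
    (if b then 1 else @ksgn K n a (\sum_(c <- mask (set_mask J) d) c)) *
      koszul K J d *: Phi (b :: set_mask J)).
  by rewrite pair_bigA; apply: eq_bigr => -[b J] _; rewrite koszul_cons set_mask_cons.
rewrite big_bool /= -!IH; congr (_ + _); apply: eq_bigr => J _.
  by rewrite mul1r.
by rewrite scalerA mulrC.
Qed.

Lemma eq_mask_sum M (Phi Psi : bitseq -> M) d :
  (forall m, size m = size d -> Phi m = Psi m) -> mask_sum Phi d = mask_sum Psi d.
Proof.
elim: d Phi Psi => [|a d IH] Phi Psi eqPP /=; first exact: eqPP.
by congr (_ + _); apply: IH => m sm; rewrite eqPP //= sm.
Qed.

Lemma mask_sum_rcons M (Phi : bitseq -> M) d a :
  (forall m, Phi (rcons m true) = 0) ->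
  mask_sum Phi (rcons d a) = mask_sum (fun m => Phi (rcons m false)) d.
Proof.
elim: d Phi => [|b d IH] Phi Phi0 /=.
  by rewrite (Phi0 [::]) add0r big_nil ksgn0r scale1r.
rewrite !IH => [|m|m]; rewrite -?rcons_cons ?Phi0 ?scaler0 //.
congr (_ + _); apply: eq_mask_sum => m sm.
by rewrite -!cats1 mask_cat // cats0.
Qed.

Lemma mask_sum_ssum (X : Type) (deg : X -> 'rV[int]_n) M
    (Phi : seq X -> seq X -> M) s :
  mask_sum (fun m => Phi (mask m s) (mask (map negb m) s)) (map deg s) =
  ssum deg Phi s.
Proof.
elim: s Phi => [|x s IH] Phi //=; rewrite -!IH; congr (_ + _).
by apply: eq_mask_sum => m _; rewrite -map_mask big_map.
Qed.
End SubsetSplittings.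

Section TensorZero.
Variables (K : fieldType) (A B : lmodType K).

Lemma tens0l (v : B) : (0 : A) *t v = 0.
Proof. by rewrite -(scale0r (0 : A)) tensZl scale0r. Qed.

Lemma tens0r (u : A) : u *t (0 : B) = 0.
Proof. by rewrite -(scale0r (0 : B)) tensZr scale0r. Qed.

Lemma tens_addr (u : A) (v w : B) : u *t (v + w) = u *t v + u *t w.
Proof. by rewrite -[v]scale1r tensDr !scale1r. Qed.
End TensorZero.

Section CoproductOfWords.
Variables (K : fieldType) (n : nat) (W : gradedSpace K n).
Local Notation TW := (tcoalg W).
Local Notation wsum := (ssum (@hdeg K n W)).

(** The last letter always goes to the right.  The splittings with empty left part
are excluded from the coproduct; here they vanish since the empty word is 0. *)
Lemma coprod_rcons (t : seq (hvec W)) x :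
  coprod W (word (rcons t x)) =
  wsum (fun I J => (word I : TW) *t (word (rcons J x) : TW)) t.
Proof.
rewrite coprodE /split_word.
pose Phi m := if last false m then 0 else
  (word (mask m (rcons t x)) : TW) *t (word (mask (map negb m) (rcons t x)) : TW).
transitivity (mask_sum Phi (map (@hdeg K n W) (rcons t x))).
  move ed : (map _ (rcons t x)) => d.
  have {ed} : size d = (size t).+1 by rewrite -ed size_map size_rcons.
  have : size (rcons t x) = (size t).+1 by rewrite size_rcons.
  rewrite -sum_koszul big_mkcond /=.
  move: (size (rcons t x)) (size d) => p _ -> ->.
  apply: eq_bigr => I _; rewrite /Phi /subword -set_maskC -!/(set_mask _).
  have -> : last false (set_mask I) = (ord_max \in I).
    by rewrite /set_mask enum_ordSr map_rcons last_rcons.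
  case: (eqVneq I set0) => [->|I0] /=.
    rewrite in_set0 /set_mask (eq_map (g := fun=> false)) => [|i]; last exact: in_set0.
    have -> : [seq false | _ <- enum 'I_(size t).+1] = nseq (size t).+1 false.
      rewrite -[X in nseq X](size_enum_ord (size t).+1).
      by elim: (enum _) => //= ? ? ->.
    by rewrite mask_false word0 tens0l scaler0.
  case: forallP => [Il|nIl]; case: ifP => // mI; rewrite ?scaler0 //.
    by have := Il ord_max; rewrite mI ltnn.
  case: nIl => i; apply/implyP => iI; rewrite ltnS ltn_neqAle -ltnS ltn_ord andbT.
  by apply: contraFN mI => /eqP im; rewrite (_ : ord_max = i) //; apply: val_inj.
rewrite map_rcons mask_sum_rcons => [|m]; last by rewrite /Phi last_rcons.
rewrite -mask_sum_ssum; apply: eq_mask_sum => m sm; rewrite size_map in sm.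
rewrite /Phi last_rcons map_rcons -!cats1 !mask_cat ?size_map //= cats0.
by [].
Qed.
End CoproductOfWords.

(** * Weights, and linear maps determined by words *)
Section LinearExtensionality.
Variable K : fieldType.

Lemma tensor_eq (A B M : lmodType K) (f g : {linear tensor A B -> M}) :
  (forall u v, f (u *t v) = g (u *t v)) -> f =1 g.
Proof. by move=> fg; apply: pres_eq => -[u v]; apply: fg. Qed.

Lemma linZ (A B : lmodType K) (f : {linear A -> B}) c u : f (c *: u) = c *: f u.
Proof. exact: linearZ. Qed.

Variable n : nat.

(** A vector is the sum of its homogeneous components. *)
Lemma hval_eq (W : gradedSpace K n) (M : lmodType K) (f g : W -> M) :
  linear f -> linear g ->
  (forall x : hvec W, f (hval x) = g (hval x)) -> f =1 g.
Proof.
move=> lf lg fg w.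
pose f' : {linear W -> M} := HB.pack f (GRing.isLinear.Build K W M _ f lf).
pose g' : {linear W -> M} := HB.pack g (GRing.isLinear.Build K W M _ g lg).
rewrite -[f w]/(f' w) -[g w]/(g' w).
have [_ ->] := gr_suppP w; rewrite !linear_sum; apply: eq_bigr => a _.
exact: (fg (hcomp a w)).
Qed.

Lemma tcoalg_eq_rcons (W : gradedSpace K n) (M : lmodType K)
    (f g : {linear tcoalg W -> M}) :
  (forall t x, f (word (rcons t x)) = g (word (rcons t x))) -> f =1 g.
Proof.
move=> fg; apply: tcoalg_eq => s; case/lastP: s => [|t x]; last exact: fg.
by rewrite word0 !linear0.
Qed.

Lemma homog0 (W : gradedSpace K n) a : homog a (0 : W).
Proof. by rewrite /homog linear0. Qed.

Lemma homogD (W : gradedSpace K n) a (u v : W) :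
  homog a u -> homog a v -> homog a (u + v).
Proof. by rewrite /homog linearD => /eqP-> /eqP->. Qed.

Lemma homogZ (W : gradedSpace K n) a c (u : W) : homog a u -> homog a (c *: u).
Proof. by rewrite /homog linearZ => /eqP /= ->. Qed.

Lemma homogB (W : gradedSpace K n) a (u v : W) :
  homog a u -> homog a v -> homog a (u - v).
Proof. by rewrite /homog linearB => /eqP-> /eqP->. Qed.

Lemma homog_ssum (W : gradedSpace K n) a (X : Type) (deg : X -> 'rV[int]_n)
    (Phi : seq X -> seq X -> W) s :
  (forall I J, \sum_(x <- I) deg x + \sum_(x <- J) deg x = \sum_(x <- s) deg x ->
     homog a (Phi I J)) -> homog a (ssum deg Phi s).
Proof.
move=> hPhi; apply/eqP; rewrite linear_ssum; apply: eq_ssum => I J /hPhi.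
by move/eqP.
Qed.

Lemma wdeg_rcons (W : gradedSpace K n) t (x : hvec W) :
  wdeg (rcons t x) = wdeg t + hdeg x.
Proof. by rewrite /wdeg -cats1 big_cat big_seq1. Qed.

Lemma homogP (V : gradedSpace K n) a (v : V) :
  reflect (gr_pr V a v = v) (homog a v).
Proof. exact: eqP. Qed.

(** T(W) is spanned by words, which are homogeneous. *)
Lemma word_weight (W : gradedSpace K n) (V : gradedSpace K n) d
    (f : {linear tcoalg W -> V}) :
  (forall t x, homog (wdeg (rcons t x) + d) (f (word (rcons t x)))) ->
  has_weight d f.
Proof.
move=> fw a v av; have fE u : gr_pr V (a + d) (f (gr_pr (tcoalg W) a u)) = f (gr_pr (tcoalg W) a u).
  pose g : {linear tcoalg W -> V} := gr_pr V (a + d) \o f \o tcoalg_pr W a.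
  pose h : {linear tcoalg W -> V} := f \o tcoalg_pr W a.
  rewrite -[LHS]/(g u) -[RHS]/(h u); apply: tcoalg_eq_rcons => t x.
  rewrite /g /h /= tliftE; case: eqP => [<-|_]; last by rewrite !linear0.
  by apply/eqP; exact: fw.
by apply/homogP; have := fE v; rewrite (homogP _ _ av).
Qed.

Lemma weightD (V W : gradedSpace K n) d (f g : {linear V -> W}) :
  has_weight d f -> has_weight d g -> has_weight d (f \+ g).
Proof. by move=> hf hg a v av; rewrite homogD ?hf ?hg. Qed.

Lemma weightB (V W : gradedSpace K n) d (f g : {linear V -> W}) :
  has_weight d f -> has_weight d g -> has_weight d (f \- g).
Proof. by move=> hf hg a v av; apply: homogB; [apply: hf|apply: hg]. Qed.

Lemma weight_comp (U V W : gradedSpace K n) c d e (f : {linear V -> W})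
    (g : {linear U -> V}) :
  has_weight c f -> has_weight d g -> d + c = e -> has_weight e (f \o g).
Proof. by move=> hf hg <- a v av; rewrite addrA; apply/hf/hg. Qed.

Lemma proj_weight (W : gradedSpace K n) : has_weight 0 (tcoalg_proj W).
Proof.
apply: word_weight => t x; rewrite addr0 tliftE.
case: t => [|y [|z t]]; rewrite ?homog0 //=.
by rewrite /wdeg big_seq1; exact: (valP x).
Qed.

Lemma inj_weight (W : gradedSpace K n) : has_weight 0 (@tcoalg_inj K n W).
Proof.
move=> a v av; rewrite addr0.
have -> : v = hval (exist _ (a, v) av : hvec W) by [].
rewrite tcoalg_injE; have := homog_word [:: exist _ (a, v) av : hvec W].
by rewrite /wdeg big_seq1.
Qed.

Lemma gr_sign0 (W : gradedSpace K n) : @gr_sign K n W 0 =1 idfun.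
Proof.
apply: hval_eq; [exact: linearP|exact: linearP|] => x.
by rewrite (gr_signE _ (valP x)) -/(ksgn K _ _) ksgn0l scale1r.
Qed.

Lemma gr_sign_weight (V W : gradedSpace K n) c d (f : {linear V -> W}) :
  has_weight d f -> forall v, gr_sign c (f v) = ksgn K c d *: f (gr_sign c v).
Proof.
move=> fd; apply: hval_eq => [||x].
- exact: (linearP (gr_sign c \o f)).
- exact: (linearP (ksgn K c d \*: (f \o gr_sign c))).
rewrite (gr_signE _ (fd _ _ (valP x))) (gr_signE _ (valP x)) linearZ scalerA.
by rewrite -!/(ksgn K _ _) ksgnDr mulrC.
Qed.
End LinearExtensionality.

(** * Appending a letter, and maps defined by recursion on words *)
Section Append.
Variables (K : fieldType) (n : nat) (W : gradedSpace K n).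
Local Notation TW := (tcoalg W).

Definition snocl (u : TW) (w : W) : TW := tlift (glue_wordlin u) (tcoalg_inj w).

Lemma snocl_word s (x : hvec W) :
  snocl (word s) (hval x) = if s is [::] then 0 else word (rcons s x).
Proof. by rewrite /snocl tcoalg_injE !tliftE. Qed.

Lemma proj_word s :
  tcoalg_proj W (word s) = if s is [:: x] then hval x else 0.
Proof. exact: tliftE. Qed.

Fact snocl_linear u : linear (snocl u).
Proof. exact: (linearP (tlift (glue_wordlin u) \o @tcoalg_inj K n W)). Qed.
HB.instance Definition _ u :=
  GRing.isLinear.Build K W TW _ (snocl u) (snocl_linear u).

(** The left inverse of the reduced coproduct only sees the letters of its second
argument; this is deconcatenation of the last letter read backwards. *)
Lemma glueE (u v : TW) : tlift (glue_wordlin u) v = snocl u (tcoalg_proj W v).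
Proof.
pose f := tlift (glue_wordlin u).
pose g : {linear TW -> TW} := f \o (@tcoalg_inj K n W) \o tcoalg_proj W.
rewrite -[RHS]/(g v); apply: tcoalg_eq => s.
rewrite [RHS]/(snocl u (tcoalg_proj W (word s))) proj_word tliftE.
case: s => [|x [|y s]]; try exact: esym (linear0 (snocl u)).
by rewrite /snocl tcoalg_injE tliftE.
Qed.

Definition snocr w u := snocl u w.
Fact snocr_linear w : linear (snocr w).
Proof. by move=> a u v; case: (glue_bilin W) => + _; apply. Qed.
HB.instance Definition _ w :=
  GRing.isLinear.Build K TW TW _ (snocr w) (snocr_linear w).

Lemma snocl0 w : snocl 0 w = 0. Proof. exact: (linear0 (snocr w)). Qed.

Lemma snocl0r u : snocl u 0 = 0. Proof. exact: (linear0 (snocl u)). Qed.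

Lemma snocl_homog a b u w : homog a u -> homog b w -> homog (a + b) (snocl u w).
Proof.
move=> au bw; pose x : hvec W := exist _ (b, w) bw.
suff sw : has_weight b (snocr w) by exact: sw.
apply: word_weight => t y.
change (homog (wdeg (rcons t y) + b) (snocl (word (rcons t y)) (hval x))).
rewrite snocl_word.
have -> : wdeg (rcons t y) + b = wdeg (rcons (rcons t y) x).
  by rewrite -(cats1 (rcons t y)) /wdeg big_cat big_seq1.
by have := homog_word (rcons (rcons t y) x); case: t.
Qed.
End Append.

Section AppendAlong.
Variables (K : fieldType) (n : nat) (W W' : gradedSpace K n).
Local Notation TW := (tcoalg W).
Local Notation TW' := (tcoalg W').
Local Notation wsum := (ssum (@hdeg K n W)).
Implicit Types (X Y F : {linear TW -> TW'}) (e f : {linear TW -> W'}).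

Fact append_along_bilin X d e : bilin (fun u v => snocl (X (gr_sign d u)) (e v)).
Proof.
split=> w.
  exact: (linearP (snocr (e w) \o X \o gr_sign d)).
exact: (linearP (snocl (X (gr_sign d w)) \o e)).
Qed.

(** Split a word by the coproduct, transform the left part by X and the right part
into a letter by e, of weight d, and append that letter. *)
Definition append_along X d e : {linear TW -> TW'} :=
  tensor_lift (append_along_bilin X d e) \o coprod W.

Lemma append_along_rcons X d e t x : append_along X d e (word (rcons t x)) =
  wsum (fun I J =>
    ksgn K d (wdeg I) *: snocl (X (word I)) (e (word (rcons J x)))) t.
Proof.
rewrite /append_along /= coprod_rcons linear_ssum; apply: eq_ssum => I J _ _.
rewrite tensor_liftE (gr_signE _ (homog_word I)).
exact: (linZ (snocr _ \o X)).
Qed.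

(** Both parts of a splitting that contributes are proper subwords. *)
Lemma eq_append_along X Y d e f s :
  (forall I, (size I < size s)%N -> X (word I) = Y (word I)) ->
  (forall J, (size J < size s)%N -> e (word J) = f (word J)) ->
  append_along X d e (word s) = append_along Y d f (word s).
Proof.
case/lastP: s => [|t x]; first by rewrite word0 !linear0.
rewrite size_rcons => XY ef; rewrite !append_along_rcons.
apply: eq_ssum => -[|y I] J _ sIJ; first by rewrite word0 (linear0 X) (linear0 Y) !snocl0.
rewrite XY; last by rewrite ltnS -sIJ leq_addr.
by rewrite ef // size_rcons ltnS -sIJ addSn ltnS leq_addl.
Qed.

Lemma append_along_weight X c d e c' b :
  has_weight c X -> has_weight c' e -> c + c' = b ->
  has_weight b (append_along X d e).
Proof.
move=> Xc ec <-; apply: word_weight => t x; rewrite append_along_rcons.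
apply: homog_ssum => I J dIJ; apply: homogZ.
have -> : wdeg (rcons t x) + (c + c') = (wdeg I + c) + (wdeg (rcons J x) + c').
  rewrite [RHS]addrACA; congr (_ + _); rewrite !wdeg_rcons addrA.
  by congr (_ + _); exact: esym dIJ.
by apply: snocl_homog; [apply: Xc|apply: ec]; apply: homog_word.
Qed.

Lemma append_along_glue X d (E : {linear TW -> TW'}) z :
  tensor_lift (glue_bilin W') (tensor_map X d E z) =
  tensor_lift (append_along_bilin X d (tcoalg_proj W' \o E)) z.
Proof.
rewrite -[LHS]/((tensor_lift (glue_bilin W') \o tensor_map X d E) z).
apply: tensor_eq => u v; rewrite /= /tensor_map !tensor_liftE.
exact: glueE.
Qed.
End AppendAlong.
Arguments append_along : simpl never.

Section FixedPoint.
Variables (K : fieldType) (n : nat) (W W' : gradedSpace K n).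
Local Notation TW := (tcoalg W).
Local Notation TW' := (tcoalg W').

(** The shape common to cohomomorphisms, coderivations and the homotopy below; the
left parts being proper subwords, it is a recursion on the length of words. *)
Definition fixes (b : {linear TW -> TW'}) (e : {linear TW -> W'})
    (X : {linear TW -> TW'}) := forall x, X x = b x + append_along X 0 e x.

Lemma fix_local b b' e e' X X' k : fixes b e X -> fixes b' e' X' ->
  (forall s, (size s <= k)%N -> b (word s) = b' (word s)) ->
  (forall s, (size s <= k)%N -> e (word s) = e' (word s)) ->
  forall s, (size s <= k)%N -> X (word s) = X' (word s).
Proof.
move=> hX hX' bb ee s; have [m] := ubnP (size s).
elim: m s => // m IH s /ltnSE sm sk; rewrite hX hX' bb //; congr (_ + _).
apply: eq_append_along => [I Is|J Js]; last by rewrite ee // (leq_trans (ltnW Js)).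
by rewrite IH ?(leq_trans Is) // ltnW // (leq_trans Is).
Qed.

Section Construction.
Variables (b : {linear TW -> TW'}) (e : {linear TW -> W'}).

(** Iterating the equation from 0 gives linear maps that agree with the solution on
words of bounded length; this avoids checking linearity of a recursive function on
words. *)
Fixpoint fix_iter k : {linear TW -> TW'} :=
  if k is k'.+1 then b \+ append_along (fix_iter k') 0 e else \0.

Lemma fix_iterE k s : (size s <= k)%N ->
  fix_iter k (word s) = fix_iter (size s) (word s).
Proof.
have [m] := ubnP (size s); elim: m s k => // m IH s k /ltnSE sm sk.
case: s sm sk => [|x s] sm sk; first by rewrite word0 !linear0.
case: k sk => // k sk /=; congr (_ + _); apply: eq_append_along => // I Is.
rewrite IH ?(leq_trans Is) //; last by rewrite -ltnS (leq_trans Is).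
by rewrite [RHS]IH // (leq_trans Is).
Qed.

Fact fix_wordlin : wordlin (fun s => fix_iter (size s) (word s)).
Proof.
split=> [|s t a x y z xyz]; first by rewrite word0 linear0.
by rewrite !size_cat /= (word_lin s t xyz) linearP.
Qed.

Definition fixm : {linear TW -> TW'} := tlift fix_wordlin.

Lemma fixmP : fixes b e fixm.
Proof.
move=> x; rewrite -[RHS]/((b \+ append_along fixm 0 e) x); apply: tcoalg_eq => s /=.
rewrite tliftE; case: s => [|y s]; first by rewrite word0 !linear0 addr0.
congr (_ + _); apply: eq_append_along => // I Is.
by rewrite tliftE fix_iterE.
Qed.

Lemma fixm_weight c : has_weight c b -> has_weight 0 e -> has_weight c fixm.
Proof.
move=> bc e0; have ic k : has_weight c (fix_iter k).
  elim: k => [|k IH] /=; first by move=> a v _; apply: homog0.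
  by apply: weightD => //; apply: append_along_weight IH e0 _; rewrite addr0.
apply: word_weight => t x; rewrite tliftE; apply: ic; exact: homog_word.
Qed.
End Construction.
End FixedPoint.

(** * Cofreeness: cohomomorphisms and coderivations from their corestrictions *)
Section Shuffle.
Variables (K : fieldType) (n : nat) (W : gradedSpace K n).
Local Notation TW := (tcoalg W).

Fact twist_bilin :
  bilin (fun u v : TW => gr_sum (fun a u' => gr_sign a v *t u') u).
Proof.
split=> w; first by apply: gr_sum_linear => a c u v; apply: tensDr.
move=> c u v; rewrite /gr_sum scaler_sumr -big_split; apply: eq_bigr => a _.
by rewrite linearP; apply: tensDl.
Qed.

Definition twist : {linear tensor TW TW -> tensor TW TW} :=
  tensor_lift twist_bilin.

Lemma twistE a b u v : homog a u -> homog b v ->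
  twist (u *t v) = ksgn K a b *: (v *t u).
Proof.
move=> au bv; rewrite /twist tensor_liftE (gr_sum_homog _ au).
  by rewrite (gr_signE _ bv) tensZl.
by move=> c d x y; apply: tensDr.
Qed.

(** The coproduct that splits off either part without constraint on the last letter,
recovered from coprod by symmetrization. *)
Definition unshuffle : {linear TW -> tensor TW TW} :=
  coprod W \+ (twist \o coprod W).

Fact append_right_bilin w : bilin (fun u v : TW => u *t snocl v w).
Proof.
split=> x c u v; first exact: tensDl.
have -> : snocl (c *: u + v) w = c *: snocl u w + snocl v w.
  exact: snocr_linear.
exact: tensDr.
Qed.

Definition append_right w : {linear tensor TW TW -> tensor TW TW} :=
  tensor_lift (append_right_bilin w).

Lemma append_right_linear z : linear (append_right^~ z).
Proof.
move=> c u v.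
rewrite -[RHS]/((c \*: append_right u \+ append_right v) z).
apply: tensor_eq => x y /=; rewrite /append_right !tensor_liftE.
by rewrite -tensDr; congr (_ *t _); apply: snocl_linear.
Qed.
End Shuffle.
Arguments twist {K n W}.
Arguments unshuffle {K n W}.
Arguments append_right {K n W}.

Section CoproductFormulas.
Variables (K : fieldType) (n : nat) (W : gradedSpace K n).
Local Notation TW := (tcoalg W).

(** For a Phi compatible with the twist, symmetrizing the sum over splittings with
the last letter on the right gives the sum over all splittings: the twist supplies
those with the last letter on the left. *)
Lemma unshuffle_rcons (W0 : gradedSpace K n)
    (Phi : seq (hvec W0) -> seq (hvec W0) -> tensor TW TW) (y : TW) t x :
  (forall A B, twist (Phi A B) = ksgn K (wdeg A) (wdeg B) *: Phi B A) ->
  coprod W y = ssum (@hdeg K n W0) (fun A B => Phi A (rcons B x)) t ->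
  unshuffle y = ssum (@hdeg K n W0) Phi (rcons t x).
Proof.
move=> twPhi yE; rewrite /unshuffle /= yE ssum_rcons addrC; congr (_ + _).
rewrite linear_ssum ssumC; apply: eq_ssum => A B _ _.
rewrite twPhi scalerA wdeg_rcons ksgnDr mulrA.
by rewrite (ksgnC K (wdeg B)) ksgn_sqr mul1r ksgnC.
Qed.

Lemma unshuffle_word (s : seq (hvec W)) : unshuffle (word s) =
  ssum (@hdeg K n W) (fun A B => (word A : TW) *t (word B : TW)) s.
Proof.
case/lastP: s => [|t x]; first by rewrite word0 linear0 /= word0 tens0l.
apply: unshuffle_rcons (coprod_rcons t x) => A B.
by rewrite (twistE (homog_word A) (homog_word B)).
Qed.

(** When w is appended to y it becomes the last letter; y is split freely, and the
first term is the splitting with w alone on the right. *)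
Lemma coprod_snocl (y : TW) w :
  coprod W (snocl y w) = y *t tcoalg_inj w + append_right w (unshuffle y).
Proof.
move: w; apply: hval_eq => [||x].
- exact: (linearP (coprod W \o snocl y)).
- move=> c u v; rewrite append_right_linear linearP tensDr scalerDr.
  by rewrite addrACA.
pose f : {linear TW -> tensor TW TW} := coprod W \o snocr (hval x).
have ilin : linear (fun y : TW => y *t tcoalg_inj (hval x)).
  by move=> c u v; apply: tensDl.
pose i : {linear TW -> tensor TW TW} :=
  HB.pack (fun y : TW => y *t tcoalg_inj (hval x))
    (GRing.isLinear.Build K TW (tensor TW TW) _ _ ilin).
pose g : {linear TW -> tensor TW TW} :=
  i \+ (append_right (hval x) \o unshuffle).
rewrite -[LHS]/(f y) -[RHS]/(g y); apply: tcoalg_eq_rcons => t z.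
rewrite [LHS]/(coprod W (snocl (word (rcons t z)) (hval x))).
transitivity (ssum (@hdeg K n W) (fun I J =>
    (if J is [::] then (word I : TW) *t (word [:: x] : TW) else 0) +
    append_right (hval x) ((word I : TW) *t (word J : TW))) (rcons t z)).
  rewrite snocl_word.
  have -> : (if rcons t z is [::] then 0 else word (rcons (rcons t z) x)) =
    word (rcons (rcons t z) x) by case: (t).
  rewrite [LHS]coprod_rcons; apply: eq_ssum => I [|b J] _ _.
    by rewrite /append_right tensor_liftE snocl_word tens0r addr0.
  by rewrite /append_right tensor_liftE snocl_word add0r.
rewrite ssumD ssum_nilr -linear_ssum -unshuffle_word -tcoalg_injE.
by [].
Qed.

Lemma tensor_map_rcons (A : gradedSpace K n) (B : lmodType K)
    (X : {linear TW -> A}) d (Y : {linear TW -> B}) t x :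
  tensor_map X d Y (coprod W (word (rcons t x))) =
  ssum (@hdeg K n W) (fun I J =>
    ksgn K d (wdeg I) *: (X (word I) *t Y (word (rcons J x)))) t.
Proof.
rewrite coprod_rcons linear_ssum; apply: eq_ssum => I J _ _.
exact: (tensor_mapE _ _ _ _ (homog_word I)).
Qed.
End CoproductFormulas.

Section TensorRight.
Variables (K : fieldType) (A B : lmodType K) (u : A).

Definition tensr (v : B) : tensor A B := u *t v.
Fact tensr_linear : linear tensr. Proof. by move=> c v w; apply: tensDr. Qed.
HB.instance Definition _ :=
  GRing.isLinear.Build K B (tensor A B) _ tensr tensr_linear.
End TensorRight.

(** T(W) is W plus the words with a last letter to be removed. *)
Lemma tcoalg_split (K : fieldType) (n : nat) (W : gradedSpace K n) (u : tcoalg W) :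
  u = tcoalg_inj (tcoalg_proj W u) + tensor_lift (glue_bilin W) (coprod W u).
Proof. by rewrite glue_coprod addrC subrK. Qed.

Section Cohomomorphisms.
Variables (K : fieldType) (n : nat) (W W' : gradedSpace K n).
Local Notation TW := (tcoalg W).
Local Notation TW' := (tcoalg W').
Local Notation wsum := (ssum (@hdeg K n W)).

(** A cohomomorphism is determined by its corestriction, through a recursion. *)
Lemma cohom_fixes (F : {linear TW -> TW'}) : is_cohomomorphism F ->
  fixes (@tcoalg_inj K n W' \o (tcoalg_proj W' \o F)) (tcoalg_proj W' \o F) F.
Proof.
by case=> _ hF x; rewrite [LHS]tcoalg_split hF append_along_glue.
Qed.

(** E is a coderivation along F, which need not be the identity. *)
Lemma coder_fixes (F E : {linear TW -> TW'}) d :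
  (forall x, coprod W' (E x) =
     tensor_map E 0 F (coprod W x) + tensor_map F d E (coprod W x)) ->
  fixes (@tcoalg_inj K n W' \o (tcoalg_proj W' \o E) \+
         append_along F d (tcoalg_proj W' \o E))
    (tcoalg_proj W' \o F) E.
Proof.
move=> hE x; rewrite [LHS]tcoalg_split hE linearD !append_along_glue.
by rewrite [X in _ + X]addrC addrA.
Qed.

Definition cohom (f : {linear TW -> W'}) : {linear TW -> TW'} :=
  fixm (@tcoalg_inj K n W' \o f) f.

Section Corestriction.
Variable f : {linear TW -> W'}.
Local Notation F := (cohom f).

Lemma cohomP : fixes (@tcoalg_inj K n W' \o f) f F. Proof. exact: fixmP. Qed.

Hypothesis f0 : has_weight 0 f.

Lemma cohom_weight : has_weight 0 F.
Proof.
apply: fixm_weight => //; apply: weight_comp (@inj_weight K n W') f0 _.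
by rewrite addr0.
Qed.

(** By induction the left part of a splitting is known to be compatible with
unshuffling; coassociativity then regroups the two successive splittings so that
the recursion for F can be folded on the right part. *)
Lemma coprod_cohom t x : coprod W' (F (word (rcons t x))) =
  wsum (fun I J => F (word I) *t F (word (rcons J x))) t.
Proof.
have [m] := ubnP (size t); elim: m t x => // m IH t x /ltnSE tm.
rewrite cohomP linearD [X in X + _]coprod_inj add0r append_along_rcons linear_ssum.
transitivity (wsum (fun I J =>
    F (word I) *t tcoalg_inj (f (word (rcons J x))) +
    wsum (fun A B => F (word A) *t snocl (F (word B)) (f (word (rcons J x)))) I) t).
  apply: eq_ssum => I J _ sIJ; rewrite ksgn0l scale1r coprod_snocl.
  congr (_ + _).
  have {}sIJ : (size I <= m)%N by apply: leq_trans tm; rewrite -sIJ leq_addr.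
  rewrite (_ : unshuffle _ = wsum (fun A B => F (word A) *t F (word B)) I).
    rewrite linear_ssum; apply: eq_ssum => A B _ _.
    by rewrite /append_right tensor_liftE.
  case/lastP: I sIJ => [|I y] sI; first by rewrite word0 !linear0 /= word0 linear0 tens0l.
  apply: unshuffle_rcons => [A B|]; last by apply: IH; rewrite size_rcons in sI.
  apply: twistE; rewrite -[wdeg _]addr0; apply: cohom_weight; exact: homog_word.
rewrite ssumD ssum_coassoc -ssumD; apply: eq_ssum => A L _ _.
rewrite [F (word (rcons L x))]cohomP tens_addr append_along_rcons; congr (_ + _).
rewrite -[RHS]/(tensr (F (word A)) _) linear_ssum; apply: eq_ssum => B J _ _.
by rewrite ksgn0l scale1r.
Qed.

Lemma cohom_is_cohom : is_cohomomorphism F.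
Proof.
split; first exact: cohom_weight.
move=> x; rewrite -[LHS]/((coprod W' \o F) x).
rewrite -[RHS]/((tensor_map F 0 F \o coprod W) x).
apply: tcoalg_eq_rcons => t y; rewrite [LHS]coprod_cohom [RHS]tensor_map_rcons.
by apply: eq_ssum => I J _ _; rewrite ksgn0l scale1r.
Qed.
End Corestriction.
End Cohomomorphisms.

(** The construction for coderivations follows that for cohomomorphisms, with the
identity in the role of F. *)
Section Coderivations.
Variables (K : fieldType) (n : nat) (W : gradedSpace K n).
Local Notation TW := (tcoalg W).
Local Notation wsum := (ssum (@hdeg K n W)).
Local Notation id_T := (idfun : {linear TW -> TW}).

Lemma id_fixes : fixes (@tcoalg_inj K n W \o tcoalg_proj W) (tcoalg_proj W) id_T.
Proof.
move=> u; rewrite [LHS]tcoalg_split; congr (_ + _); rewrite /append_along /=.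
apply: tensor_eq => x y; rewrite !tensor_liftE glueE.
by rewrite gr_sign0.
Qed.

Variables (d : 'rV[int]_n) (e : {linear TW -> W}).

Definition coder : {linear TW -> TW} :=
  fixm ((@tcoalg_inj K n W \o e) \+ append_along id_T d e) (tcoalg_proj W).
Local Notation X := coder.

Lemma coderP :
  fixes ((@tcoalg_inj K n W \o e) \+ append_along id_T d e) (tcoalg_proj W) X.
Proof. exact: fixmP. Qed.

Hypothesis e_weight : has_weight d e.

Lemma coder_weight : has_weight d X.
Proof.
apply: fixm_weight; last exact: proj_weight.
apply: weightD; first by apply: weight_comp (@inj_weight K n W) e_weight _; rewrite addr0.
by apply: append_along_weight e_weight (add0r d) => a v av; rewrite addr0.
Qed.

(** The two splittings that occur are regrouped by coassociativity as for
cohomomorphisms.  P collects the terms with a single splitting and Q those with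
two. *)
Lemma coprod_coder t x : coprod W (X (word (rcons t x))) =
  wsum (fun I J => X (word I) *t word (rcons J x) +
    ksgn K d (wdeg I) *: ((word I : TW) *t X (word (rcons J x)))) t.
Proof.
have [m] := ubnP (size t); elim: m t x => // m IH t x /ltnSE tm.
pose p J := tcoalg_proj W (word (rcons J x)).
pose eJ J := e (word (rcons J x)).
pose P I J : tensor TW TW := X (word I) *t tcoalg_inj (p J) +
  ksgn K d (wdeg I) *: ((word I : TW) *t tcoalg_inj (eJ J)).
pose Q A B J : tensor TW TW := X (word A) *t snocl (word B) (p J) +
  ksgn K d (wdeg A) *: ((word A : TW) *t
    (ksgn K d (wdeg B) *: snocl (word B) (eJ J) + snocl (X (word B)) (p J))).
transitivity (wsum (fun I J => P I J + wsum (fun A B => Q A B J) I) t).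
  rewrite coderP linearD [X in X + _]linearD [X in X + _ + _]coprod_inj add0r.
  rewrite !append_along_rcons !linear_ssum -ssumD; apply: eq_ssum => I J _ sIJ.
  rewrite ksgn0l scale1r linZ !coprod_snocl -/(p J) -/(eJ J) /P.
  rewrite scalerDr addrACA; congr (_ + _); first exact: addrC.
  have {}sIJ : (size I <= m)%N by apply: leq_trans tm; rewrite -sIJ leq_addr.
  rewrite [unshuffle (X _)](_ : _ = wsum (fun A B => X (word A) *t word B +
     ksgn K d (wdeg A) *: ((word A : TW) *t X (word B))) I); last first.
    case/lastP: I sIJ => [|I y] sI.
      by rewrite word0 !linear0 /= word0 linear0 !tens0l scaler0 addr0.
    apply: unshuffle_rcons => [A B|]; last by apply: IH; rewrite size_rcons in sI.
    have XA A' : homog (wdeg A' + d) (X (word A')).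
      by apply: coder_weight; exact: homog_word.
    rewrite linearD linZ (twistE (XA _) (homog_word _)) (twistE (homog_word _) (XA _)).
    rewrite addrC scalerDr !scalerA !ksgnDl !ksgnDr; congr (_ *: _ + _ *: _).
      by rewrite mulrCA (ksgnC K d) ksgn_sqr mulr1.
  rewrite [unshuffle _]unshuffle_word !linear_ssum -ssumD; apply: eq_ssum => A B dAB _.
  rewrite linearD linZ /append_right !tensor_liftE /Q addrCA; congr (_ + _).
  have -> : wdeg I = wdeg A + wdeg B by exact: esym dAB.
  by rewrite tens_addr scalerDr ksgnDr tensZr scalerA.
rewrite ssumD ssum_coassoc -ssumD; apply: eq_ssum => A L _ _.
rewrite /P /Q ssumD ssumZ addrACA; congr (_ + _).
  rewrite [word (rcons L x)]id_fixes tens_addr; congr (_ + _).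
  rewrite append_along_rcons -[RHS]/(tensr (X (word A)) _) linear_ssum.
  by apply: eq_ssum => B J _ _; rewrite ksgn0l scale1r.
rewrite -scalerDr; congr (_ *: _); rewrite coderP -addrA tens_addr; congr (_ + _).
rewrite !append_along_rcons -ssumD -[RHS]/(tensr (word A) _) linear_ssum.
by apply: eq_ssum => B J _ _; rewrite ksgn0l scale1r.
Qed.

Lemma coder_is_coder : is_coderivation d X.
Proof.
split; first exact: coder_weight.
move=> x; rewrite -[LHS]/((coprod W \o X) x).
rewrite -[RHS]/(((tensor_map X 0 id_T \o coprod W) \+
  (tensor_map id_T d X \o coprod W)) x).
apply: tcoalg_eq_rcons => t y; rewrite [LHS]coprod_coder.
rewrite [RHS]/(tensor_map X 0 id_T (coprod W (word (rcons t y))) +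
  tensor_map id_T d X (coprod W (word (rcons t y)))).
rewrite ssumD; congr (_ + _); rewrite [RHS]tensor_map_rcons //.
by apply: eq_ssum => I J _ _; rewrite ksgn0l scale1r.
Qed.
End Coderivations.

(** * The filtration by word length, and leading terms *)
Section Filtration.
Variables (K : fieldType) (n : nat) (W : gradedSpace K n).
Local Notation TW := (tcoalg W).

Fact tail_wordlin p :
  wordlin (fun s : seq (hvec W) => if (p <= size s)%N then word s else 0).
Proof.
split=> [|s t a x y z xyz]; first by rewrite word0 if_same.
rewrite !size_cat /=; case: ifP => _; last by rewrite scaler0 addr0.
exact: word_lin.
Qed.

(** The projection onto words of length at least p.  Its kernel is the span of the
shorter words, so that congruences modulo shorter words are equations between
values of tail. *)
Definition tail p : {linear TW -> TW} := tlift (tail_wordlin p).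

Lemma tail_word p s : tail p (word s) = if (p <= size s)%N then word s else 0.
Proof. exact: tliftE. Qed.

Lemma tailD p x y : tail p (x + y) = tail p x + tail p y.
Proof. exact: linearD. Qed.

Lemma tailB p x y : tail p (x - y) = tail p x - tail p y.
Proof. exact: linearB. Qed.

Definition filt p (x : TW) : Prop := tail p x = 0.

Lemma filt_word p s : (size s < p)%N -> filt p (word s).
Proof. by move=> sp; rewrite /filt tliftE leqNgt sp. Qed.

Lemma filt0 p : filt p 0. Proof. exact: linear0. Qed.

Lemma filtD p x y : filt p x -> filt p y -> filt p (x + y).
Proof. by rewrite /filt linearD => -> ->; rewrite addr0. Qed.

Lemma filtN p x : filt p x -> filt p (- x).
Proof. by rewrite /filt linearN => ->; rewrite oppr0. Qed.

Lemma filtB p x y : filt p x -> filt p y -> filt p (x - y).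
Proof. by move=> hx /filtN; apply: filtD. Qed.

Lemma filtZ p c x : filt p x -> filt p (c *: x).
Proof. by rewrite /filt linZ => ->; rewrite scaler0. Qed.

Lemma filt_ssum p (X : Type) (deg : X -> 'rV[int]_n) (Phi : seq X -> seq X -> TW) s :
  (forall I J, (size I + size J = size s)%N -> filt p (Phi I J)) ->
  filt p (ssum deg Phi s).
Proof.
move=> hPhi; rewrite /filt linear_ssum -[RHS](ssum0 deg _ s).
by apply: eq_ssum => I J _ /hPhi.
Qed.

Lemma filt_eq (M : lmodType K) (f g : {linear TW -> M}) p :
  (forall s, (size s < p)%N -> f (word s) = g (word s)) ->
  forall x, filt p x -> f x = g x.
Proof.
move=> fg x xp; have xE : x = x - tail p x by rewrite xp subr0.
pose f' : {linear TW -> M} := f \o (idfun \- tail p).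
pose g' : {linear TW -> M} := g \o (idfun \- tail p).
rewrite xE -[LHS]/(f' x) -[RHS]/(g' x); apply: tcoalg_eq => s.
change (f (word s - tail p (word s)) = g (word s - tail p (word s))).
rewrite tail_word; case: leqP => sp; last by rewrite subr0 fg.
by rewrite subrr !linear0.
Qed.

Lemma filt_leq p q x : (p <= q)%N -> filt p x -> filt q x.
Proof.
move=> pq; apply: (filt_eq (f := tail q) (g := \0)) => s sp.
exact: (filt_word (leq_trans sp pq)).
Qed.

Lemma filt_snocl p u w : filt p u -> filt p.+1 (snocl u w).
Proof.
move=> up; move: w; apply: hval_eq => [||x].
- exact: (linearP (tail p.+1 \o snocl u)).
- exact: (linearP (\0 : {linear W -> TW})).
pose f : {linear TW -> TW} := tail p.+1 \o snocr (hval x).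
rewrite -[LHS]/(f u) -[RHS]/((\0 : {linear TW -> TW}) u).
apply: filt_eq up => s sp.
have : filt p.+1 (snocl (word s) (hval x)); last by [].
rewrite snocl_word; case: s sp => [|y s] sp; first exact: filt0.
by apply: filt_word; rewrite size_rcons ltnS.
Qed.

Lemma filt_inj w : filt 2 (tcoalg_inj w).
Proof.
move: w; apply: hval_eq => [||x].
- exact: (linearP (tail 2 \o @tcoalg_inj K n W)).
- exact: (linearP (\0 : {linear W -> TW})).
by rewrite tcoalg_injE; apply: filt_word.
Qed.
End Filtration.

Lemma filt_map (K : fieldType) n (W W' : gradedSpace K n)
    (f : {linear tcoalg W -> tcoalg W'}) p q :
  (forall s, (size s < p)%N -> filt q (f (word s))) ->
  forall x, filt p x -> filt q (f x).
Proof.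
by move=> fw x; apply: (filt_eq (f := tail W' q \o f) (g := \0)) => s /fw.
Qed.

Section FilteredMaps.
Variables (K : fieldType) (n : nat) (W W' : gradedSpace K n).
Local Notation TW := (tcoalg W).
Local Notation TW' := (tcoalg W').
Implicit Types (X F : {linear TW -> TW'}).

Definition filtered X := forall s, filt (size s).+1 (X (word s)).

Definition lowering X := forall s, filt (size s) (X (word s)).

Lemma filteredP X : filtered X -> forall p x, filt p x -> filt p (X x).
Proof. by move=> hX p; apply: filt_map => s sp; apply: filt_leq (hX s). Qed.

Lemma loweringP X : lowering X -> forall p x, filt p.+1 x -> filt p (X x).
Proof. by move=> hX p; apply: filt_map => s sp; apply: filt_leq (hX s). Qed.

Lemma append_along_filtered X d e t x :
  (forall I, (size I <= size t)%N -> filt (size I).+1 (X (word I))) ->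
  filt (size t).+2 (append_along X d e (word (rcons t x))).
Proof.
move=> hX; rewrite append_along_rcons; apply: filt_ssum => I J sIJ; apply: filtZ.
have sI : (size I <= size t)%N by rewrite -sIJ leq_addr.
by apply: filt_leq (filt_snocl _ (hX I sI)); rewrite ltnS.
Qed.

Lemma fixes_filtered b e X : fixes b e X -> filtered b -> filtered X.
Proof.
move=> hX hb s; have [m] := ubnP (size s); elim: m s => // m IH s /ltnSE sm.
rewrite hX; apply: filtD => //; case/lastP: s sm => [|t x] sm.
  by rewrite word0 linear0; apply: filt0.
rewrite size_rcons; apply: append_along_filtered => I sI; apply: IH.
by apply: leq_ltn_trans sI _; rewrite size_rcons in sm.
Qed.

Lemma inj_filtered (f : {linear TW -> W'}) : filtered (@tcoalg_inj K n W' \o f).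
Proof.
case=> [|x s]; last by apply: filt_leq (filt_inj _).
by rewrite word0 linear0; apply: filt0.
Qed.

Lemma cohom_filtered f : filtered (@cohom K n W W' f).
Proof. exact: fixes_filtered (@cohomP _ _ _ _ f) (inj_filtered f). Qed.

Lemma is_cohom_filtered F : is_cohomomorphism F -> filtered F.
Proof. by move/cohom_fixes/fixes_filtered; apply; apply: inj_filtered. Qed.

(** The leading term is the splitting in which only the last letter goes to the right;
the other ones leave a strictly shorter left part. *)
Lemma append_along_lead X d e t x : filtered X ->
  filt (size t).+1 (append_along X d e (word (rcons t x)) -
    ksgn K d (wdeg t) *: snocl (X (word t)) (e (word [:: x]))).
Proof.
move=> hX; rewrite append_along_rcons -(ssum_nilr (@hdeg K n W)
  (fun I => ksgn K d (wdeg I) *: snocl (X (word I)) (e (word [:: x])))).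
rewrite -scaleN1r -ssumZ -ssumD; apply: filt_ssum => I [|y J] sIJ.
  by rewrite scaleN1r subrr; apply: filt0.
rewrite scaler0 addr0; apply/filtZ/filt_leq/filt_snocl/hX.
by rewrite -sIJ /= addnS ltnS leq_addr.
Qed.

(** If e only sees letters, no other splitting contributes. *)
Lemma append_along_proj X d (g : {linear W -> W'}) t x :
  append_along X d (g \o tcoalg_proj W) (word (rcons t x)) =
  ksgn K d (wdeg t) *: snocl (X (word t)) (g (hval x)).
Proof.
pose e : {linear TW -> W'} := g \o tcoalg_proj W.
have eE J : e (word (rcons J x)) = if J is [::] then g (hval x) else 0.
  transitivity (g (tcoalg_proj W (word (rcons J x)))) => //; rewrite proj_word.
  by case: J => [|y [|z J]] //; apply: (linear0 g).
rewrite -/e append_along_rcons -[RHS](ssum_nilr (@hdeg K n W)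
  (fun I => ksgn K d (wdeg I) *: snocl (X (word I)) (g (hval x)))).
apply: eq_ssum => I [|y J] _ _; rewrite eE //.
by rewrite snocl0r scaler0.
Qed.

Lemma is_cohom_inj F v : is_cohomomorphism F ->
  F (tcoalg_inj v) = tcoalg_inj (tcoalg_proj W' (F (tcoalg_inj v))).
Proof. by case=> _ hF; apply: coprod_eq0; rewrite hF coprod_inj linear0. Qed.

(** Modulo shorter words a cohomomorphism acts letterwise by its linear part. *)
Lemma cohom_lead F p u w : is_cohomomorphism F -> filt p u ->
  filt p (F (snocl u w) - snocl (F u) (tcoalg_proj W' (F (tcoalg_inj w)))).
Proof.
move=> hF up; move: w; apply: hval_eq => [||x].
- pose f : {linear W -> W'} := tcoalg_proj W' \o F \o @tcoalg_inj K n W.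
  exact: (linearP (tail W' p \o ((F \o snocl u) \- (snocl (F u) \o f)))).
- exact: (linearP (\0 : {linear W -> TW'})).
set f := tcoalg_proj W' _.
pose D : {linear TW -> TW'} := (F \o snocr (hval x)) \- (snocr f \o F).
apply: (filt_map (f := D)) up => s sp.
change (filt p (F (snocl (word s) (hval x)) - snocl (F (word s)) f)).
rewrite snocl_word; case: s sp => [|y s] sp.
  by rewrite word0 (linear0 F) snocl0 subrr; apply: filt0.
rewrite [F (word (rcons _ _))](cohom_fixes hF) -addrA.
apply: filtD; first by apply: filt_leq (filt_inj _); apply: leq_trans sp.
have := append_along_lead 0 (tcoalg_proj W' \o F) (y :: s) x (is_cohom_filtered hF).
by rewrite ksgn0l scale1r -tcoalg_injE; apply: filt_leq.
Qed.
End FilteredMaps.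

Section FilteredCoderivations.
Variables (K : fieldType) (n : nat) (W : gradedSpace K n) (d : 'rV[int]_n).
Local Notation TW := (tcoalg W).
Variable Q : {linear TW -> TW}.
Hypothesis hQ : is_coderivation d Q.
Local Notation q := (tcoalg_proj W \o Q).

Lemma is_coder_fixes :
  fixes (@tcoalg_inj K n W \o q \+ append_along (idfun : {linear TW -> TW}) d q)
    (tcoalg_proj W) Q.
Proof. by case: hQ => _ /coder_fixes. Qed.

Lemma is_coder_inj v : Q (tcoalg_inj v) = tcoalg_inj (q (tcoalg_inj v)).
Proof.
by case: hQ => _ cQ; apply: coprod_eq0; rewrite cQ coprod_inj !linear0 addr0.
Qed.

Lemma is_coder_filtered : filtered Q.
Proof.
apply: fixes_filtered is_coder_fixes _ => s.
apply: filtD; first exact: (inj_filtered q).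
case/lastP: s => [|t x]; first by rewrite word0 linear0; apply: filt0.
by rewrite size_rcons; apply: append_along_filtered => I _; apply: filt_word.
Qed.

(** Modulo shorter words a coderivation is the derivation that extends its linear
part. *)
Lemma coder_lead p u w : filt p u ->
  filt p (Q (snocl u w) -
    (snocl (Q u) w + snocl (gr_sign d u) (q (tcoalg_inj w)))).
Proof.
move=> up; move: w; apply: hval_eq => [||x].
- pose f : {linear W -> W} := q \o @tcoalg_inj K n W.
  exact: (linearP (tail W p \o ((Q \o snocl u) \-
    (snocl (Q u) \+ (snocl (gr_sign d u) \o f))))).
- exact: (linearP (\0 : {linear W -> TW})).
set f := q _.
pose D : {linear TW -> TW} := (Q \o snocr (hval x)) \-
  ((snocr (hval x) \o Q) \+ (snocr f \o gr_sign d)).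
apply: (filt_map (f := D)) up => s sp.
change (filt p (Q (snocl (word s) (hval x)) -
  (snocl (Q (word s)) (hval x) + snocl (gr_sign d (word s : TW)) f))).
rewrite snocl_word; case: s sp => [|y s] sp.
  by rewrite word0 (linear0 Q) (linear0 (gr_sign d)) !snocl0 addr0 subrr; apply: filt0.
rewrite [Q (word (rcons _ _))]is_coder_fixes.
rewrite (append_along_proj Q 0 (idfun : {linear W -> W})) ksgn0l scale1r.
rewrite (gr_signE _ (homog_word (y :: s))) [X in _ - (_ + X)](linZ (snocr f)).
rewrite opprD addrA addrK -addrA.
apply: filtD; first by apply: filt_leq (filt_inj _); apply: leq_trans sp.
have hid : filtered (idfun : {linear TW -> TW}) by move=> t; apply: filt_word.
have := append_along_lead d q (y :: s) x hid.
by rewrite -tcoalg_injE; apply: filt_leq.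
Qed.
End FilteredCoderivations.

(** From here on these maps are handled through the equations that characterize
them. *)
Opaque tail cohom coder append_along fixm.

Lemma tcoalg_inj0 (K : fieldType) n (W : gradedSpace K n) :
  tcoalg_inj (0 : W) = 0.
Proof. exact: linear0. Qed.

Lemma tcoalg_injD (K : fieldType) n (W : gradedSpace K n) (v w : W) :
  tcoalg_inj (v + w) = tcoalg_inj v + tcoalg_inj w.
Proof. exact: linearD. Qed.

Lemma tcoalg_injB (K : fieldType) n (W : gradedSpace K n) (v w : W) :
  tcoalg_inj (v - w) = tcoalg_inj v - tcoalg_inj w.
Proof. exact: linearB. Qed.

Lemma snoclDl (K : fieldType) n (W : gradedSpace K n) (u v : tcoalg W) w :
  snocl (u + v) w = snocl u w + snocl v w.
Proof. by have := snocr_linear w 1 u v; rewrite !scale1r. Qed.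

Lemma snoclBl (K : fieldType) n (W : gradedSpace K n) (u v : tcoalg W) w :
  snocl (u - v) w = snocl u w - snocl v w.
Proof. by have := snocr_linear w (-1) v u; rewrite !scaleN1r addrC => <-; rewrite addrC. Qed.

Lemma snoclDr (K : fieldType) n (W : gradedSpace K n) (u : tcoalg W) v w :
  snocl u (v + w) = snocl u v + snocl u w.
Proof. by have := snocl_linear u 1 v w; rewrite !scale1r. Qed.

Lemma snoclBr (K : fieldType) n (W : gradedSpace K n) (u : tcoalg W) v w :
  snocl u (v - w) = snocl u v - snocl u w.
Proof. by have := snocl_linear u (-1) w v; rewrite !scaleN1r addrC => <-; rewrite addrC. Qed.

(** * The homotopy on words *)
Fact regroup_pairs (M : zmodType) (a b c e f g k l : M) :
  ((a + b) + (c + e)) + ((f + g) + (k + l)) =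
  ((a + f) + (b + k)) + ((c + g) + (e + l)).
Proof. by rewrite [LHS](AC ((2*2)*(2*2)) (((1*5)*(2*7))*((3*6)*(4*8)))). Qed.

Fact regroup_homotopy (M : zmodType) (a c x y z : M) :
  a + (c + (y - z)) - (x - z) = a - (x - y) + c.
Proof.
rewrite !opprB [LHS](AC ((1*(1*2))*2) (((1*(3*6))*2)*(5*4))).
by rewrite [X in _ + X = _]subrr addr0.
Qed.

Section BilinearExtensionality.
Variables (K : fieldType) (n : nat) (W : gradedSpace K n) (M : lmodType K).
Local Notation TW := (tcoalg W).

Lemma bilin_eq (f g : TW -> W -> M) : bilin f -> bilin g ->
  (forall t (x : hvec W), t != [::] -> f (word t) (hval x) = g (word t) (hval x)) ->
  forall u w, f u w = g u w.
Proof.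
move=> [fl fr] [gl gr] fg u; apply: hval_eq => // x.
pose f' : {linear TW -> M} :=
  HB.pack (f^~ (hval x)) (GRing.isLinear.Build K TW M _ _ (fl (hval x))).
pose g' : {linear TW -> M} :=
  HB.pack (g^~ (hval x)) (GRing.isLinear.Build K TW M _ _ (gl (hval x))).
rewrite -[LHS]/(f' u) -[RHS]/(g' u); apply: tcoalg_eq_rcons => t y.
by apply: fg; case: t.
Qed.

Lemma snocl_bilin (A : lmodType K) (B : lmodType K) (f : {linear A -> TW})
    (g : {linear B -> W}) : bilin (fun u w => snocl (f u) (g w)).
Proof.
split=> w; first exact: (linearP (snocr (g w) \o f)).
exact: (linearP (snocl (f w) \o g)).
Qed.

Lemma bilin_comp (A B N : lmodType K) (F : {linear M -> N}) (f : A -> B -> M) :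
  bilin f -> bilin (fun u w => F (f u w)).
Proof.
by case=> fl fr; split=> w c u v; rewrite ?(fl w) ?(fr w); apply: (linearP F).
Qed.

Lemma bilinD (A B : lmodType K) (f g : A -> B -> M) :
  bilin f -> bilin g -> bilin (fun u w => f u w + g u w).
Proof.
by move=> [fl fr] [gl gr]; split=> w c u v; rewrite ?(fl w) ?(gl w) ?(fr w)
  ?(gr w) scalerDr addrACA.
Qed.
End BilinearExtensionality.

Section WordInduction.
Variables (K : fieldType) (n : nat) (W W' : gradedSpace K n).
Local Notation TW := (tcoalg W).
Local Notation TW' := (tcoalg W').

Lemma snocl_word_rcons t (x : hvec W) : t != [::] ->
  word (rcons t x) = snocl (word t) (hval x) :> TW.
Proof. by rewrite snocl_word; case: t. Qed.

Lemma lowering_ind (D : {linear TW -> TW'}) :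
  (forall w, filt 1 (D (tcoalg_inj w))) ->
  (forall t x, t != [::] -> filt (size t) (D (word t)) ->
     filt (size t).+1 (D (snocl (word t) (hval x)))) ->
  lowering D.
Proof.
move=> D1 DS s; elim/last_ind: s => [|t x IH].
  by rewrite word0 (linear0 D); apply: filt0.
rewrite size_rcons; case: (eqVneq t [::]) => [->|t0].
  by have := D1 (hval x); rewrite tcoalg_injE.
by rewrite snocl_word_rcons //; apply: DS.
Qed.

(** A cohomomorphism whose corestriction factors through the projection onto W is a
tensor power on each word. *)
Lemma strict_snocl (g : {linear W -> W'}) u w :
  cohom (g \o tcoalg_proj W) (snocl u w) =
  snocl (cohom (g \o tcoalg_proj W) u) (g w).
Proof.
set F := cohom _; move: u w; apply: bilin_eq => [||t x t0].
- apply: bilin_comp.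
  exact: (snocl_bilin (idfun : {linear TW -> TW}) (idfun : {linear W -> W})).
- exact: snocl_bilin.
rewrite -snocl_word_rcons // [LHS]cohomP append_along_proj ksgn0l scale1r.
rewrite [X in X + _](_ : _ = 0) ?add0r //.
transitivity (tcoalg_inj (g (tcoalg_proj W (word (rcons t x))))) => //.
rewrite proj_word -[RHS]tcoalg_inj0 -(linear0 g).
by case: t t0 => [|y [|z t]].
Qed.

Lemma strict_inj (g : {linear W -> W'}) w :
  cohom (g \o tcoalg_proj W) (tcoalg_inj w) = tcoalg_inj (g w).
Proof.
move: w; apply: hval_eq => [||x].
- exact: (linearP (cohom (g \o tcoalg_proj W) \o @tcoalg_inj K n W)).
- exact: (linearP (@tcoalg_inj K n W' \o g)).
rewrite tcoalg_injE [LHS]cohomP (append_along_proj _ _ _ [::]).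
rewrite word0 (linear0 (cohom _)) snocl0 scaler0 addr0.
transitivity (tcoalg_inj (g (tcoalg_proj W (word [:: x])))) => //.
by rewrite proj_word.
Qed.
End WordInduction.

Section WordHomotopy.
Variables (K : fieldType) (n : nat) (W : gradedSpace K n) (d : 'rV[int]_n).
Hypothesis d_odd : ksgn K d d = -1.
Local Notation TW := (tcoalg W).
Variables (Q : {linear TW -> TW}) (h pi : {linear W -> W}).
Hypothesis hQ : is_codifferential d Q.
Hypothesis h_weight : has_weight (- d) h.
Hypothesis pi_weight : has_weight 0 pi.
Let dW : {linear W -> W} := tcoalg_proj W \o Q \o @tcoalg_inj K n W.
Hypothesis hdW : forall w, dW (h w) + h (dW w) = w - pi w.

Let Pi := cohom (pi \o tcoalg_proj W).
Let eps : {linear TW -> TW} := gr_sign d.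

Let epsE t : eps (word t) = ksgn K d (wdeg t) *: word t.
Proof. exact: gr_signE (homog_word t). Qed.

Let Qinj w : Q (tcoalg_inj w) = tcoalg_inj (dW w).
Proof. exact: is_coder_inj hQ.1 w. Qed.

Lemma dW_sqr w : dW (dW w) = 0.
Proof.
apply: (can_inj (@tcoalg_injK _ _ W)).
by rewrite -(Qinj (dW w)) -(Qinj w) (hQ.2) tcoalg_inj0.
Qed.

(** Being homotopic to the identity, pi is a chain map. *)
Lemma pi_dW w : pi (dW w) = dW (pi w).
Proof.
have e1 := hdW (dW w); rewrite dW_sqr (linear0 h) addr0 in e1.
have e2 : dW (dW (h w) + h (dW w)) = dW w - dW (pi w) by rewrite hdW linearB.
rewrite linearD dW_sqr add0r e1 in e2.
by apply: oppr_inj; apply: (addrI (dW w)).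
Qed.

(** On words of length p this is the sum over i of the i-fold tensor power of pi,
followed by h and by identities: the standard homotopy between the tensor powers of
the identity and of pi. *)
Definition word_homotopy : {linear TW -> TW} :=
  fixm ((@tcoalg_inj K n W \o (h \o tcoalg_proj W)) \+
    append_along Pi d (h \o tcoalg_proj W)) (tcoalg_proj W).
Let s := word_homotopy.

Let sP : fixes ((@tcoalg_inj K n W \o (h \o tcoalg_proj W)) \+
    append_along Pi d (h \o tcoalg_proj W)) (tcoalg_proj W) s.
Proof. exact: fixmP. Qed.

Lemma Pi_weight : has_weight 0 Pi.
Proof.
by apply/cohom_weight/(weight_comp pi_weight (@proj_weight K n W)); rewrite addr0.
Qed.

Lemma word_homotopy_weight : has_weight (- d) s.
Proof.
have hp : has_weight (- d) (h \o tcoalg_proj W).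
  by apply: weight_comp h_weight (@proj_weight K n W) _; rewrite add0r.
apply: fixm_weight; last exact: proj_weight.
apply: weightD; last by apply: append_along_weight Pi_weight hp _; rewrite add0r.
by apply: weight_comp (@inj_weight K n W) hp _; rewrite addr0.
Qed.

Lemma word_homotopy_filtered : filtered s.
Proof.
apply: fixes_filtered sP _ => t; apply: filtD; first exact: (inj_filtered (h \o _)).
case/lastP: t => [|t x]; first by rewrite word0 linear0; apply: filt0.
by rewrite size_rcons; apply: append_along_filtered => I _; apply: cohom_filtered.
Qed.

Lemma word_homotopy_inj w : s (tcoalg_inj w) = tcoalg_inj (h w).
Proof.
move: w; apply: hval_eq => [||x].
- exact: (linearP (s \o @tcoalg_inj K n W)).
- exact: (linearP (@tcoalg_inj K n W \o h)).
rewrite tcoalg_injE [LHS]sP (append_along_proj _ _ (idfun : {linear W -> W}) [::]).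
rewrite word0 (linear0 s) snocl0 scaler0 addr0.
transitivity (tcoalg_inj (h (tcoalg_proj W (word [:: x]))) +
  append_along Pi d (h \o tcoalg_proj W) (word (rcons [::] x))) => //.
rewrite append_along_proj word0 (linear0 Pi) snocl0 scaler0 addr0.
by rewrite proj_word.
Qed.

Lemma word_homotopy_snocl u w :
  s (snocl u w) = snocl (s u) w + snocl (Pi (eps u)) (h w).
Proof.
move: u w; apply: bilin_eq => [||t x t0].
- apply: bilin_comp.
  exact: (snocl_bilin (idfun : {linear TW -> TW}) (idfun : {linear W -> W})).
- apply: bilinD; first exact: (snocl_bilin s (idfun : {linear W -> W})).
  exact: (snocl_bilin (Pi \o eps) h).
rewrite -snocl_word_rcons // [LHS]sP (append_along_proj _ _ (idfun : {linear W -> W})).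
rewrite ksgn0l scale1r addrC; congr (_ + _).
transitivity (tcoalg_inj (h (tcoalg_proj W (word (rcons t x)))) +
  append_along Pi d (h \o tcoalg_proj W) (word (rcons t x))) => //.
rewrite append_along_proj proj_word (_ : (if rcons t x is [:: y] then hval y else 0) = 0).
  rewrite (linear0 h) tcoalg_inj0 add0r.
  rewrite epsE (linZ Pi).
  by rewrite [RHS](linZ (snocr (h (hval x)))).
by case: (t) t0 => [|y [|z r]].
Qed.

Let eps2 u : eps (eps u) = u.
Proof.
rewrite -[RHS]/((idfun : {linear TW -> TW}) u) -[LHS]/((eps \o eps) u).
apply: tcoalg_eq => t; change (eps (eps (word t)) = word t).
by rewrite epsE linZ epsE scalerA ksgn_sqr scale1r.
Qed.

Let epsQ u : eps (Q u) = - Q (eps u).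
Proof. by rewrite [LHS](gr_sign_weight d hQ.1.1) d_odd scaleN1r. Qed.

Let epsPi u : eps (Pi u) = Pi (eps u).
Proof. by rewrite [LHS](gr_sign_weight d Pi_weight) ksgn0r scale1r. Qed.

Let epss u : eps (s u) = - s (eps u).
Proof.
by rewrite [LHS](gr_sign_weight d word_homotopy_weight) ksgnC ksgnNl d_odd scaleN1r.
Qed.

Let filt_eps p u : filt p u -> filt p (eps u).
Proof.
apply: filt_map => t tp; rewrite epsE.
exact/filtZ/filt_word.
Qed.

Let tailQ p u w : filt p u -> tail W p (Q (snocl u w)) =
  tail W p (snocl (Q u) w) + tail W p (snocl (eps u) (dW w)).
Proof.
move=> up; apply/eqP; rewrite -subr_eq0 -tailD -tailB; apply/eqP.
exact: coder_lead hQ.1 _ _ _ up.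
Qed.

(** To leading order Q is the derivation extending dW, which commutes with pi. *)
Lemma Pi_Q_lowering : lowering ((Q \o Pi) \- (Pi \o Q)).
Proof.
apply: lowering_ind => [w|t x t0 IH].
  change (filt 1 (Q (Pi (tcoalg_inj w)) - Pi (Q (tcoalg_inj w)))).
  rewrite (strict_inj pi w) (Qinj w) (Qinj (pi w)) (strict_inj pi (dW w)).
  by rewrite pi_dW subrr; apply: filt0.
set p := (size t).+1; set u := word t in IH *; set w := hval x.
change (filt p (Q (Pi (snocl u w)) - Pi (Q (snocl u w)))).
have up : filt p u by apply: filt_word.
have Pip y : filt p y -> filt p (Pi y).
  exact: (filteredP (cohom_filtered (pi \o tcoalg_proj W))).
rewrite /filt tailB strict_snocl tailQ; last exact: Pip.
have -> : tail W p (Pi (Q (snocl u w))) =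
    tail W p (snocl (Pi (Q u)) (pi w)) + tail W p (snocl (Pi (eps u)) (pi (dW w))).
  apply/eqP; rewrite -subr_eq0 -tailD -tailB -!strict_snocl -/Pi -(linearD Pi) -(linearB Pi).
  by apply/eqP/Pip; apply: coder_lead hQ.1 _ _ _ up.
rewrite epsPi pi_dW opprD addrACA subrr addr0 -tailB -snoclBl.
exact: filt_snocl IH.
Qed.

(** Induction on the length: for a word u w the terms with d and h on different letters
cancel because both are odd, those with both on w give u - T(pi) u up to pi w, and
the induction hypothesis accounts for those with both on u. *)
Lemma word_homotopyP : lowering
  ((Q \o s) \+ (s \o Q) \- (idfun \- Pi)).
Proof.
apply: lowering_ind => [w|t x t0 IH].
  change (filt 1 (Q (s (tcoalg_inj w)) + s (Q (tcoalg_inj w)) -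
    (tcoalg_inj w - Pi (tcoalg_inj w)))).
  rewrite (strict_inj pi w) (word_homotopy_inj w) (Qinj w) (Qinj (h w)).
  rewrite (word_homotopy_inj (dW w)) -tcoalg_injD hdW -tcoalg_injB subrr.
  exact: filt0.
set p := (size t).+1; set u := word t in IH *; set w := hval x.
change (filt p (Q (s (snocl u w)) + s (Q (snocl u w)) -
  (snocl u w - Pi (snocl u w)))).
have up : filt p u by apply: filt_word.
have Pip y : filt p y -> filt p (Pi y).
  exact: (filteredP (cohom_filtered (pi \o tcoalg_proj W))).
have sp y : filt p y -> filt p (s y) by apply: (filteredP word_homotopy_filtered).
have Tsnocl v : filt (size t) v -> forall w', tail W p (snocl v w') = 0.
  by move=> hv w'; apply: filt_snocl.
rewrite /filt.
rewrite tailB.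
rewrite tailB.
rewrite tailD.
rewrite (word_homotopy_snocl u w).
rewrite [Pi (snocl u w)](strict_snocl pi u w).
rewrite (linearD Q) tailD (tailQ _ (sp _ up)) (tailQ _ (Pip _ (filt_eps up))).
have -> : tail W p (s (Q (snocl u w))) =
    (tail W p (snocl (s (Q u)) w) + tail W p (snocl (Pi (eps (Q u))) (h w))) +
    (tail W p (snocl (s (eps u)) (dW w)) + tail W p (snocl (Pi u) (h (dW w)))).
  rewrite -[in X in _ + (_ + X)](eps2 u) -!tailD -!word_homotopy_snocl -(linearD s).
  apply/eqP; rewrite -subr_eq0 -tailB -(linearB s).
  by apply/eqP/sp; apply: coder_lead hQ.1 _ _ _ up.
rewrite epss epsPi eps2 epsQ.
rewrite regroup_pairs -!tailD -!tailB -!snoclDl -snoclDr hdW addNr snocl0 addr0.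
rewrite snoclBr regroup_homotopy -(snoclBl u) -snoclBl (linearN Pi) tailD.
rewrite (Tsnocl _ IH) add0r; apply: Tsnocl.
have -> : eps u = ksgn K d (wdeg t) *: u by apply: epsE.
rewrite (linZ Pi) !(linZ Q) (linZ Pi) -scalerBr; apply: filtZ.
by have := Pi_Q_lowering t.
Qed.

End WordHomotopy.

Opaque word_homotopy.

(** * Coderivations along a cohomomorphism and curvature *)
Section TensorMaps.
Variables (K : fieldType) (n : nat).

Lemma gr_signD (V : gradedSpace K n) c d (v : V) :
  gr_sign c (gr_sign d v) = gr_sign (c + d) v.
Proof.
move: v; apply: hval_eq => [||x].
- exact: (linearP (gr_sign c \o gr_sign d)).
- exact: linearP.
have E b : gr_sign b (hval x) = ksgn K b (hdeg x) *: hval x.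
  exact: gr_signE (valP x).
have Z a : gr_sign c (a *: hval x) = a *: gr_sign c (hval x).
  exact: (linZ (gr_sign c)).
by rewrite E Z !E scalerA ksgnDl mulrC.
Qed.

Lemma tensor_map_tens (A A' : gradedSpace K n) (B B' : lmodType K)
    (f : {linear A -> A'}) d (g : {linear B -> B'}) u v :
  tensor_map f d g (u *t v) = f (gr_sign d u) *t g v.
Proof. exact: tensor_liftE. Qed.

Lemma tensor_map_comp (A A' A'' : gradedSpace K n) (B B' B'' : lmodType K)
    (f : {linear A' -> A''}) d (g : {linear B' -> B''})
    (f' : {linear A -> A'}) c d' (g' : {linear B -> B'}) z :
  has_weight c f' ->
  tensor_map f d g (tensor_map f' d' g' z) =
  ksgn K d c *: tensor_map (f \o f') (d + d') (g \o g') z.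
Proof.
move=> f'c.
rewrite -[LHS]/((tensor_map f d g \o tensor_map f' d' g') z).
rewrite -[RHS]/((ksgn K d c \*: tensor_map (f \o f') (d + d') (g \o g')) z).
apply: tensor_eq => u v.
change (tensor_map f d g (tensor_map f' d' g' (u *t v)) =
  ksgn K d c *: tensor_map (f \o f') (d + d') (g \o g') (u *t v)).
rewrite !tensor_map_tens (gr_sign_weight d f'c) gr_signD linZ.
by rewrite tensZl.
Qed.

Lemma eq_tensor_map (A A' : gradedSpace K n) (B B' : lmodType K)
    (f f' : {linear A -> A'}) d (g g' : {linear B -> B'}) z :
  f =1 f' -> g =1 g' -> tensor_map f d g z = tensor_map f' d g' z.
Proof.
by move=> ff gg; apply: tensor_eq => u v; rewrite !tensor_map_tens ff gg.
Qed.

Lemma tensor_mapBl (A A' : gradedSpace K n) (B B' : lmodType K)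
    (f f' : {linear A -> A'}) d (g : {linear B -> B'}) z :
  tensor_map (f \- f') d g z = tensor_map f d g z - tensor_map f' d g z.
Proof.
rewrite -[RHS]/((tensor_map f d g \- tensor_map f' d g) z).
apply: tensor_eq => u v.
change (tensor_map (f \- f') d g (u *t v) =
  tensor_map f d g (u *t v) - tensor_map f' d g (u *t v)).
rewrite !tensor_map_tens -scaleN1r addrC -tensDl scaleN1r addrC.
by [].
Qed.

Lemma tensor_mapBr (A A' : gradedSpace K n) (B B' : lmodType K)
    (f : {linear A -> A'}) d (g g' : {linear B -> B'}) z :
  tensor_map f d (g \- g') z = tensor_map f d g z - tensor_map f d g' z.
Proof.
rewrite -[RHS]/((tensor_map f d g \- tensor_map f d g') z).
apply: tensor_eq => u v.
change (tensor_map f d (g \- g') (u *t v) =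
  tensor_map f d g (u *t v) - tensor_map f d g' (u *t v)).
rewrite !tensor_map_tens -scaleN1r addrC -tensDr scaleN1r addrC.
by [].
Qed.
End TensorMaps.

Section Uniqueness.
Variables (K : fieldType) (n : nat).

Lemma cohom_comp (U V W : gradedSpace K n) (F : {linear tcoalg V -> tcoalg W})
    (G : {linear tcoalg U -> tcoalg V}) :
  is_cohomomorphism F -> is_cohomomorphism G -> is_cohomomorphism (F \o G).
Proof.
move=> [F0 hF] [G0 hG]; split.
  by apply: weight_comp F0 G0 _; rewrite addr0.
move=> x; rewrite [LHS]hF hG (tensor_map_comp _ _ _ _ _ _ G0).
by rewrite ksgn0l scale1r addr0.
Qed.

Variables (W W' : gradedSpace K n).
Local Notation TW := (tcoalg W).
Local Notation TW' := (tcoalg W').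

Lemma id_cohom : is_cohomomorphism (idfun : {linear TW -> TW}).
Proof.
split=> [a v|x]; first by rewrite addr0.
rewrite -[LHS]/((idfun : {linear _ -> _}) (coprod W x)); apply: tensor_eq => u v.
by rewrite tensor_map_tens gr_sign0.
Qed.

Lemma cohom_eq (F G : {linear TW -> TW'}) k :
  is_cohomomorphism F -> is_cohomomorphism G ->
  (forall s, (size s <= k)%N ->
     tcoalg_proj W' (F (word s)) = tcoalg_proj W' (G (word s))) ->
  forall s, (size s <= k)%N -> F (word s) = G (word s).
Proof.
move=> hF hG FG; apply: fix_local (cohom_fixes hF) (cohom_fixes hG) _ (FG) => s sk.
by congr tcoalg_inj; apply: FG.
Qed.

Lemma cohom_ext (F G : {linear TW -> TW'}) :
  is_cohomomorphism F -> is_cohomomorphism G ->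
  (forall x, tcoalg_proj W' (F x) = tcoalg_proj W' (G x)) -> F =1 G.
Proof.
move=> hF hG FG; apply: tcoalg_eq => s.
by apply: (cohom_eq (k := size s) hF hG).
Qed.

Lemma proj_snocl u w : tcoalg_proj W (snocl u w) = 0.
Proof.
move: u w; apply: (bilin_eq (g := fun _ _ => 0)) => [||t x t0].
- apply: bilin_comp.
  exact: (snocl_bilin (idfun : {linear TW -> TW}) (idfun : {linear W -> W})).
- by split=> w a u v; rewrite scaler0 addr0.
rewrite -snocl_word_rcons // proj_word.
by case: t t0 => [|y [|z t]].
Qed.
End Uniqueness.

Lemma proj_append_along (K : fieldType) n (W W' : gradedSpace K n)
    (X : {linear tcoalg W -> tcoalg W'}) d (e : {linear tcoalg W -> W'}) x :
  tcoalg_proj W' (append_along X d e x) = 0.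
Proof.
pose f : {linear tcoalg W -> W'} := tcoalg_proj W' \o append_along X d e.
rewrite -[LHS]/(f x) -[RHS]/((\0 : {linear tcoalg W -> W'}) x).
apply: tcoalg_eq_rcons => t y.
change (tcoalg_proj W' (append_along X d e (word (rcons t y))) = 0).
rewrite append_along_rcons linear_ssum -[RHS](ssum0 (@hdeg K n W) _ t).
by apply: eq_ssum => I J _ _; rewrite linZ proj_snocl scaler0.
Qed.

Lemma proj_cohom (K : fieldType) n (W W' : gradedSpace K n)
    (f : {linear tcoalg W -> W'}) x : tcoalg_proj W' (cohom f x) = f x.
Proof.
by rewrite cohomP linearD proj_append_along addr0; apply: tcoalg_injK.
Qed.

Lemma proj_coder (K : fieldType) n (W : gradedSpace K n) d
    (e : {linear tcoalg W -> W}) x : tcoalg_proj W (coder d e x) = e x.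
Proof.
rewrite coderP linearD proj_append_along addr0.
transitivity (tcoalg_proj W (tcoalg_inj (e x) + append_along idfun d e x)) => //.
by rewrite linearD proj_append_along addr0 tcoalg_injK.
Qed.

Section AppendAlongZero.
Variables (K : fieldType) (n : nat) (W W' : gradedSpace K n) (d : 'rV[int]_n).
Local Notation TW := (tcoalg W).
Local Notation TW' := (tcoalg W').

Lemma append_along0 (X : {linear TW -> TW'}) (e : {linear TW -> W'}) s :
  (forall I J, (size I < size s)%N -> (size J <= size s)%N ->
     I = [::] \/ (size J < size s)%N -> snocl (X (word I)) (e (word J)) = 0) ->
  append_along X d e (word s) = 0.
Proof.
case/lastP: s => [|t x] h0; first by rewrite word0 linear0.
rewrite append_along_rcons -[RHS](ssum0 (@hdeg K n W) _ t); apply: eq_ssum => I J _ sIJ.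
rewrite h0 ?scaler0 // ?size_rcons ?ltnS -sIJ ?leq_addr ?leq_addl //.
by case: I {sIJ} => [|y I]; [left|right; rewrite addSn ltnS leq_addl].
Qed.
End AppendAlongZero.

(** E is a coderivation along R. *)
Section CoderivationsAlong.
Variables (K : fieldType) (n : nat) (d : 'rV[int]_n) (W W' : gradedSpace K n).
Local Notation TW := (tcoalg W).
Local Notation TW' := (tcoalg W').
Variables R E : {linear TW -> TW'}.
Hypothesis hE : fixes
  (@tcoalg_inj K n W' \o (tcoalg_proj W' \o E) \+
   append_along R d (tcoalg_proj W' \o E))
  (tcoalg_proj W' \o R) E.

(** The recursion for E expresses it by its corestriction on words that are not
longer. *)
Lemma coder_flat k :
  (forall s, (size s <= k)%N -> tcoalg_proj W' (E (word s)) = 0) ->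
  forall s, (size s <= k)%N -> E (word s) = 0.
Proof.
move=> e0; set f : {linear TW -> W'} := tcoalg_proj W' \o R.
have z0 : fixes (\0 : {linear TW -> TW'}) f (\0 : {linear TW -> TW'}).
  move=> x; pose z : {linear TW -> TW'} := append_along \0 0 f.
  rewrite add0r -[RHS]/(z x); pose o : {linear TW -> TW'} := \0.
  rewrite -[LHS]/(o x); apply: tcoalg_eq => s.
  by rewrite [RHS]append_along0 // => I J _ _ _; rewrite snocl0.
apply: (fix_local hE z0) => // t tk.
pose e : {linear TW -> W'} := tcoalg_proj W' \o E.
transitivity (tcoalg_inj (e (word t)) + append_along R d e (word t)) => //.
rewrite [e _]e0 // tcoalg_inj0 add0r append_along0 // => I J _ Jt _.
by rewrite [e _]e0 ?snocl0r // (leq_trans Jt).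
Qed.

(** If e vanishes up to length k, in length k+1 every splitting has a part on which
e or E vanishes already: only the corestriction survives. *)
Lemma coder_next k :
  (forall s, (size s <= k)%N -> tcoalg_proj W' (E (word s)) = 0) ->
  forall s, (size s <= k.+1)%N ->
  E (word s) = tcoalg_inj (tcoalg_proj W' (E (word s))).
Proof.
move=> e0 s sk; have E0 := coder_flat e0.
set e := tcoalg_proj W' _.
rewrite [LHS]hE append_along0 => [|I J Is Js _]; last first.
  by rewrite E0 ?snocl0 // -ltnS (leq_trans Is).
pose e' : {linear TW -> W'} := tcoalg_proj W' \o E.
transitivity (tcoalg_inj (e' (word s)) + append_along R d e' (word s) + 0) => //.
rewrite append_along0 ?addr0 // => I J Is Js [->|Jls].
  by rewrite word0 (linear0 R) snocl0.
by rewrite [e' _]e0 ?snocl0r // -ltnS (leq_trans Jls).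
Qed.
End CoderivationsAlong.

(** The square of an odd coderivation is again a coderivation: the mixed terms cancel
by the sign rule. *)
Lemma coder_sqr (K : fieldType) n (d : 'rV[int]_n) (W : gradedSpace K n)
    (Q : {linear tcoalg W -> tcoalg W}) :
  ksgn K d d = -1 -> is_coderivation d Q ->
  (forall x, tcoalg_proj W (Q (Q x)) = 0) -> forall x, Q (Q x) = 0.
Proof.
move=> dd [Qd cQ] QQ0.
pose id_T : {linear tcoalg W -> tcoalg W} := idfun.
have hE x : coprod W ((Q \o Q) x) = tensor_map (Q \o Q) 0 id_T (coprod W x) +
    tensor_map id_T (d + d) (Q \o Q) (coprod W x).
  have id0 : has_weight 0 id_T by move=> a v; rewrite addr0.
  set z := coprod W x.
  have c1 : tensor_map Q 0 id_T (tensor_map Q 0 id_T z) = tensor_map (Q \o Q) 0 id_T z.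
    rewrite (tensor_map_comp _ _ _ _ _ _ Qd) ksgn0l scale1r addr0.
    exact: eq_tensor_map.
  have c2 : tensor_map Q 0 id_T (tensor_map id_T d Q z) = tensor_map Q d Q z.
    rewrite (tensor_map_comp _ _ _ _ _ _ id0) ksgn0l scale1r add0r.
    exact: eq_tensor_map.
  have c3 : tensor_map id_T d Q (tensor_map Q 0 id_T z) = - tensor_map Q d Q z.
    have <- : tensor_map (id_T \o Q) d (Q \o id_T) z = tensor_map Q d Q z.
      exact: eq_tensor_map.
    by rewrite (tensor_map_comp _ _ _ _ _ _ Qd) dd scaleN1r addr0.
  have c4 : tensor_map id_T d Q (tensor_map id_T d Q z) =
      tensor_map id_T (d + d) (Q \o Q) z.
    rewrite (tensor_map_comp _ _ _ _ _ _ id0) ksgn0r scale1r.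
    exact: eq_tensor_map.
  transitivity (coprod W (Q (Q x))) => //.
  rewrite !cQ -/z (linearD (tensor_map Q 0 id_T)) (linearD (tensor_map id_T d Q)).
  by rewrite c1 c2 c3 c4 -addrA addrA; rewrite addrA addrK.
move=> x; rewrite -[LHS]/((Q \o Q : {linear tcoalg W -> tcoalg W}) x).
rewrite -[RHS]/((\0 : {linear tcoalg W -> tcoalg W}) x); apply: tcoalg_eq => s.
by apply: (coder_flat (coder_fixes hE) (k := size s)) => // t _; apply: QQ0.
Qed.

Section Curvature.
Variables (K : fieldType) (n : nat) (d : 'rV[int]_n) (W W' : gradedSpace K n).
Local Notation TW := (tcoalg W).
Local Notation TW' := (tcoalg W').
Variables (Q : {linear TW -> TW}) (Q' : {linear TW' -> TW'}).
Hypotheses (hQ : is_coderivation d Q) (hQ' : is_coderivation d Q').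
Variable R : {linear TW -> TW'}.
Hypothesis hR : is_cohomomorphism R.

(** The defect of a cohomomorphism to commute with the codifferentials; it is a
coderivation along that cohomomorphism. *)
Definition curvature (R : {linear TW -> TW'}) : {linear TW -> TW'} :=
  (Q' \o R) \- (R \o Q).

Lemma curvature_fixes : fixes
  (@tcoalg_inj K n W' \o (tcoalg_proj W' \o curvature R) \+
   append_along R d (tcoalg_proj W' \o curvature R))
  (tcoalg_proj W' \o R) (curvature R).
Proof.
apply: coder_fixes => x; case: hQ hQ' hR => Qd cQ [Qd' cQ'] [R0 cR].
have id0 (V : gradedSpace K n) : has_weight 0 (idfun : {linear V -> V}).
  by move=> a v; rewrite addr0.
transitivity (coprod W' (Q' (R x)) - coprod W' (R (Q x))); first exact: linearB.
set z := coprod W x.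
have c1 : tensor_map Q' 0 (idfun : {linear TW' -> TW'}) (tensor_map R 0 R z) =
    tensor_map (Q' \o R) 0 R z.
  rewrite (tensor_map_comp _ _ _ _ _ _ R0) ksgn0l scale1r addr0.
  exact: eq_tensor_map.
have c2 : tensor_map (idfun : {linear TW' -> TW'}) d Q' (tensor_map R 0 R z) =
    tensor_map R d (Q' \o R) z.
  rewrite (tensor_map_comp _ _ _ _ _ _ R0) ksgn0r scale1r addr0.
  exact: eq_tensor_map.
have c3 : tensor_map R 0 R (tensor_map Q 0 (idfun : {linear TW -> TW}) z) =
    tensor_map (R \o Q) 0 R z.
  rewrite (tensor_map_comp _ _ _ _ _ _ Qd) ksgn0l scale1r addr0.
  exact: eq_tensor_map.
have c4 : tensor_map R 0 R (tensor_map (idfun : {linear TW -> TW}) d Q z) =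
    tensor_map R d (R \o Q) z.
  rewrite (tensor_map_comp _ _ _ _ _ _ (id0 _)) ksgn0l scale1r add0r.
  exact: eq_tensor_map.
rewrite cQ' !cR cQ -/z (linearD (tensor_map R 0 R)) c1 c2 c3 c4.
rewrite opprD addrACA; congr (_ + _).
  exact/esym/(tensor_mapBl (Q' \o R) (R \o Q)).
exact/esym/(tensor_mapBr R d (Q' \o R) (R \o Q)).
Qed.

Definition curvature_flat := coder_flat curvature_fixes.
Definition curvature_next := coder_next curvature_fixes.

Lemma curvature_eq0 :
  (forall x, tcoalg_proj W' (Q' (R x)) = tcoalg_proj W' (R (Q x))) ->
  forall x, Q' (R x) = R (Q x).
Proof.
move=> QR x; apply/eqP; rewrite -subr_eq0; apply/eqP.
rewrite -[LHS]/(curvature R x).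
rewrite -[RHS]/((\0 : {linear TW -> TW'}) x); apply: tcoalg_eq => s.
apply: (curvature_flat (k := size s)) => // t _.
transitivity (tcoalg_proj W' (Q' (R (word t)) - R (Q (word t)))) => //.
by rewrite (linearB (tcoalg_proj W')) QR subrr.
Qed.
End Curvature.

Opaque curvature.

(** * The retraction of a split injective quasi-isomorphism *)
Fact regroup_correction (M : zmodType) (x a b c e k y : M) :
  x - (a - b) - (c - e) - k = - (a + c - (x - y)) + (b + e) + (y - k).
Proof.
rewrite !opprB opprD.
rewrite [LHS](AC (((1*2)*2)*1) ((((1*3)*5)*(2*4))*6)).
rewrite [RHS](AC (((2*2)*2)*2) ((((1*3)*4)*(5*6))*8*(2*7))).
by rewrite [X in _ = _ + X]addNr addr0.
Qed.

Section Retraction.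
Variables (K : fieldType) (n : nat) (d : 'rV[int]_n).
Hypothesis d_odd : ksgn K d d = -1.
Variables (W W' : gradedSpace K n).
Local Notation TW := (tcoalg W).
Local Notation TW' := (tcoalg W').
Local Notation pr := (tcoalg_proj W).
Local Notation pr' := (tcoalg_proj W').
Variables (Q : {linear TW -> TW}) (Q' : {linear TW' -> TW'}).
Hypotheses (hQ : is_codifferential d Q) (hQ' : is_codifferential d Q').
Variable F : {linear TW -> TW'}.
Hypotheses (hF : is_cohomomorphism F) (FQ : forall x, Q' (F x) = F (Q x)).
Let f1 : {linear W -> W'} := pr' \o F \o @tcoalg_inj K n W.
Let d1 : {linear W -> W} := pr \o Q \o @tcoalg_inj K n W.
Let d1' : {linear W' -> W'} := pr' \o Q' \o @tcoalg_inj K n W'.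

Variables (l rho : {linear W' -> W}) (h : {linear W' -> W'}).
Hypotheses (l_weight : has_weight 0 l) (rho_weight : has_weight 0 rho).
Hypothesis h_weight : has_weight (- d) h.
Hypothesis lF : forall x, l (pr' (F x)) = pr x.
Hypothesis hf1 : forall w, h (f1 w) = 0.
Hypothesis h_homotopy : forall w, d1' (h w) + h (d1' w) = w - f1 (rho w).

Let pi : {linear W' -> W'} := f1 \o rho.
Let T (g : {linear W' -> W}) : {linear TW' -> TW} := cohom (g \o pr').
Let Pi : {linear TW' -> TW'} := cohom (pi \o pr').
Let s := word_homotopy d h pi.

Let f1_weight : has_weight 0 f1.
Proof.
apply: (weight_comp (c := 0) (d := 0)) (@inj_weight K n W) _; last by rewrite addr0.
by apply: weight_comp (@proj_weight K n W') hF.1 _; rewrite addr0.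
Qed.

Let pi_weight : has_weight 0 pi.
Proof. by apply: weight_comp f1_weight rho_weight _; rewrite addr0. Qed.

Let s_weight : has_weight (- d) s. Proof. exact: word_homotopy_weight. Qed.
Let s_filtered : filtered s. Proof. exact: word_homotopy_filtered. Qed.
Let F_filtered : filtered F. Proof. exact: is_cohom_filtered. Qed.
Let Q_filtered' : filtered Q'. Proof. exact: is_coder_filtered hQ'.1. Qed.
Let T_filtered g : filtered (T g). Proof. exact: cohom_filtered. Qed.

Let sP p x : filt p.+1 x -> filt p (Q' (s x) + s (Q' x) - (x - Pi x)).
Proof.
exact: (loweringP (word_homotopyP d_odd hQ' h_weight pi_weight h_homotopy)).
Qed.

Let F_inj v : F (tcoalg_inj v) = tcoalg_inj (f1 v).
Proof. exact: is_cohom_inj hF. Qed.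

(** To leading order F is a tensor power of f1, and h f1 = 0. *)
Lemma homotopy_F_lowering : lowering (s \o F).
Proof.
apply: lowering_ind => [w|t x t0 IH].
  change (filt 1 (s (F (tcoalg_inj w)))).
  by rewrite F_inj word_homotopy_inj hf1 tcoalg_inj0; apply: filt0.
set p := (size t).+1; set u := word t in IH *; set w := hval x.
change (filt p (s (F (snocl u w)))).
have up : filt p u by apply: filt_word.
have hr : filt p (F (snocl u w) - snocl (F u) (f1 w)) by apply: cohom_lead.
have := filteredP s_filtered hr; rewrite (linearB s) word_homotopy_snocl hf1.
rewrite snocl0r addr0 => hs; rewrite -[s _](subrK (snocl (s (F u)) (f1 w))).
by apply: filtD => //; apply: filt_snocl.
Qed.

(** T(pi) and F T(rho) both have leading term T(f1 rho).  The second one has the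
advantage that the curvature vanishes on the image of F exactly. *)
Lemma retract_projection_lowering : lowering (Pi \- (F \o T rho)).
Proof.
apply: lowering_ind => [w|t x t0 IH].
  change (filt 1 (Pi (tcoalg_inj w) - F (T rho (tcoalg_inj w)))).
  by rewrite /Pi /T !strict_inj F_inj subrr; apply: filt0.
set p := (size t).+1; set u := word t in IH *; set w := hval x.
change (filt p (Pi (snocl u w) - F (T rho (snocl u w)))).
have up : filt p (T rho u) by apply/(filteredP (T_filtered rho))/filt_word.
rewrite /Pi /T !strict_snocl -/Pi -/(T rho).
have hr := cohom_lead (rho w) hF up; rewrite -[_ - _]opprB; apply: filtN.
rewrite -[F _](subrK (snocl (F (T rho u)) (f1 (rho w)))) -addrA; apply: filtD => //.
by rewrite -snoclBl -opprB; apply: filt_snocl; apply: filtN; exact: IH.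
Qed.

(** As T(l) F = id, the map F T(l) is a projector onto the image of F; precomposing s
with the complementary projector makes it vanish on that image without changing
its leading term. *)
Definition rel_homotopy : {linear TW' -> TW'} := s \o (idfun \- (F \o T l)).
Let s' := rel_homotopy.

Let s'E x : s' x = s x - s (F (T l x)).
Proof. exact: (linearB s). Qed.

Let TlF x : T l (F x) = x.
Proof.
have lw : has_weight 0 (l \o pr').
  by apply: weight_comp l_weight (@proj_weight K n W') _; rewrite addr0.
apply: (cohom_ext (cohom_comp (cohom_is_cohom lw) hF) (id_cohom W)) => y.
by rewrite [LHS]proj_cohom; exact: lF.
Qed.

Lemma rel_homotopy_F x : s' (F x) = 0.
Proof. by rewrite s'E TlF subrr. Qed.

Lemma rel_homotopy_weight : has_weight (- d) s'.
Proof.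
move=> a v av; rewrite s'E; apply: homogB; apply: s_weight => //.
rewrite -[a]addr0 -[a]addr0; apply: hF.1; apply: cohom_weight => //.
by apply: weight_comp l_weight (@proj_weight K n W') _; rewrite addr0.
Qed.

Let s's_lowering p x : filt p.+1 x -> filt p (s (F (T l x))).
Proof.
move=> xp; apply: (loweringP homotopy_F_lowering).
exact: (filteredP (T_filtered l)).
Qed.

Lemma rel_homotopy_filt p x : filt p x -> filt p (s' x).
Proof.
move=> xp; rewrite s'E; apply: filtB; first exact: filteredP xp.
by apply/(filteredP s_filtered)/(filteredP F_filtered)/(filteredP (T_filtered l)).
Qed.

Lemma rel_homotopyP p x : filt p.+1 x ->
  filt p (x - Q' (s' x) - s' (Q' x) - F (T rho x)).
Proof.
move=> xp; have xQ : filt p.+1 (Q' x) by apply: filteredP xp.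
rewrite !s'E (linearB Q').
rewrite (regroup_correction _ _ _ _ _ _ (Pi x)); apply: filtD; last first.
  exact: (loweringP retract_projection_lowering xp).
apply: filtD; first exact/filtN/sP.
by apply: filtD; [apply: filteredP (s's_lowering xp)|apply: s's_lowering].
Qed.

Section Step.
Variables (k : nat) (r : {linear TW' -> W}).
Let R := cohom r.
Let e : {linear TW' -> W} := pr \o curvature Q' Q R.

Hypothesis r_weight : has_weight 0 r.
Hypothesis rF : forall x, r (F x) = pr x.
Hypothesis e0 : forall t, (size t <= k)%N -> e (word t) = 0.

Definition corrected : {linear TW' -> W} := r \+ (e \o s').
Let R1 := cohom corrected.

Let hR : is_cohomomorphism R. Proof. exact: cohom_is_cohom. Qed.

Let e_filt x : filt k.+1 x -> e x = 0.
Proof. by apply: (filt_eq (g := \0)) => t; apply: e0. Qed.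

Lemma cohom_retract x : R (F x) = x.
Proof.
apply: (cohom_ext (cohom_comp hR hF) (id_cohom W)) => y.
by rewrite [LHS]proj_cohom; apply: rF.
Qed.

Let curvE x : curvature Q' Q R x = Q (R x) - R (Q' x).
Proof. by []. Qed.

Let eE x : e x = pr (Q (R x)) - r (Q' x).
Proof.
transitivity (pr (Q (R x) - R (Q' x))) => //.
by rewrite (linearB pr) proj_cohom.
Qed.

(** As R F = id, and F commutes with the codifferentials. *)
Lemma curvature_on_image x : e (F x) = 0.
Proof. by rewrite eE cohom_retract FQ rF subrr. Qed.

Lemma corrected_weight : has_weight 0 corrected.
Proof.
apply: weightD => //; apply: weight_comp rel_homotopy_weight (addNr d).
apply: (weight_comp (c := 0) (d := d)) (@proj_weight K n W) _ (addr0 d).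
have R0 := hR.1; move=> a v av; rewrite curvE; apply: homogB.
  by apply: hQ.1.1; rewrite -[a]addr0; apply: R0.
by rewrite -[a + d]addr0; apply: R0; apply: hQ'.1.1.
Qed.

Lemma correctedF x : corrected (F x) = pr x.
Proof.
transitivity (r (F x) + e (s' (F x))) => //.
by rewrite rF rel_homotopy_F (linear0 e) addr0.
Qed.

Lemma corrected_eq t : (size t <= k)%N -> corrected (word t) = r (word t).
Proof.
move=> tk; transitivity (r (word t) + e (s' (word t))) => //.
by rewrite e_filt ?addr0 //; apply/rel_homotopy_filt/filt_word.
Qed.

Let cR1 : is_cohomomorphism R1.
Proof. exact/cohom_is_cohom/corrected_weight. Qed.

(** A change of the corestriction on words of length k+1 is felt as such on these words,
and otherwise on longer ones only. *)
Lemma cohom_corrected x : filt k.+2 x ->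
  R1 x = R x + tcoalg_inj (e (s' x)).
Proof.
pose f : {linear TW' -> TW} := R \+ (@tcoalg_inj K n W \o (e \o s')).
apply: (filt_eq (f := R1) (g := f)) => t tk.
have R1E t' : (size t' <= k)%N -> R1 (word t') = R (word t').
  apply: (cohom_eq cR1 hR) => t'' tk'.
  by rewrite !proj_cohom corrected_eq.
transitivity (R (word t) + tcoalg_inj (e (s' (word t)))) => //.
rewrite [LHS]cohomP [R _]cohomP.
rewrite (@eq_append_along _ _ _ _ R1 R 0 corrected r) => [|I It|J Jt]; last first.
- by apply: corrected_eq; rewrite -ltnS (leq_trans Jt).
- by apply: R1E; rewrite -ltnS (leq_trans It).
rewrite addrAC; congr (_ + _).
transitivity (tcoalg_inj (r (word t) + e (s' (word t)))) => //.
by rewrite tcoalg_injD.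
Qed.

(** The identity QE + EQ' = 0 holds for E = QR - RQ'; here it is read on words of length
k+1, where E takes values in W. *)
Lemma curvature_cocycle x : filt k.+2 x -> d1 (e x) = - e (Q' x).
Proof.
pose f : {linear TW' -> W} := d1 \o e; pose g : {linear TW' -> W} := \- (e \o Q').
apply: (filt_eq (f := f) (g := g)) => t tk.
transitivity (d1 (e (word t))) => //; transitivity (- e (Q' (word t))) => //.
apply/eqP; rewrite -subr_eq0 opprK; apply/eqP.
transitivity (pr (Q (curvature Q' Q R (word t)) + curvature Q' Q R (Q' (word t)))).
  by rewrite (linearD pr) [in RHS](curvature_next hQ'.1 hQ.1 hR e0).
rewrite !curvE (hQ'.2) (linear0 R) subr0 (linearB Q) (hQ.2) sub0r addNr.
exact: linear0.
Qed.

(** The new curvature is e applied to x - Q's'x - s'Q'x, which is F T(rho) x modulo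
shorter words; e vanishes on both. *)
Lemma corrected_flat t : (size t <= k.+1)%N ->
  pr (curvature Q' Q R1 (word t)) = 0.
Proof.
move=> tk; set x := word t; have xk : filt k.+2 x by apply: filt_word.
transitivity (pr (Q (R1 x)) - corrected (Q' x)).
  transitivity (pr (Q (R1 x) - R1 (Q' x))) => //.
  by rewrite (linearB pr) proj_cohom.
rewrite cohom_corrected // (linearD Q) (linearD pr).
transitivity (pr (Q (R x)) + d1 (e (s' x)) - (r (Q' x) + e (s' (Q' x)))) => //.
rewrite opprD addrACA -eE curvature_cocycle; last exact: rel_homotopy_filt.
have := e_filt (rel_homotopyP xk).
by rewrite !(linearB e) curvature_on_image subr0 -addrA.
Qed.
End Step.

Fixpoint approx k : {linear TW' -> W} :=
  if k is k'.+1 then corrected (approx k') else l \o pr'.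

Lemma approxP k : [/\ has_weight 0 (approx k), forall x, approx k (F x) = pr x &
  forall t, (size t <= k)%N -> pr (curvature Q' Q (cohom (approx k)) (word t)) = 0].
Proof.
elim: k => [|k [wk Fk ek]] /=.
  split=> [|//|[|//] _].
    by apply: weight_comp l_weight (@proj_weight K n W') _; rewrite addr0.
  by rewrite word0 !linear0.
by split; [apply: corrected_weight|apply: correctedF|apply: corrected_flat].
Qed.

(** The corrections from step k on do not affect words of length at most k: the
sequence of corestrictions is stationary on every word. *)
Lemma approx_stable k t : (size t <= k)%N ->
  approx k (word t) = approx (size t) (word t).
Proof.
elim: k => [|k IH]; first by case: t.
rewrite leq_eqVlt => /orP[/eqP->//|tk]; rewrite -IH //.
have [_ _ ek] := approxP k.
by apply: corrected_eq; [exact: ek|exact: tk].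
Qed.

Fact retraction_wordlin : wordlin (fun t => approx (size t) (word t)).
Proof.
split=> [|t u a x y z xyz]; first by rewrite word0 linear0.
by rewrite !size_cat /= (word_lin t u xyz) linearP.
Qed.

Definition retraction_corestriction : {linear TW' -> W} := tlift retraction_wordlin.
Local Notation r := retraction_corestriction.
Definition retraction : {linear TW' -> TW} := cohom r.

Lemma retraction_approx k x : filt k.+1 x -> r x = approx k x.
Proof.
apply: filt_eq => t tk; rewrite tliftE.
by rewrite [RHS]approx_stable.
Qed.

Lemma retraction_cohom : is_cohomomorphism retraction.
Proof.
apply: cohom_is_cohom; apply: word_weight => t x; rewrite tliftE.
by have [wk _ _] := approxP (size (rcons t x)); apply: wk; apply: homog_word.
Qed.

Lemma retractionF x : retraction (F x) = x.
Proof.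
apply: (cohom_ext (cohom_comp retraction_cohom hF) (id_cohom W)) => y.
rewrite [LHS]proj_cohom.
pose f : {linear TW -> W} := r \o F; rewrite -[LHS]/(f y); apply: tcoalg_eq => t.
transitivity (r (F (word t))) => //; rewrite (retraction_approx (F_filtered t)).
by have [_ Fk _] := approxP (size t).
Qed.

Lemma retractionQ x : Q (retraction x) = retraction (Q' x).
Proof.
apply/eqP; rewrite -subr_eq0; apply/eqP.
rewrite -[LHS]/(curvature Q' Q retraction x).
rewrite -[RHS]/((\0 : {linear TW' -> TW}) x); apply: tcoalg_eq => t.
pose k := size t; have [wk Fk ek] := approxP k.
have Rk : is_cohomomorphism (cohom (approx k)) by apply: cohom_is_cohom.
have RE y : filt k.+1 y -> retraction y = cohom (approx k) y.
  apply: filt_eq; apply: (cohom_eq retraction_cohom Rk) => u uk.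
  by rewrite !proj_cohom; apply/retraction_approx/filt_word.
transitivity (curvature Q' Q (cohom (approx k)) (word t)).
  transitivity (Q (retraction (word t)) - retraction (Q' (word t))) => //.
  by rewrite !RE //; [apply: Q_filtered'|apply: filt_word].
exact: (curvature_flat hQ'.1 hQ.1 Rk ek).
Qed.

Theorem cohomomorphism_retraction : exists R : {linear TW' -> TW},
  [/\ is_cohomomorphism R, forall x, R (F x) = x &
      forall x, Q (R x) = R (Q' x)].
Proof.
by exists retraction; split;
  [exact: retraction_cohom|exact: retractionF|exact: retractionQ].
Qed.
End Retraction.

(** * Exact graded complexes over a field are contractible *)
Section ExactContraction.
Import classical_sets.
Local Open Scope classical_set_scope.
Variables (K : fieldType) (U : lmodType K) (d : {linear U -> U}).
Hypothesis dd : forall x, d (d x) = 0.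
Hypothesis exact_d : forall x, d x = 0 -> exists y, x = d y.

Let indep (S : set U) :=
  (forall a x y, S x -> S y -> S (a *: x + y)) /\ (forall x, S x -> d x = 0 -> x = 0).

(** A subspace maximal among those that meet the kernel trivially is a complement of
it. *)
Lemma kernel_complement : exists S : set U,
  [/\ forall a x y, S x -> S y -> S (a *: x + y),
      forall x, S x -> d x = 0 -> x = 0 &
      forall x, exists2 s, S s & d s = d x].
Proof.
have [F FP Ftot|S [[Slin Sker] Smax]] := @Zorn_bigcup U indep.
  split=> [a x y [A FA Ax] [B FB By]|x [A FA Ax]]; last by apply: (FP A FA).2.
  have [AB|BA] := Ftot A B FA FB.
    by exists B => //; apply: (FP B FB).1 => //; apply: AB.
  by exists A => //; apply: (FP A FA).1 => //; apply: BA.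
have S0 : S 0.
  apply: contrapT => nS0; apply: (Smax [set 0]).
    split=> [x Sx|/(_ 0 erefl)//].
    by case: nS0; have := Slin (-1) x x Sx Sx; rewrite scaleN1r addNr.
  split=> [a x y -> ->|x -> //]; by rewrite scaler0 addr0.
exists S; split=> // x; apply: contrapT => nx.
apply: (Smax [set y | exists a s, S s /\ y = a *: x + s]).
  split=> [y Sy|SB]; first by exists 0, y; rewrite scale0r add0r.
  apply: nx; exists x => //; apply: SB.
  by exists 1, 0; rewrite scale1r addr0.
split=> [a _ _ [b [s [Ss ->]]] [c [t [St ->]]]|_ [b [s [Ss ->]]]].
  exists (a * b + c), (a *: s + t); split; first exact: Slin.
  by rewrite scalerDr scalerDl scalerA addrACA.
have [->|b0] := eqVneq b 0; first by rewrite scale0r add0r; apply: Sker.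
rewrite linearD linearZ /= => /eqP; rewrite addr_eq0 => /eqP dbx; case: nx.
exists (- b^-1 *: s + 0); first exact: Slin.
by rewrite addr0 linearZ /= scaleNr -scalerN -dbx scalerA mulVf // scale1r.
Qed.

(** On a complement S of the kernel d is injective, with image the whole kernel by
exactness.  Let s be the projection onto S along the kernel; h y is the element of S
that d sends to y - s y. *)
Lemma exact_contraction :
  exists h : {linear U -> U}, forall x, d (h x) + h (d x) = x.
Proof.
have [S [Slin Sker Ssurj]] := kernel_complement.
have Suniq s t : S s -> S t -> d s = d t -> s = t.
  move=> Ss St dst; apply/eqP; rewrite -subr_eq0; apply/eqP; apply: Sker.
    by rewrite addrC -scaleN1r; apply: Slin.
  by rewrite linearB dst subrr.
have /choice[s sP] x : exists s, S s /\ d s = d x.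
  by have [s Ss dE] := Ssurj x; exists s.
have s_lin : linear s.
  move=> a x y; have [Sx dx] := sP x; have [Sy dy] := sP y.
  have [Sz dz] := sP (a *: x + y); apply: Suniq => //; first exact: Slin.
  by rewrite dz !linearP dx dy.
have /choice[h hP] y : exists z, S z /\ d z = y - s y.
  have [|x yx] := @exact_d (y - s y); last by have [Sx dx] := sP x; exists (s x); rewrite dx.
  by rewrite linearB (sP y).2 subrr.
have h_lin : linear h.
  move=> a x y; have [Sx dx] := hP x; have [Sy dy] := hP y.
  have [Sz dz] := hP (a *: x + y); apply: Suniq => //; first exact: Slin.
  rewrite dz linearP dx dy s_lin scalerBr opprD; exact: addrACA.
pose hl : {linear U -> U} := HB.pack h (GRing.isLinear.Build K U U _ h h_lin).
exists hl => y; change (d (h y) + h (d y) = y).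
have [_ ->] := hP y; have [Sh dh] := hP (d y).
suff -> : h (d y) = s y by rewrite subrK.
have [Sy dy] := sP y; apply: Suniq => //; rewrite dh dy.
have [Sdy ddy] := sP (d y); rewrite (Sker (s (d y))) ?subr0 //.
by rewrite ddy dd.
Qed.
End ExactContraction.

Section GradedContraction.
Variables (K : fieldType) (n : nat) (U : gradedSpace K n) (d : {linear U -> U}).
Variable e : 'rV[int]_n.
Hypothesis d_weight : has_weight e d.
Hypothesis dd : forall x, d (d x) = 0.
Hypothesis exact_d : forall x, d x = 0 -> exists y, x = d y.

Lemma weight_pr a x : d (gr_pr U a x) = gr_pr U (a + e) (d x).
Proof.
move: x; apply: hval_eq => [||x].
- exact: (linearP (d \o gr_pr U a)).
- exact: (linearP (gr_pr U (a + e) \o d)).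
have vE := homogP _ _ (valP x); have /homogP dE := d_weight (valP x).
rewrite -/(hval x) -/(hdeg x) in vE dE; rewrite -dE -[in LHS]vE !gr_prK.
by rewrite (inj_eq (addIr _)); case: eqP; rewrite ?vE ?dE // (linear0 d).
Qed.

(** The component of weight -e of an ungraded contraction is again a contraction. *)
Lemma graded_contraction : exists h : {linear U -> U},
  has_weight (- e) h /\ forall x, d (h x) + h (d x) = x.
Proof.
have [h0 h0P] := exact_contraction dd exact_d.
pose hf := gr_sum (fun a (u : U) => gr_pr U (a - e) (h0 u)).
have h_lin : linear hf.
  by apply: gr_sum_linear => a; apply: (linearP (gr_pr U (a - e) \o h0)).
pose h : {linear U -> U} := HB.pack hf (GRing.isLinear.Build K U U _ hf h_lin).
have hE a v : homog a v -> h v = gr_pr U (a - e) (h0 v).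
  move=> av; apply: (gr_sum_homog _ av) => b.
  exact: (linearP (gr_pr U (b - e) \o h0)).
exists h; split=> [a v av|x]; first by rewrite (hE _ _ av) homog_pr.
move: x; apply: hval_eq => [||x].
- exact: (linearP ((d \o h) \+ (h \o d))).
- exact: (linearP (idfun : {linear U -> U})).
rewrite (hE _ _ (valP x)) (hE _ _ (d_weight (valP x))) addrK weight_pr subrK.
by rewrite -linearD h0P; apply/homogP; apply: (valP x).
Qed.
End GradedContraction.

(** * Direct sums, the mapping cone and the cylinder *)
Section DirectSum.
Variables (K : fieldType) (n : nat) (A B : gradedSpace K n).

Definition dsum_pr a (x : A * B) : A * B := (gr_pr A a x.1, gr_pr B a x.2).
Fact dsum_pr_linear a : linear (dsum_pr a).
Proof. by move=> c x y; rewrite /dsum_pr /= !linearP. Qed.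
HB.instance Definition _ a := GRing.isLinear.Build K (A * B)%type (A * B)%type _
  (dsum_pr a) (dsum_pr_linear a).

Fact dsum_prK a b x :
  dsum_pr a (dsum_pr b x) = if a == b then dsum_pr b x else 0.
Proof. by rewrite /dsum_pr /= !gr_prK; case: ifP. Qed.

Fact dsum_fin x : exists s : seq 'rV[int]_n,
  uniq s && (x == \sum_(a <- s) dsum_pr a x).
Proof.
have [uA EA] := gr_suppP x.1; have [uB EB] := gr_suppP x.2.
pose s := undup (gr_supp x.1 ++ gr_supp x.2).
exists s; rewrite undup_uniq /=; apply/eqP.
have sum_s (V : gradedSpace K n) (v : V) : {subset gr_supp v <= s} ->
    v = \sum_(a <- s) gr_pr V a v.
  move=> sub; have lin (a : 'rV[int]_n) : linear (fun u : V => u) by [].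
  have := gr_sumE lin (undup_uniq _) (s := s) (v := v) => <-.
    by rewrite [LHS](gr_suppP v).2.
  move=> a as_; have [_ /gr_pr_out] := gr_suppP v; apply.
  by apply: contra as_; apply: sub.
have sumE (r : seq 'rV[int]_n) :
    \sum_(a <- r) dsum_pr a x =
    (\sum_(a <- r) gr_pr A a x.1, \sum_(a <- r) gr_pr B a x.2).
  by elim: r => [|a r IH]; rewrite ?big_nil // !big_cons IH.
rewrite sumE -!sum_s -?surjective_pairing // => a as_; rewrite mem_undup mem_cat as_ //.
by rewrite orbT.
Qed.

Definition dsum : gradedSpace K n := GradedSpace dsum_prK dsum_fin.
End DirectSum.

Section DirectSumMaps.
Variables (K : fieldType) (n : nat) (A B : gradedSpace K n).

Definition dfst : {linear dsum A B -> A} := (fst : {linear (A * B)%type -> A}).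
Definition dsnd : {linear dsum A B -> B} := (snd : {linear (A * B)%type -> B}).

Lemma homog_dsum a (x : dsum A B) : homog a x -> homog a x.1 /\ homog a x.2.
Proof.
move=> /homogP; case: x => x y [] /= hx hy.
by split; apply/homogP.
Qed.

Lemma homog_pair a (x : A) (y : B) :
  homog a x -> homog a y -> homog a ((x, y) : dsum A B).
Proof.
move=> /homogP hx /homogP hy; apply/homogP.
transitivity ((gr_pr A a x, gr_pr B a y) : dsum A B) => //.
by rewrite hx hy.
Qed.

Lemma dfst_weight : has_weight 0 dfst.
Proof. by move=> a x /homog_dsum[]; rewrite addr0. Qed.

Lemma dsnd_weight : has_weight 0 dsnd.
Proof. by move=> a x /homog_dsum[]; rewrite addr0. Qed.

Variable M : lmodType K.
Variables (f : {linear M -> A}) (g : {linear M -> B}).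
Definition pair_fun (x : M) : dsum A B := (f x, g x).
Fact pair_fun_linear : linear pair_fun.
Proof. by move=> c x y; rewrite /pair_fun !linearP. Qed.
HB.instance Definition _ :=
  GRing.isLinear.Build K M (dsum A B) _ pair_fun pair_fun_linear.
Definition dpair : {linear M -> dsum A B} := pair_fun.
End DirectSumMaps.

Lemma dpair_weight (K : fieldType) n (A B V : gradedSpace K n) c
    (f : {linear V -> A}) (g : {linear V -> B}) :
  has_weight c f -> has_weight c g -> has_weight c (dpair f g).
Proof. by move=> hf hg a v av; apply: homog_pair; [apply: hf|apply: hg]. Qed.

Section Cone.
Variables (K : fieldType) (n : nat) (W W' : gradedSpace K n.+1).
Variables (d : {linear W -> W}) (d' : {linear W' -> W'}) (f : {linear W -> W'}).
Hypotheses (d_weight : has_weight (e1 n) d) (d'_weight : has_weight (e1 n) d').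
Hypotheses (dd : forall x, d (d x) = 0) (dd' : forall x, d' (d' x) = 0).
Hypotheses (f_weight : has_weight 0 f) (fd : forall x, d' (f x) = f (d x)).
Hypothesis f_inj : forall z y, d z = 0 -> f z = d' y -> exists y, z = d y.
Hypothesis f_surj : forall z, d' z = 0 -> exists x y, d x = 0 /\ z = f x + d' y.

Definition cone : gradedSpace K n.+1 := dsum W' (desusp W).

Lemma up_weight : has_weight (e1 n) (up W).
Proof. by []. Qed.

Lemma down_weight : has_weight (- e1 n) (down W).
Proof. by move=> a v av; rewrite /homog /= subrK. Qed.

Definition cone_d : {linear cone -> cone} :=
  dpair ((d' \o @dfst _ _ W' (desusp W)) \- (f \o up W \o @dsnd _ _ W' (desusp W)))
    (\- (down W \o d \o up W \o @dsnd _ _ W' (desusp W))).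

Lemma cone_dE (x : W') (y : W) :
  cone_d ((x, y) : cone) = ((d' x - f y, - d y) : cone).
Proof. by []. Qed.

Lemma cone_d_weight : has_weight (e1 n) cone_d.
Proof.
move=> a [x y] /homog_dsum[/= ax ay]; rewrite cone_dE.
have fy : homog (a + e1 n) (f y) by rewrite -[a + e1 n]addr0; apply: f_weight.
apply: homog_pair; first by apply: homogB => //; apply: d'_weight.
have /homogP dy : homog (a + e1 n + e1 n) (d y) by apply: d_weight.
by apply/homogP; rewrite [LHS]linearN; congr (- _).
Qed.

(** A cycle (x, y) of the cone has d y = 0 and d' x = f y.  As f is injective on
cohomology y = d z, and f z may be subtracted from x to obtain a cycle; as f is
surjective on cohomology this cycle is f z1 up to a boundary. *)
Lemma cone_contraction : exists h : {linear cone -> cone},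
  has_weight (- e1 n) h /\ forall x, cone_d (h x) + h (cone_d x) = x.
Proof.
apply: graded_contraction cone_d_weight _ _ => [[x y0]|[x y0]].
  pose y : W := y0; transitivity
    ((d' (d' x - f y) - f (- d y), (- d (- d y) : W)) : cone) => //.
  by rewrite (linearB d') dd' fd sub0r !linearN !opprK addNr dd.
pose y : W := y0; rewrite (cone_dE x y) => -[/eqP xy /eqP dy].
rewrite oppr_eq0 in dy; rewrite subr_eq0 in xy.
have [z yz] := f_inj (eqP dy) (esym (eqP xy)).
have [|z1 [w [dz1 E]]] := @f_surj (x - f z).
  by rewrite (linearB d') (eqP xy) fd yz subrr.
exists ((w, (- (z + z1) : W)) : cone); rewrite cone_dE.
congr (_, _); last by rewrite (linearN d) opprK (linearD d) dz1 addr0; exact: yz.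
by rewrite (linearN f) opprK (linearD f) addrCA [d' w + _]addrC -E addrC subrK.
Qed.
End Cone.

Fact regroup_cylinder (M : zmodType) (a w u b : M) :
  a + (w - u - (a - b)) = w - (u - b).
Proof.
rewrite !opprB [LHS](AC (1*(2*2)) ((2*(4*3))*(1*5))).
by rewrite [X in _ + X = _]subrr addr0.
Qed.

Section Cylinder.
Variables (K : fieldType) (n : nat) (W W' : gradedSpace K n.+1).
Local Notation e1 := (e1 n).
Local Notation TW := (tcoalg W).
Local Notation TW' := (tcoalg W').
Local Notation pr := (tcoalg_proj W).
Local Notation pr' := (tcoalg_proj W').
Variables (Q : {linear TW -> TW}) (Q' : {linear TW' -> TW'}).
Hypotheses (hQ : is_codifferential e1 Q) (hQ' : is_codifferential e1 Q').
Variable F : {linear TW -> TW'}.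
Hypotheses (hF : is_cohomomorphism F) (FQ : forall x, Q' (F x) = F (Q x)).
Let f : {linear W -> W'} := pr' \o F \o @tcoalg_inj K n.+1 W.
Let d : {linear W -> W} := pr \o Q \o @tcoalg_inj K n.+1 W.
Let d' : {linear W' -> W'} := pr' \o Q' \o @tcoalg_inj K n.+1 W'.
Hypothesis f_inj : forall z y, d z = 0 -> f z = d' y -> exists y, z = d y.
Hypothesis f_surj : forall z, d' z = 0 -> exists x y, d x = 0 /\ z = f x + d' y.

Lemma e1_odd : ksgn K e1 e1 = -1.
Proof.
rewrite /ksgn /pairing (bigD1 ord0) //= big1 ?addr0 => [|i i0].
  by rewrite mxE !eqxx mulr1.
by rewrite mxE (negPf i0) mul0r.
Qed.

(** The third summand is W shifted so that the differential of W + desusp W, sending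
the third coordinate to the second one, has weight e1. *)
Definition cyl : gradedSpace K n.+1 := dsum W' (dsum W (desusp W)).
Local Notation TC := (tcoalg cyl).
Local Notation prC := (tcoalg_proj cyl).

Definition cyl1 : {linear cyl -> W'} := @dfst _ _ W' (dsum W (desusp W)).
Definition cyl2 : {linear cyl -> W} :=
  @dfst _ _ W (desusp W) \o @dsnd _ _ W' (dsum W (desusp W)).
Definition cyl3 : {linear cyl -> W} :=
  up W \o @dsnd _ _ W (desusp W) \o @dsnd _ _ W' (dsum W (desusp W)).

(** Elements of the cylinder with the third coordinate typed in W, so that it can be
compared with the second one. *)
Definition cyl_vec (w' : W') (u v : W) : cyl := (w', (u, (v : desusp W))).

Lemma cyl1_weight : has_weight 0 cyl1.
Proof. exact: dfst_weight. Qed.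

Lemma cyl2_weight : has_weight 0 cyl2.
Proof.
by apply: weight_comp (@dfst_weight _ _ _ _) (@dsnd_weight _ _ _ _) _; rewrite addr0.
Qed.

Lemma cyl3_weight : has_weight e1 cyl3.
Proof.
apply: (weight_comp (c := e1) (d := 0)) _ (@dsnd_weight _ _ _ _) (add0r _).
apply: (weight_comp (c := e1) (d := 0)) _ (@dsnd_weight _ _ _ _) (add0r _).
exact: up_weight.
Qed.

Definition tcyl1 : {linear TC -> TW'} := cohom (cyl1 \o prC).

Lemma tcyl1_cohom : is_cohomomorphism tcyl1.
Proof.
apply: cohom_is_cohom; apply: weight_comp cyl1_weight (@proj_weight _ _ _) _.
by rewrite addr0.
Qed.

(** The product structure: Q' on the first coordinate, and the acyclic differential,
without higher operations, on the other two. *)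
Definition cylQ_corestr : {linear TC -> cyl} :=
  dpair (pr' \o Q' \o tcyl1) (dpair (cyl3 \o prC) (\0 : {linear TC -> desusp W})).

Lemma cylQ_corestrE x : cylQ_corestr x = cyl_vec (pr' (Q' (tcyl1 x))) (cyl3 (prC x)) 0.
Proof. by []. Qed.

Lemma cylQ_corestr_weight : has_weight e1 cylQ_corestr.
Proof.
apply: dpair_weight.
  apply: (weight_comp (c := e1) (d := 0)) _ tcyl1_cohom.1 (add0r _).
  by apply: weight_comp (@proj_weight _ _ _) hQ'.1.1 _; rewrite addr0.
apply: dpair_weight => [|a v _]; last exact: homog0.
exact: (weight_comp cyl3_weight (@proj_weight _ _ _) (add0r _)).
Qed.

Definition cylQ : {linear TC -> TC} := coder e1 cylQ_corestr.

Lemma cylQ_coder : is_coderivation e1 cylQ.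
Proof. exact: coder_is_coder cylQ_corestr_weight. Qed.

Lemma tcyl1_Q x : Q' (tcyl1 x) = tcyl1 (cylQ x).
Proof.
apply: (curvature_eq0 cylQ_coder hQ'.1 tcyl1_cohom) => {}x.
rewrite [RHS]proj_cohom.
transitivity (cyl1 (prC (cylQ x))) => //.
by rewrite proj_coder.
Qed.

Lemma cylQ_codiff : is_codifferential e1 cylQ.
Proof.
split; first exact: cylQ_coder.
apply: (coder_sqr e1_odd cylQ_coder) => x.
rewrite proj_coder cylQ_corestrE -!tcyl1_Q (hQ'.2).
have -> : cyl3 (prC (cylQ x)) = 0 by rewrite proj_coder.
by rewrite linear0.
Qed.

(** Every linear map a : T(W) -> W gives a map (a, a Q) that intertwines Q with the
differential of W + desusp W; taking for a the projection makes the cylinder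
inclusion split injective. *)
Definition cyl_corestr : {linear TW -> cyl} :=
  dpair (pr' \o F) (dpair pr (down W \o pr \o Q)).

Lemma cyl_corestrE x : cyl_corestr x = cyl_vec (pr' (F x)) (pr x) (pr (Q x)).
Proof. by []. Qed.

Lemma cyl_corestr_weight : has_weight 0 cyl_corestr.
Proof.
apply: dpair_weight.
  by apply: weight_comp (@proj_weight _ _ _) hF.1 _; rewrite addr0.
apply: dpair_weight; first exact: proj_weight.
apply: (weight_comp (c := - e1) (d := e1)) _ _ (addrN e1).
  by apply: weight_comp (@down_weight _ _ _) (@proj_weight _ _ _) _; rewrite add0r.
exact: hQ.1.1.
Qed.

Definition cylF : {linear TW -> TC} := cohom cyl_corestr.

Lemma cylF_cohom : is_cohomomorphism cylF.
Proof. exact: cohom_is_cohom cyl_corestr_weight. Qed.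

Lemma tcyl1_F x : tcyl1 (cylF x) = F x.
Proof.
apply: (cohom_ext (cohom_comp tcyl1_cohom cylF_cohom) hF) => y.
rewrite [LHS]proj_cohom.
transitivity (cyl1 (prC (cylF y))) => //.
by rewrite proj_cohom.
Qed.

Lemma cylF_Q x : cylQ (cylF x) = cylF (Q x).
Proof.
apply: (curvature_eq0 hQ.1 cylQ_coder cylF_cohom) => {}x.
rewrite proj_coder cylQ_corestrE tcyl1_F FQ /cylF !proj_cohom !cyl_corestrE (hQ.2).
by rewrite (linear0 pr).
Qed.

Definition cyl_in : {linear W' -> cyl} :=
  dpair (idfun : {linear W' -> W'}) (\0 : {linear W' -> dsum W (desusp W)}).

Lemma cyl_in_weight : has_weight 0 cyl_in.
Proof.
by apply: dpair_weight => a v av; rewrite addr0 //; apply: homog0.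
Qed.

Definition tcyl_in : {linear TW' -> TC} := cohom (cyl_in \o pr').

Lemma tcyl_in_cohom : is_cohomomorphism tcyl_in.
Proof.
apply: cohom_is_cohom; apply: weight_comp cyl_in_weight (@proj_weight _ _ _) _.
by rewrite addr0.
Qed.

Lemma tcyl1_in x : tcyl1 (tcyl_in x) = x.
Proof.
apply: (cohom_ext (cohom_comp tcyl1_cohom tcyl_in_cohom) (id_cohom W')) => y.
rewrite [LHS]proj_cohom.
transitivity (cyl1 (prC (tcyl_in y))) => //.
by rewrite proj_cohom.
Qed.

Lemma tcyl_in_Q x : cylQ (tcyl_in x) = tcyl_in (Q' x).
Proof.
apply: (curvature_eq0 hQ'.1 cylQ_coder tcyl_in_cohom) => {}x.
by rewrite proj_coder cylQ_corestrE tcyl1_in /tcyl_in !proj_cohom.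
Qed.

Let phi1 : {linear W -> cyl} := prC \o cylF \o @tcoalg_inj K n.+1 W.
Let dC : {linear cyl -> cyl} := prC \o cylQ \o @tcoalg_inj K n.+1 cyl.

Lemma phi1E w : phi1 w = cyl_vec (f w) w (d w).
Proof.
transitivity (prC (cylF (tcoalg_inj w))) => //.
by rewrite proj_cohom cyl_corestrE tcoalg_injK.
Qed.

Lemma dCE w' u v : dC (cyl_vec w' u v) = cyl_vec (d' w') v 0.
Proof.
transitivity (prC (cylQ (tcoalg_inj (cyl_vec w' u v)))) => //.
by rewrite proj_coder cylQ_corestrE tcoalg_injK [tcyl1 _]strict_inj.
Qed.

Let d_weight : has_weight e1 d.
Proof.
have prQ := weight_comp (@proj_weight _ _ W) hQ.1.1 (addr0 e1).
exact: weight_comp prQ (@inj_weight _ _ W) (add0r e1).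
Qed.

Let d'_weight : has_weight e1 d'.
Proof.
have prQ := weight_comp (@proj_weight _ _ W') hQ'.1.1 (addr0 e1).
exact: weight_comp prQ (@inj_weight _ _ W') (add0r e1).
Qed.

Let f_weight : has_weight 0 f.
Proof.
apply: (weight_comp (c := 0) (d := 0)) _ (@inj_weight _ _ _) (add0r _).
by apply: weight_comp (@proj_weight _ _ _) hF.1 _; rewrite addr0.
Qed.

Let fd w : d' (f w) = f (d w).
Proof.
transitivity (pr' (Q' (tcoalg_inj (f w)))) => //.
have <- : F (tcoalg_inj w) = tcoalg_inj (f w) by exact: is_cohom_inj hF.
rewrite FQ; have -> : Q (tcoalg_inj w) = tcoalg_inj (d w) by exact: is_coder_inj hQ.1 _.
by [].
Qed.

(** The quotient of the cylinder by the image of the linear part of F: every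
(w', u, v) is congruent to (w' - f u, 0, v - d u) modulo the image of u. *)
Definition cyl_cone : {linear cyl -> cone W W'} :=
  dpair (cyl1 \- (f \o cyl2)) (down W \o (cyl3 \- (d \o cyl2))).

(** A linear section of the quotient map, which is not a chain map. *)
Definition cone_cyl : {linear cone W W' -> cyl} :=
  dpair (@dfst _ _ W' (desusp W))
    (dpair (\0 : {linear cone W W' -> W}) (@dsnd _ _ W' (desusp W))).

Lemma cyl_coneE w' u v :
  cyl_cone (cyl_vec w' u v) = ((w' - f u, (v - d u : W)) : cone W W').
Proof. by []. Qed.

Lemma cyl_cone_weight : has_weight 0 cyl_cone.
Proof.
apply: dpair_weight.
  apply: weightB; first exact: cyl1_weight.
  by apply: weight_comp f_weight cyl2_weight _; rewrite addr0.
apply: weight_comp (@down_weight _ _ _) _ (addrN e1).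
apply: weightB; first exact: cyl3_weight.
by apply: weight_comp d_weight cyl2_weight _; rewrite add0r.
Qed.

Lemma cone_cyl_weight : has_weight 0 cone_cyl.
Proof.
apply: dpair_weight; first exact: dfst_weight.
apply: dpair_weight; last exact: dsnd_weight.
by move=> a v _; apply: homog0.
Qed.

Lemma cyl_vecD w1 u1 v1 w2 u2 v2 :
  cyl_vec w1 u1 v1 + cyl_vec w2 u2 v2 = cyl_vec (w1 + w2) (u1 + u2) (v1 + v2).
Proof. by []. Qed.

Lemma cyl_vecB w1 u1 v1 w2 u2 v2 :
  cyl_vec w1 u1 v1 - cyl_vec w2 u2 v2 = cyl_vec (w1 - w2) (u1 - u2) (v1 - v2).
Proof. by []. Qed.

(** With kappa = cyl_cone, sigma = cone_cyl and a contraction hU of the cone, take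
h = sigma hU kappa.  Then h kills the image of the linear part, and the failure of
sigma to be a chain map, which lies in that image, is absorbed in rho. *)
Lemma cylinder_contraction : exists (rho : {linear cyl -> W}) (h : {linear cyl -> cyl}),
  [/\ has_weight 0 rho, has_weight (- e1) h, forall w, h (phi1 w) = 0 &
      forall x, dC (h x) + h (dC x) = x - phi1 (rho x)].
Proof.
have dd x : d (d x) = 0 by apply: (dW_sqr hQ).
have dd' x : d' (d' x) = 0 by apply: (dW_sqr hQ').
have [hU [hU_weight hUE]] :=
  cone_contraction d_weight d'_weight dd dd' f_weight fd f_inj f_surj.
pose chi : {linear cone W W' -> W} := up W \o @dsnd _ _ W' (desusp W).
pose rho : {linear cyl -> W} := cyl2 \- (chi \o (hU \o cyl_cone)).
pose h : {linear cyl -> cyl} := cone_cyl \o (hU \o cyl_cone).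
have hk_weight : has_weight (- e1) (hU \o cyl_cone).
  by apply: weight_comp hU_weight cyl_cone_weight _; rewrite add0r.
exists rho, h; split.
- apply: weightB; first exact: cyl2_weight.
  apply: (weight_comp (c := e1) (d := - e1)) _ hk_weight (addNr e1).
  by apply: weight_comp (@up_weight _ _ _) (@dsnd_weight _ _ _ _) _; rewrite add0r.
- by apply: weight_comp cone_cyl_weight hk_weight _; rewrite addr0.
- move=> w; transitivity (cone_cyl (hU (cyl_cone (phi1 w)))) => //.
  rewrite phi1E cyl_coneE !subrr.
  by rewrite [hU _](linear0 hU) (linear0 cone_cyl).
move=> [w' [u v0]]; pose v : W := v0.
set x : cyl := (w', (u, v0)).
have kx : cyl_cone x = (w' - f u, (v - d u : W)) by [].
have kdx : cyl_cone (dC x) = cone_d d d' f (cyl_cone x).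
  rewrite kx cone_dE [dC x](dCE w' u v) cyl_coneE sub0r.
  congr (_, - _); last by rewrite linearB dd subr0.
  rewrite (linearB d') (linearB f) fd; apply/esym; rewrite opprB addrA.
  by rewrite subrK.
case E : (hU (cyl_cone x)) => [a b0]; pose b : W := b0.
have hx : h x = cyl_vec a 0 b by rewrite -[LHS]/(cone_cyl (hU (cyl_cone x))) E.
have rx : rho x = u - b by rewrite -[LHS]/(u - chi (hU (cyl_cone x))) E.
have hdx : h (dC x) = cyl_vec (w' - f u - (d' a - f b)) 0 (v - d u - (- d b)).
  rewrite -[LHS]/(cone_cyl (hU (cyl_cone (dC x)))) kdx.
  have -> : hU (cone_d d d' f (cyl_cone x)) =
      cyl_cone x - cone_d d d' f (hU (cyl_cone x)).
    by rewrite -[X in X - _](hUE (cyl_cone x)) addrAC subrr add0r.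
  by rewrite E [cone_d _ _ _ _](cone_dE d d' f a b) kx.
rewrite hx hdx dCE rx phi1E -[x]/(cyl_vec w' u v) cyl_vecD cyl_vecB.
rewrite (linearB f) (linearB d); congr cyl_vec.
- exact: regroup_cylinder.
- by rewrite addr0 subKr.
by rewrite add0r opprK -addrA opprB [- d u + _]addrC.
Qed.

(** The conclusion on cycles z says that the linear part of G is a left inverse of f on
cohomology. *)
Theorem cohomomorphism_quasi_inverse : exists G : {linear TW' -> TW},
  [/\ is_cohomomorphism G, forall x, Q (G x) = G (Q' x) &
      forall z, d z = 0 -> exists y, z = pr (G (tcoalg_inj (f z))) + d y].
Proof.
have [rho [h [rho_weight h_weight hphi hP]]] := cylinder_contraction.
have lF x : cyl2 (prC (cylF x)) = pr x by rewrite proj_cohom.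
have [R [R_cohom RF RQ]] := cohomomorphism_retraction e1_odd hQ cylQ_codiff
  cylF_cohom cylF_Q cyl2_weight rho_weight h_weight lF hphi hP.
exists (R \o tcyl_in); split=> [|x|z dz].
- exact: cohom_comp R_cohom tcyl_in_cohom.
- transitivity (Q (R (tcyl_in x))) => //.
  by rewrite RQ tcyl_in_Q.
pose r1 : {linear cyl -> W} := pr \o R \o @tcoalg_inj _ _ cyl.
have r1_phi w : r1 (phi1 w) = w.
  transitivity (pr (R (tcoalg_inj (phi1 w)))) => //.
  have <- : cylF (tcoalg_inj w) = tcoalg_inj (phi1 w) by exact: is_cohom_inj cylF_cohom.
  by rewrite RF tcoalg_injK.
have r1_d x : r1 (dC x) = d (r1 x).
  transitivity (pr (R (tcoalg_inj (dC x)))) => //.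
  have <- : cylQ (tcoalg_inj x) = tcoalg_inj (dC x) by exact: is_coder_inj cylQ_coder _.
  rewrite -RQ; have -> : R (tcoalg_inj x) = tcoalg_inj (r1 x) by exact: is_cohom_inj R_cohom.
  by [].
exists (r1 (cyl_vec 0 0 z)).
have -> : pr ((R \o tcyl_in) (tcoalg_inj (f z))) = r1 (cyl_vec (f z) 0 0).
  transitivity (pr (R (tcyl_in (tcoalg_inj (f z))))) => //.
  by rewrite [tcyl_in _]strict_inj.
rewrite -r1_d dCE (linear0 d') -[LHS](r1_phi z) phi1E dz -(linearD r1) cyl_vecD.
by rewrite addr0 add0r addr0.
Qed.
End Cylinder.

(** * Cohomology classes and the theorem *)
Section CohomologyClasses.
Variables (K : fieldType) (V : lmodType K) (d : {linear V -> V}).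

(** The boundaries already form a subspace, so the span in the definition of
cohomology adds nothing. *)
Lemma cohom_classP (z t : cycles d) :
  cohom_class z = cohom_class t <-> exists y, val z = val t + d y.
Proof.
split=> [/lpiP zt|[y zE]].
  pose P : {pred cycles d} := [pred u | `[< exists y, val u = d y >]].
  have Pclosed : submod_closed P.
    split=> [|a u v]; first by apply/asboolP; exists 0; rewrite linear0.
    move=> /asboolP[x xE] /asboolP[y yE]; apply/asboolP; exists (a *: x + y).
    by rewrite linearP -xE -yE.
  have := lspan_ind Pclosed (fun u (hu : exists y, val u = d y) => introT (asboolP _) hu) zt.
  by move=> /asboolP[y yE]; exists y; rewrite -yE addrC subrK.
apply/lpiP/lspan_gen; exists y.
by transitivity (val z - val t) => //; rewrite zE addrAC subrr add0r.
Qed.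

Lemma cohom_class0P (z : cycles d) : cohom_class z = 0 <-> exists y, val z = d y.
Proof.
have <- : cohom_class (0 : cycles d) = 0 by exact: linear0.
split=> [/cohom_classP[y yE]|[y yE]]; first by exists y; rewrite yE add0r.
by apply/cohom_classP; exists y; rewrite yE add0r.
Qed.

Lemma cohom_class_surj (c : cohomology d) : exists z, c = cohom_class z.
Proof. by exists (lrepr c); rewrite [RHS]lreprK. Qed.

Lemma cycle_val (z : cycles d) : d (val z) = 0.
Proof. by have /eqP := valP z. Qed.

Lemma cycle_of v : d v = 0 -> exists z : cycles d, val z = v.
Proof. by move=> /eqP dv; exists (exist _ v dv). Qed.
End CohomologyClasses.

Section Corestrictions.
Variables (K : fieldType) (n : nat).

Lemma lod_pi1E (V : lodAlgebra K n) v :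
  lod_pi1 V v = tcoalg_proj (desusp V) (lod_Q V (tcoalg_inj (down V v))).
Proof. by rewrite -down_tens_inj. Qed.

Lemma lod_f1E (V V' : lodAlgebra K n) (f : lodMorphism V V') v :
  lod_f1 f v = tcoalg_proj (desusp V') (lod_F f (tcoalg_inj (down V v))).
Proof. by rewrite -down_tens_inj. Qed.

Variables (V V' : lodAlgebra K n) (f : lodMorphism V V').

Lemma sharp_inj : injective (lod_f1_sharp f) -> forall z y,
  lod_pi1 V z = 0 -> lod_f1 f z = lod_pi1 V' y -> exists y, z = lod_pi1 V y.
Proof.
move=> finj z y /cycle_of[c <-] fz.
apply/cohom_class0P; apply: finj.
have -> : lod_f1_sharp f 0 = 0 by exact: linear0.
by rewrite [LHS]cohomology_mapE; apply/cohom_class0P; exists y.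
Qed.

Lemma sharp_surj : (forall c, exists b, c = lod_f1_sharp f b) -> forall z,
  lod_pi1 V' z = 0 ->
  exists x y, lod_pi1 V x = 0 /\ z = lod_f1 f x + lod_pi1 V' y.
Proof.
move=> fsurj z /cycle_of[c <-].
have [b] := fsurj (cohom_class c); have [x ->] := cohom_class_surj b.
rewrite [RHS]cohomology_mapE => /cohom_classP[y ->].
by exists (val x), y; split=> //; apply: cycle_val.
Qed.

Lemma sharp_cancel (g : lodMorphism V' V) :
  (forall z, lod_pi1 V z = 0 ->
     exists y, z = lod_f1 g (lod_f1 f z) + lod_pi1 V y) ->
  cancel (lod_f1_sharp f) (lod_f1_sharp g).
Proof.
move=> gf c; have [z ->] := cohom_class_surj c.
rewrite [lod_f1_sharp f _]cohomology_mapE [LHS]cohomology_mapE; apply/esym.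
by apply/cohom_classP; have [y yE] := gf _ (cycle_val z); exists y.
Qed.
End Corestrictions.

Theorem theorem5 (K : fieldType) (charK0 : [pchar K]%R =i pred0) (n : nat)
    (V V' : lodAlgebra K n) (f : lodMorphism V V') (qf : lod_quasi_iso f) :
  exists g : lodMorphism V' V,
    lod_quasi_iso g /\
    (cancel (lod_f1_sharp f) (lod_f1_sharp g) /\
     cancel (lod_f1_sharp g) (lod_f1_sharp f)).
Proof.
have [G [G_cohom GQ Gf]] : exists G : {linear tcoalg (desusp V') -> tcoalg (desusp V)},
    [/\ is_cohomomorphism G, forall x, lod_Q V (G x) = G (lod_Q V' x) &
        forall z : V, lod_pi1 V z = 0 -> exists y : V,
          z = tcoalg_proj (desusp V) (G (tcoalg_inj (down V' (lod_f1 f z)))) +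
              lod_pi1 V y].
  have [||G [G_cohom GQ Gf]] := cohomomorphism_quasi_inverse (lod_codiff V)
    (lod_codiff V') (lod_cohom f) (lod_comm f).
  - move=> z y; have := sharp_inj (bij_inj qf) (z := z) (y := y).
    rewrite lod_pi1E lod_f1E lod_pi1E => H dz fz; have [x xE] := H dz fz.
    by exists x; rewrite {1}xE lod_pi1E.
  - move=> z dz; have dz' : lod_pi1 V' z = 0 by rewrite lod_pi1E.
    have fsurj c : exists b, c = lod_f1_sharp f b.
      by case: qf => b _ bK; exists (b c); rewrite bK.
    have [x [y [dx zE]]] := sharp_surj fsurj dz'.
    rewrite lod_pi1E in dx; rewrite lod_f1E lod_pi1E in zE.
    by exists x, y.
  exists G; split=> // z dz; have [|y yE] := Gf z.
    by rewrite lod_pi1E in dz.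
  by exists y; rewrite lod_pi1E lod_f1E.
pose g := LodMorphism G_cohom GQ.
have fg : cancel (lod_f1_sharp f) (lod_f1_sharp g).
  by apply: sharp_cancel => z dz; have [y yE] := Gf z dz; exists y; rewrite lod_f1E.
exists g; split; first exact: (bij_can_bij qf fg).
by split=> //; exact: (proj2 (bij_can_sym qf _) fg).
Qed.
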